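(* Let $(M,C)$ be a contact manifold, let $(P,\omega)$ be its symplectic cover with projection $\tau:P\to M$, and let $\mathfrak{s}$ be a calibration on $P$. Let $\tilde M=\{\mathfrak{s}=1\}\subset P$ and let $p=\tau|_{\tilde M}:\tilde M\to M$ be the resulting 2-sheeted cover. Then the pullback contact structure $p^*C$ on $\tilde M$ admits a canonical global contact form $\tilde\eta$, namely the restriction to $\tilde M$ of the Liouville form $\vartheta$ on $P$, and there are an open covering $\{U_\alpha\}$ of $M$ and local contact forms $\eta_\alpha$ on $U_\alpha$ inducing $C$ on $U_\alpha$ such that, on the two sheets of $\tilde M$ covering $U_\alpha$, $\tilde\eta$ is $\pm\eta_\alpha$. In other words, one can find an open covering $\{U_\alpha\}$ of $M$ and local contact forms $\eta_\alpha$ inducing $C$ on $U_\alpha$ such that $\eta_\alpha=\pm\eta_\beta$ on $U_\alpha\cap U_\beta$.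
   Context: A contact manifold $(M,C)$ is a manifold of odd dimension $2n+1$ with a corank-one distribution $C\subset TM$ which is locally the kernel of a contact form, i.e. a 1-form $\eta$ with $\eta\wedge(\mathrm{d}\eta)^n\neq0$; such $\eta$ with $\ker\eta=C$ is said to induce $C$. A symplectic $\mathbb{R}^\times$-bundle is a principal bundle $\tau:P\to M$ with group $\mathbb{R}^\times$ (nonzero reals under multiplication), action $s\mapsto h_s$, and a symplectic form $\omega$ with $h_s^*\omega=s\,\omega$ for all $s\in\mathbb{R}^\times$; $\nabla$ is the infinitesimal generator of the action and $\vartheta=i_\nabla\omega$ is the Liouville 1-form. It is a symplectic cover of $(M,C)$ if $C=T\tau(\ker\vartheta)$; it exists and is unique up to isomorphism. A calibration on $P$ is a smooth function $\mathfrak{s}:P\to\mathbb{R}$, $\mathfrak{s}>0$, with $\mathfrak{s}(h_t(p))=|t|\,\mathfrak{s}(p)$ for all $t\in\mathbb{R}^\times$. The pullback distribution is $p^*C=(Tp)^{-1}(C)$. The sign in $\pm$ is locally constant. *)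

(* Defs.v *)
From HB Require Import structures.
From mathcomp Require Export all_boot all_order all_algebra all_fingroup.
From mathcomp Require Export all_classical all_reals all_analysis.

Set Implicit Arguments.
Unset Strict Implicit.
Unset Printing Implicit Defensive.

Import Order.TTheory GRing.Theory Num.Theory.
Import numFieldNormedType.Exports.

#[global] Open Scope classical_set_scope.
#[global] Open Scope ring_scope.

(* Conventions.  Manifolds are C^oo, Hausdorff and second countable, given by
   an atlas.  Tensors are given by their components: a tangent vector at p is
   represented in a chart c around p by a vector v of the model space, and the
   pairs (c, v) and (d, w) represent the same tangent vector when w is the image
   of v under the derivative of the change of charts at c(p).  Maps are total;
   a chart, form or distribution is only meaningful on its domain. *)

Section Smooth.
Context {R : realType} {E F : normedModType R}.

(* For finite-dimensional E and open U, this is C^k regularity on U. *)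
Fixpoint Ck_on (k : nat) (U : set E) (f : E -> F) : Prop :=
  if k is k'.+1 then
    (forall x, U x -> differentiable f x) /\
    (forall v, Ck_on k' U (fun x => 'D_v f x))
  else forall x, U x -> {for x, continuous f}.

Definition smooth_on (U : set E) (f : E -> F) : Prop := forall k, Ck_on k U f.

End Smooth.

Section Charted.
Context {R : realType}.

Record chart (E : normedModType R) (M : topologicalType) := Chart {
  dom : set M;
  fwd : M -> E;
  inv : E -> M }.

Record charted (E : normedModType R) := Charted {
  space :> topologicalType;
  atlas : set (chart E space) }.

Arguments atlas {E} c.

Definition cdom (E : normedModType R) (M : topologicalType)
    (U : set M) (c : chart E M) : set E :=
  [set x | (fwd c @` dom c) x /\ U (inv c x)].

(* The coordinate image of the whole domain of c. *)
Definition cimg (E : normedModType R) (M : topologicalType) (c : chart E M) :=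
  cdom setT c.

Record is_chart (E : normedModType R) (M : topologicalType)
    (c : chart E M) : Prop := IsChart {
  chart_dom_open : open (dom c);
  chart_img_open : open (fwd c @` dom c);
  chart_fwdK : forall p, dom c p -> inv c (fwd c p) = p;
  chart_fwd_cont : forall p, dom c p -> {for p, continuous (fwd c)};
  chart_inv_cont : forall x, (fwd c @` dom c) x -> {for x, continuous (inv c)} }.

Definition loc_rep (E F : normedModType R) (M N : topologicalType) (f : M -> N)
    (c : chart E M) (d : chart F N) : E -> F :=
  fun x => fwd d (f (inv c x)).

Record smooth_manifold (E : normedModType R) (M : charted E) : Prop :=
  SmoothManifold {
  mfd_hausdorff : hausdorff_space M;
  mfd_second_countable : @second_countable M;
  mfd_chart : forall c, atlas M c -> is_chart c;
  mfd_cover : forall p : M, exists2 c, atlas M c & dom c p;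
  mfd_compat : forall c d, atlas M c -> atlas M d ->
    smooth_on (cdom (dom d) c) (loc_rep (@id M) c d) }.

(* Smoothness of f on the open subset W of M. *)
Definition smooth_map_on (E F : normedModType R) (M : charted E) (N : charted F)
    (W : set M) (f : M -> N) : Prop :=
  (forall p, W p -> {for p, continuous f}) /\
  (forall c d, atlas M c -> atlas N d ->
     smooth_on (cdom (W `&` f @^-1` dom d) c) (loc_rep f c d)).

(* f restricts to a diffeomorphism from the open set A onto the open set B. *)
Definition diffeo_on (E F : normedModType R) (M : charted E) (N : charted F)
    (A : set M) (B : set N) (f : M -> N) : Prop :=
  exists g : N -> M,
    [/\ smooth_map_on A f /\ smooth_map_on B g,
        (forall p, A p -> B (f p)), (forall q, B q -> A (g q)),
        (forall p, A p -> g (f p) = p) & (forall q, B q -> f (g q) = q)].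

Definition model (E : normedModType R) : charted E :=
  @Charted E E [set Chart setT id id].

Definition line : charted R^o := model R^o.

Definition Rx : set line := [set t | (t : R) != 0].

Definition prod_chart (E F : normedModType R) (M N : topologicalType)
    (c : chart E M) (d : chart F N) : chart (E * F)%type (M * N)%type :=
  Chart (dom c `*` dom d)
        (fun p => (fwd c p.1, fwd d p.2)) (fun x => (inv c x.1, inv d x.2)).

Definition prod_charted (E F : normedModType R) (M : charted E) (N : charted F)
    : charted (E * F)%type :=
  @Charted (E * F)%type (M * N)%type
    [set e | exists c d, [/\ atlas M c, atlas N d & e = prod_chart c d]].

(* A subset S of P with the subspace topology; its charts are the inverses of
   the local parametrizations of S, i.e. of the homeomorphisms from open subsets
   of E onto open subsets of S that are smooth immersions into P.  Thus S is an
   embedded submanifold modelled on E iff smooth_manifold (subcharted E S). *)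
Definition subcharted (E F : normedModType R) (P : charted F) (S : set P)
    : charted E :=
  @Charted E (set_type S)
    [set c | [/\ is_chart c,
       @smooth_map_on _ _ (model E) P (cimg c) (fun x => set_val (inv c x)) &
       forall d x, atlas P d ->
         cdom ((fun q : set_type S => set_val q) @^-1` dom d) c x ->
         injective ('d (loc_rep (fun q : set_type S => set_val q) c d) x)]].

End Charted.

Arguments atlas {R E} c.
Arguments subcharted {R} E {F P} S.

Section Exterior.
Context {R : realType} {E : normedModType R}.

Definition vcons (k : nat) (u : E) (v : 'I_k -> E) : 'I_k.+1 -> E :=
  fun i => if unlift ord0 i is Some j then v j else u.

Definition multilinear (k : nat) (a : ('I_k -> E) -> R) : Prop :=
  forall (i : 'I_k) (v : 'I_k -> E) (r : R) (u w : E),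
    a (dfwith v i (r *: u + w)) = r * a (dfwith v i u) + a (dfwith v i w).

Definition alternating (k : nat) (a : ('I_k -> E) -> R) : Prop :=
  forall (v : 'I_k -> E) (i j : 'I_k), i != j -> v i = v j -> a v = 0.

Definition wedge (k l : nat) (a : ('I_k -> E) -> R) (b : ('I_l -> E) -> R)
    : ('I_(k + l) -> E) -> R :=
  fun v => (k`! * l`!)%:R^-1 *
    \sum_(s : 'S_(k + l)) (-1) ^+ s *
       (a (fun i => v (s (lshift l i))) * b (fun j => v (s (rshift k j)))).

Fixpoint wedge_pow (k : nat) (b : ('I_k -> E) -> R) (n : nat)
    : ('I_(n * k) -> E) -> R :=
  match n with
  | 0 => fun=> 1
  | n'.+1 => wedge b (@wedge_pow k b n')
  end.

Definition ext_d (k : nat) (a : E -> ('I_k -> E) -> R)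
    : E -> ('I_k.+1 -> E) -> R :=
  fun x v => \sum_(i < k.+1) (-1) ^+ i *
    'D_(v i) (fun y => a y (fun j => v (lift i j)) : R^o) x.

End Exterior.

Arguments wedge_pow {R E k} b n.

Section Forms.
Context {R : realType}.

(* a c x v is the value at the point with coordinates x in the chart c on the
   tangent vectors with components v in c. *)
Definition form (k : nat) (E : normedModType R) (M : charted E) :=
  chart E M -> E -> ('I_k -> E) -> R.

Definition distribution (E : normedModType R) (M : charted E) :=
  chart E M -> E -> set E.

Record diff_form (k : nat) (E : normedModType R) (M : charted E) (U : set M)
    (a : form k M) : Prop := DiffForm {
  form_linear : forall c x, atlas M c -> cdom U c x -> multilinear (a c x);
  form_alt : forall c x, atlas M c -> cdom U c x -> alternating (a c x);
  form_smooth : forall c v, atlas M c ->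
    smooth_on (cdom U c) (fun x => a c x v : R^o);
  form_compat : forall c d x v, atlas M c -> atlas M d ->
    cdom (U `&` dom d) c x ->
    a c x v = a d (loc_rep (@id M) c d x)
                  (fun i => 'd (loc_rep (@id M) c d) x (v i)) }.

Definition form_eq_on (k : nat) (E : normedModType R) (M : charted E)
    (U : set M) (a b : form k M) : Prop :=
  forall c x v, atlas M c -> cdom U c x -> a c x v = b c x v.

Definition form_scale (k : nat) (E : normedModType R) (M : charted E)
    (r : R) (a : form k M) : form k M :=
  fun c x v => r * a c x v.

(* The value of f^* a, computed in any chart of N around the image point; it does
   not depend on that chart when a is a form. *)
Definition pullback (k : nat) (E F : normedModType R)
    (M : charted E) (N : charted F) (f : M -> N) (a : form k N) : form k M :=
  fun c x v => xget 0
    [set r | exists d, [/\ atlas N d, dom d (f (inv c x)) &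
       r = a d (loc_rep f c d x) (fun i => 'd (loc_rep f c d) x (v i))]].

Definition pullback_distr (E F : normedModType R)
    (M : charted E) (N : charted F) (f : M -> N) (C : distribution N)
    : distribution M :=
  fun c x v => exists d, [/\ atlas N d, dom d (f (inv c x)) &
    C d (loc_rep f c d x) ('d (loc_rep f c d) x v)].

Definition kernel_of (E : normedModType R) (M : charted E) (a : form 1 M)
    : distribution M :=
  fun c x v => a c x (fun=> v) = 0.

(* The subset T f (D) of the tangent bundle of N. *)
Definition image_distr (E F : normedModType R)
    (M : charted E) (N : charted F) (f : M -> N) (D : distribution M)
    : distribution N :=
  fun d y w => exists c x v,
    [/\ atlas M c, cimg c x, f (inv c x) = inv d y, D c x v &
        'd (loc_rep f c d) x v = w].

Definition distr_eq_on (E : normedModType R) (M : charted E)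
    (U : set M) (C D : distribution M) : Prop :=
  forall c x v, atlas M c -> cdom U c x -> C c x v <-> D c x v.

End Forms.

Section Contact.
Context {R : realType} {n : nat} {M : charted 'rV[R]_(2 * n).+1}.

Definition contact_form (U : set M) (eta : form 1 M) : Prop :=
  diff_form U eta /\
  forall c x, atlas M c -> cdom U c x ->
    exists v, wedge (eta c x) (wedge_pow (ext_d (eta c) x) n) v != 0.

Definition induces (U : set M) (eta : form 1 M) (C : distribution M) : Prop :=
  distr_eq_on U C (kernel_of eta).

Definition contact_structure (C : distribution M) : Prop :=
  forall q : M, exists (U : set M) (eta : form 1 M),
    [/\ open U, U q, contact_form U eta & induces U eta C].

End Contact.

Section SymplecticBundle.
Context {R : realType} {EP EM : normedModType R}.
Context {P : charted EP} {M : charted EM}.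

Record symplectic_form (omega : form 2 P) : Prop := SymplecticForm {
  sympl_form : diff_form setT omega;
  sympl_closed : forall c x v, atlas P c -> cimg c x -> ext_d (omega c) x v = 0;
  sympl_nondeg : forall c x u, atlas P c -> cimg c x ->
    (forall w, omega c x (vcons u (fun=> w)) = 0) -> u = 0 }.

(* Only the values h s for s != 0 are meaningful. *)
Record principal_bundle (tau : P -> M) (h : R -> P -> P) : Prop :=
  PrincipalBundle {
  act_one : forall p, h 1 p = p;
  act_mul : forall s t p, s != 0 -> t != 0 -> h s (h t p) = h (s * t) p;
  act_smooth : @smooth_map_on _ _ _ (prod_charted line P) P
    (Rx `*` setT) (fun tp => h tp.1 tp.2);
  act_fiber : forall t p, t != 0 -> tau (h t p) = tau p;
  proj_smooth : smooth_map_on setT tau;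
  loc_trivial : forall q : M, exists (U : set M) (phi : P -> R),
    [/\ open U, U q,
        (forall t p, t != 0 -> U (tau p) -> phi (h t p) = t * phi p) &
        @diffeo_on _ _ _ P (prod_charted line M)
          (tau @^-1` U) (Rx `*` U) (fun p => (phi p : R^o, tau p))] }.

Record symplectic_bundle (tau : P -> M) (h : R -> P -> P) (omega : form 2 P)
    : Prop := SymplecticBundle {
  sb_principal : principal_bundle tau h;
  sb_symplectic : symplectic_form omega;
  sb_homogeneous : forall s, s != 0 ->
    form_eq_on setT (pullback (h s) omega) (form_scale s omega) }.

(* The Lie algebra of R^x is R with exponential map exp, so the generator is
   d/dt h_(exp t) at t = 0, that is d/ds h_s at s = 1. *)
Definition generator (h : R -> P -> P) (c : chart EP P) (x : EP) : EP :=
  derive1 (fun s : R => fwd c (h s (inv c x))) 1.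

Definition liouville (h : R -> P -> P) (omega : form 2 P) : form 1 P :=
  fun c x v => omega c x (vcons (generator h c x) v).

Definition symplectic_cover (tau : P -> M) (h : R -> P -> P) (omega : form 2 P)
    (C : distribution M) : Prop :=
  symplectic_bundle tau h omega /\
  distr_eq_on setT C (image_distr tau (kernel_of (liouville h omega))).

Record calibration (h : R -> P -> P) (s : P -> R) : Prop := Calibration {
  calib_smooth : @smooth_map_on _ _ _ P line setT s;
  calib_pos : forall p, 0 < s p;
  calib_homogeneous : forall t p, t != 0 -> s (h t p) = `|t| * s p }.

End SymplecticBundle.

(* Main.v *)
(* The function s is locally the absolute value of a function psi with
   psi(h_t p) = t psi(p), and psi = 1 defines a local section sigma of tau.  The
   level set {s = 1} is thus locally the union of the images of sigma and
   h_(-1) o sigma, which gives its charts and the two sheets over U.  With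
   theta = i_nabla omega, homogeneity and closedness of omega give d theta = omega,
   and h_t^* theta = t theta, so eta = sigma^* theta on U pulls back to theta on one
   sheet and to - theta on the other; two sections differ locally by h_(+-1).
   A map f into P with s o f = 1 is transverse to nabla because ds(nabla) = s; if f
   is an immersion of a (2n+1)-manifold, then f^* omega is nondegenerate on the
   kernel of f^* theta.  Evaluating the wedge product on a symplectic basis of that
   kernel, completed by one vector, all terms of the sum over permutations are
   nonnegative and one is positive, so f^* theta is a contact form. *)

(* Differentiating [h_t^* omega = t omega] at [t = 1] gives [L_nabla omega = omega]; Cartan's
   formula and closedness turn this into [d theta = omega]. For the nondegeneracy, transversality
   splits each tangent space of [P] along [f] as the line of [nabla] plus the image of [Tf]. If [u]
   is in the kernel of [f^* theta] and [f^* omega]-orthogonal to that kernel, then [omega(Tf u, .)]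
   vanishes on the kernel of [omega(nabla, .)]; so [Tf u] is a multiple of [nabla], and it is zero
   because [ds] kills [Tf u] but not [nabla]. The atlas of the level set contains every immersive
   parametrization, so arbitrary charts must be compared. Each is compared with a chart [y o tau] on
   a sheet, and one direction of the comparison needs smoothness of an inverse map already known to
   be continuous. Since smoothness means iterated derivatives in fixed directions, the chain rule at
   each order expands moving directions in a finite family. Replacing a section and its function by
   [h_(-1) o sigma] and [- psi] preserves every normalization, so each statement is proved only for
   the sheet [psi > 0]. *)
From HB Require Import structures.
Require Import Defs.
From mathcomp Require Import zify ring lra.

Set Implicit Arguments.
Unset Strict Implicit.
Unset Printing Implicit Defensive.

Import Order.TTheory GRing.Theory Num.Theory.
Import numFieldNormedType.Exports.

(** * Differential calculus *)

Section Calculus.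
Context {R : realType}.
Implicit Types E F G : normedModType R.

Lemma differentiable_diffP E F (f : E -> F) (df : {linear E -> F}) (x : E) :
  continuous df ->
  (forall e : R, 0 < e -> \forall h \near (0 : E),
     `|f (h + x) - f x - df h| <= e * `|h|) ->
  differentiable f x /\ 'd f x = df :> (E -> F).
Proof.
move=> dfc H.
have E1 : f \o shift x = cst (f x) + df +o_ (0 : E) id.
  apply/eqaddoP => e e0; apply: filterS (H e e0) => h /=.
  by rewrite /= !fctE /= opprD addrA.
have D := diff_unique dfc E1; split=> //.
apply/diff_locallyP; split; first by rewrite D.
by rewrite D.
Qed.

Lemma near_eq_diff E F (f g : E -> F) (x : E) :
  (\near x, f x = g x) -> differentiable f x ->
  differentiable g x /\ 'd g x = 'd f x :> (E -> F).
Proof.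
move=> fg df; apply: differentiable_diffP => [|e e0]; first exact: diff_continuous.
have := diff_locally df => /eqaddoP /(_ e e0) H.
have fg' : \forall h \near (0 : E), f (h + x) = g (h + x).
  by move: fg; rewrite (near_shift (0:E) x); apply: filterS => h /=; rewrite subr0.
near=> h.
have -> : g (h + x) = f (h + x) by apply/esym; near: h.
rewrite -(nbhs_singleton fg) -addrA -opprD.
by near: h; apply: filterS H => h /=; rewrite !fctE.
Unshelve. all: by end_near. Qed.

Lemma near_eq_continuous (T U : topologicalType) (f g : T -> U) x :
  (\near x, f x = g x) -> {for x, continuous f} -> {for x, continuous g}.
Proof.
move=> fg cf; rewrite /prop_for /continuous_at -(nbhs_singleton fg).
exact: cvg_trans (near_eq_cvg fg) cf.
Qed.

Lemma near_eq_near (T : topologicalType) (U : Type) (f g : T -> U) (x : T) :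
  (\forall z \near x, f z = g z) -> \forall y \near x, \forall z \near y, f z = g z.
Proof. exact: nbhs_interior. Qed.

Lemma Ck_on_near_eq k E F (f g : E -> F) (x : E) :
  (\near x, f x = g x) -> Ck_on k [set x] f -> Ck_on k [set x] g.
Proof.
elim: k f g => [|k IH] f g fg /=.
  by move=> cf y ->; apply: near_eq_continuous fg _; exact: cf.
move=> [df Df]; split=> [y ->|v]; first by have [] := near_eq_diff fg (df _ erefl).
apply: IH (Df v); near=> y.
by apply: near_eq_derive; near: y; exact: near_eq_near.
Unshelve. all: by end_near. Qed.

(** The derivatives in [Ck_on] are those of the total function, not of its restriction, so the
    condition can be tested point by point. This makes singletons meaningful and lets regularity be
    localized. *)
Lemma Ck_onP k E F (U : set E) (f : E -> F) :
  Ck_on k U f <-> forall x, U x -> Ck_on k [set x] f.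
Proof.
elim: k f => [|k IH] f /=; first by split=> [H x Ux _ ->|H x Ux]; [exact: H|exact: H Ux x erefl].
split=> [[df Df] x Ux|H].
  by split=> [_ ->|v]; [exact: df|move/IH: (Df v); exact].
by split=> [x Ux|v]; [have [+ _] := H x Ux; exact|apply/IH => x /H[]].
Qed.

Definition Ck_at k E F (f : E -> F) (x : E) := \forall y \near x, Ck_on k [set y] f.

(** The neighbourhood may depend on [k]; smoothness at all points of an open set is still the same
    as [smooth_on]. *)
Definition smooth_at E F (f : E -> F) (x : E) := forall k, Ck_at k f x.

Lemma smooth_onP E F (U : set E) (f : E -> F) : open U ->
  smooth_on U f <-> forall x, U x -> smooth_at f x.
Proof.
move=> oU; split=> [H x Ux k|H k].
  have := H k => /Ck_onP Hk; near=> y; apply: Hk.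
  by near: y; exact: open_nbhs_nbhs.
by apply/Ck_onP => x /H /(_ k); exact: nbhs_singleton.
Unshelve. all: by end_near. Qed.

Lemma smooth_on_at E F (U : set E) (f : E -> F) :
  (forall x, U x -> smooth_at f x) -> smooth_on U f.
Proof. by move=> H k; apply/Ck_onP => x /H /(_ k); exact: nbhs_singleton. Qed.

Lemma Ck_at_near_eq k E F (f g : E -> F) (x : E) :
  (\near x, f x = g x) -> Ck_at k f x -> Ck_at k g x.
Proof.
move=> /near_eq_near fg; apply: filterS2 fg => y; exact: Ck_on_near_eq.
Qed.

Lemma smooth_at_near_eq E F (f g : E -> F) (x : E) :
  (\near x, f x = g x) -> smooth_at f x -> smooth_at g x.
Proof. by move=> fg sf k; apply: Ck_at_near_eq fg _. Qed.

Lemma Ck_on_cts k E F (f : E -> F) (x : E) : Ck_on k [set x] f -> {for x, continuous f}.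
Proof.
case: k => [|k] /= H; first exact: H.
by apply: differentiable_continuous; have [+ _] := H; exact.
Qed.

Lemma Ck_at_cts k E F (f : E -> F) (x : E) : Ck_at k f x -> {for x, continuous f}.
Proof. by move=> /nbhs_singleton /Ck_on_cts. Qed.

Lemma Ck_atS k E F (f : E -> F) (x : E) : Ck_at k.+1 f x <->
  (\forall y \near x, differentiable f y) /\ (\forall y \near x, forall v, Ck_on k [set y] ('D_v f)).
Proof.
split=> [H|[H1 H2]].
  by split; apply: filterS H => y /= [d D] //; exact: d.
by apply: filterS2 H1 H2 => y d D; split=> // z ->.
Qed.

Lemma Ck_on_pred k E F (f : E -> F) (x : E) : Ck_on k.+1 [set x] f -> Ck_on k [set x] f.
Proof.
elim: k f => [|k IH] f /=; first by move=> [d _] y ->; exact/differentiable_continuous/d.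
by move=> [d D]; split=> // v; exact: IH.
Qed.

Lemma smooth_at_near_diff E F (f : E -> F) (x : E) : smooth_at f x ->
  \forall y \near x, differentiable f y.
Proof. by move=> /(_ 1) /Ck_atS[]. Qed.

Lemma smooth_at_diff E F (f : E -> F) (x : E) : smooth_at f x -> differentiable f x.
Proof. by move=> /smooth_at_near_diff /nbhs_singleton. Qed.

Lemma smooth_at_cts E F (f : E -> F) (x : E) : smooth_at f x -> {for x, continuous f}.
Proof. by move=> /(_ 0) /Ck_at_cts. Qed.

Lemma smooth_at_D E F (f : E -> F) (x : E) v : smooth_at f x -> smooth_at ('D_v f) x.
Proof. by move=> sf k; have /Ck_atS[_] := sf k.+1; apply: filterS => y; exact. Qed.

Lemma Ck_at_ex k E F (f : E -> F) (x : E) : Ck_at k f x <->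
  exists U, [/\ open U, U x & Ck_on k U f].
Proof.
split=> [H|[U [oU Ux /Ck_onP H]]].
  exists (interior [set y | Ck_on k [set y] f]); split => //.
  - exact: open_interior.
  - by apply/Ck_onP => y /nbhs_singleton.
by near=> y; apply: H; near: y; exact: open_nbhs_nbhs.
Unshelve. all: by end_near. Qed.

Lemma Ck_on_eq k E F (U : set E) (f g : E -> F) : open U ->
  (forall x, U x -> f x = g x) -> Ck_on k U f -> Ck_on k U g.
Proof.
move=> oU fg /Ck_onP H; apply/Ck_onP => x Ux; apply: Ck_on_near_eq (H _ Ux).
by near=> y; apply: fg; near: y; exact: open_nbhs_nbhs.
Unshelve. all: by end_near. Qed.

Lemma Ck_on_le k l E F (U : set E) (f : E -> F) : (l <= k)%N -> Ck_on k U f -> Ck_on l U f.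
Proof.
move=> /subnK <-; elim: (k - l)%N => // m IH H; apply: IH.
by move: H; rewrite addSn => /Ck_onP H; apply/Ck_onP => x /H; exact: Ck_on_pred.
Qed.

Lemma Ck_on_sub k E F (U V : set E) (f : E -> F) : V `<=` U -> Ck_on k U f -> Ck_on k V f.
Proof. by move=> VU /Ck_onP H; apply/Ck_onP => x /VU /H. Qed.



Lemma continuousZ_fun E F (a : E -> R^o) (f : E -> F) (x : E) :
  {for x, continuous a} -> {for x, continuous f} -> {for x, continuous (fun y => (a y : R) *: f y)}.
Proof. by move=> ca cf; apply: cvgZ. Qed.

Lemma diffZ_fun E F (a : E -> R^o) (f : E -> F) (x : E) :
  differentiable a x -> differentiable f x ->
  differentiable (fun y => (a y : R) *: f y) x /\
  forall v, 'd (fun y => (a y : R) *: f y) x v = (a x : R) *: 'd f x v + ('d a x v : R) *: f x.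
Proof.
move=> da df.
have lb : bilinear_for *:%R *:%R (fun (r : R^o) (u : F) => (r : R) *: u).
  split=> [u r x1 x2|u r x1 x2]; first by rewrite /= scalerDl -scalerA.
  by rewrite /= scalerDr scalerA mulrC -scalerA.
pose B : {bilinear R^o -> F -> F} := HB.pack (fun (r : R^o) (u : F) => (r : R) *: u) (bilinear_isBilinear.Build R R^o F F _ _ _ lb).
have cB : continuous (fun p : R^o * F => B p.1 p.2) by move=> p; exact: scale_continuous.
have dp := differentiable_pair da df.
have dB : differentiable (fun p : R^o * F => B p.1 p.2) (a x, f x) by exact: differentiable_bilin.
split; first exact: (differentiable_comp dp dB).
move=> v; have := diff_comp dp dB => /(congr1 (fun h => h v)) /= => E1.
transitivity ('d (fun p : R^o * F => B p.1 p.2) (a x, f x) ('d (fun y => (a y, f y)) x v)); first exact: E1.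
by rewrite (diff_bilin _ cB) (diff_pair da df).
Qed.

Lemma Ck_on_cst k E F (U : set E) (w : F) : Ck_on k U (cst w).
Proof.
elim: k w => [|k IH] w /=; first by move=> x _; exact: cvg_cst.
split=> [x _|v]; first exact: differentiable_cst.
by rewrite (_ : (fun x => _) = cst 0) //; apply/funext => x; rewrite derive_cst.
Qed.

Lemma Ck_on_add k E F (U : set E) (f g : E -> F) : open U ->
  Ck_on k U f -> Ck_on k U g -> Ck_on k U (fun x => f x + g x).
Proof.
move=> oU; elim: k f g => [|k IH] f g /=.
  by move=> cf cg x Ux; apply: cvgD; [exact: cf|exact: cg].
move=> [df Df] [dg Dg]; split=> [x Ux|v].
  by apply: differentiableD; [exact: df|exact: dg].
apply: (Ck_on_eq oU _ (IH _ _ (Df v) (Dg v))) => x Ux.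
by rewrite -deriveD//; apply: diff_derivable; [exact: df|exact: dg].
Qed.

Lemma Ck_on_lin k E F G (U : set E) (L : {linear F -> G}) (f : E -> F) : open U ->
  continuous L -> Ck_on k U f -> Ck_on k U (fun x => L (f x)).
Proof.
move=> oU cL; elim: k f => [|k IH] f /=.
  by move=> cf x Ux; apply: continuous_comp; [exact: cf|exact: cL].
move=> [df Df]; have dL y : differentiable L y by exact: linear_differentiable.
split=> [x Ux|v].
  by apply: differentiable_comp; [exact: df|exact: dL].
apply: (Ck_on_eq oU _ (IH _ (Df v))) => x Ux.
have dLf : differentiable (L \o f) x by apply: differentiable_comp; [exact: df|].
rewrite [RHS](deriveE _ dLf) (diff_comp (df _ Ux) (dL _)) /= (deriveE _ (df _ Ux)).
by rewrite (diff_lin _ cL).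
Qed.

Lemma Ck_on_scale k E F (U : set E) (a : E -> R^o) (f : E -> F) : open U ->
  Ck_on k U a -> Ck_on k U f -> Ck_on k U (fun x => (a x : R) *: f x).
Proof.
move=> oU; elim: k a f => [|k IH] a f /=.
  by move=> cf cg x Ux; apply: continuousZ_fun; [exact: cf|exact: cg].
move=> H1 H2; have [da Da] := H1; have [df Df] := H2.
have aC : Ck_on k U a by apply: (@Ck_on_le k.+1).
have fC : Ck_on k U f by apply: (@Ck_on_le k.+1).
split=> [x Ux|v].
  by have [] := diffZ_fun (da x Ux) (df x Ux).
apply: (Ck_on_eq oU _ (Ck_on_add oU (IH _ _ aC (Df v)) (IH _ _ (Da v) fC))) => x Ux.
have [d1 d2] := diffZ_fun (da x Ux) (df x Ux).
by rewrite (deriveE _ d1) d2 !deriveE; [|exact: da|exact: df].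
Qed.

Lemma Ck_on_sum k E F (U : set E) I (r : seq I) (P : pred I) (f : I -> E -> F) : open U ->
  (forall i, P i -> Ck_on k U (f i)) -> Ck_on k U (fun x => \sum_(i <- r | P i) f i x).
Proof.
move=> oU H; elim: r => [|i r IH].
  by apply: (Ck_on_eq oU _ (Ck_on_cst k U 0)) => x _; rewrite big_nil.
case Pi: (P i).
  apply: (Ck_on_eq oU _ (Ck_on_add oU (H i Pi) IH)) => x _.
  by rewrite big_cons Pi.
by apply: (Ck_on_eq oU _ IH) => x _; rewrite big_cons Pi.
Qed.

Lemma Ck_on_prod k E (U : set E) I (r : seq I) (P : pred I) (f : I -> E -> R^o) : open U ->
  (forall i, P i -> Ck_on k U (f i)) -> Ck_on k U (fun x => \prod_(i <- r | P i) (f i x : R) : R^o).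
Proof.
move=> oU H; elim: r => [|i r IH].
  by apply: (Ck_on_eq oU _ (Ck_on_cst k U (1 : R^o))) => x _; rewrite big_nil.
case Pi: (P i).
  apply: (Ck_on_eq oU _ (Ck_on_scale oU (H i Pi) IH)) => x _.
  by rewrite big_cons Pi.
by apply: (Ck_on_eq oU _ IH) => x _; rewrite big_cons Pi.
Qed.

Lemma Ck_on_inv k E (U : set E) (a : E -> R^o) : open U ->
  (forall x, U x -> a x != 0) -> Ck_on k U a -> Ck_on k U (fun x => (a x : R)^-1 : R^o).
Proof.
move=> oU a0; elim: k => [|k IH] /=.
  by move=> cf x Ux; apply: cvgV; [exact: a0|exact: cf].
move=> H1; have [da Da] := H1.
have /IH iC : Ck_on k U a by apply: (@Ck_on_le k.+1).
split=> [x Ux|v].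
  by apply: differentiableV; [exact: da|exact: a0].
have cN := Ck_on_cst k U (-1 : R^o).
apply: (Ck_on_eq oU _ (Ck_on_scale oU cN (Ck_on_scale oU iC (Ck_on_scale oU iC (Da v))))) => x Ux.
rewrite deriveV; [|exact: a0|exact: diff_derivable (da _ Ux)].
by rewrite /cst scaleN1r scalerA scaleNr expr2 invfM.
Qed.

(** Independence of the family [b] is not asked: the purpose is to expand a varying vector along
    fixed directions with continuous linear coefficients. *)
Definition fin_dim F := exists m (b : 'I_m -> F) (l : 'I_m -> {linear F -> R^o}),
  (forall i, continuous (l i)) /\ forall w, w = \sum_i (l i w : R) *: b i.

(** The derivative of [g o f] along [v] is that of [g] in the moving direction ['D_v f]. Expanded in
    the [b i], it is a sum of products of coordinates of ['D_v f] with ['D_(b i) g o f], to which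
    the induction hypothesis applies. *)
Lemma Ck_on_comp k E F G (U : set E) (V : set F) (f : E -> F) (g : F -> G) : fin_dim F ->
  open U -> open V -> (forall x, U x -> V (f x)) ->
  Ck_on k U f -> Ck_on k V g -> Ck_on k U (fun x => g (f x)).
Proof.
move=> [m [b [l [cl lE]]]] oU oV UV; elim: k g => [|k IH] g /=.
  by move=> cf cg x Ux; apply: continuous_comp; [exact: cf|exact/cg/UV].
move=> H1 [dg Dg]; have [df Df] := H1.
have fC : Ck_on k U f by apply: (@Ck_on_le k.+1).
split=> [x Ux|v].
  by apply: differentiable_comp; [exact: df|exact/dg/UV].
have H i := Ck_on_scale oU (Ck_on_lin oU (cl i) (Df v)) (IH _ fC (Dg (b i))).
apply: (Ck_on_eq oU _ (@Ck_on_sum _ _ _ U _ (index_enum _) xpredT _ oU (fun i _ => H i))) => x Ux.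
have d1 := df _ Ux; have d2 := dg _ (UV _ Ux).
rewrite [RHS](deriveE _ (differentiable_comp d1 d2)) (diff_comp d1 d2) /=.
rewrite (deriveE _ d1) [X in _ = 'd g _ X]lE linear_sum; apply: eq_bigr => i _.
by rewrite linearZ (deriveE _ d2).
Qed.

End Calculus.

Section Calculus2.
Context {R : realType}.
Implicit Types E F G : normedModType R.

Lemma Ck_at_ex2 k E F F' (f : E -> F) (g : E -> F') (x : E) :
  Ck_at k f x -> Ck_at k g x ->
  exists U, [/\ open U, U x, Ck_on k U f & Ck_on k U g].
Proof.
move=> /Ck_at_ex [U [oU Ux fU]] /Ck_at_ex [V [oV Vx gV]].
exists (U `&` V); split => //; first exact: openI.
- by apply: Ck_on_sub fU => ? [].
- by apply: Ck_on_sub gV => ? [].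
Qed.

Lemma Ck_at_comp k E F G (f : E -> F) (g : F -> G) (x : E) : fin_dim F ->
  Ck_at k f x -> Ck_at k g (f x) -> Ck_at k (fun y => g (f y)) x.
Proof.
move=> fF fx; have cf := Ck_at_cts fx.
move: fx => /Ck_at_ex [U [oU Ux fU]] /Ck_at_ex [V [oV Vx gV]].
apply/Ck_at_ex; exists (interior (U `&` f @^-1` V)); split.
- exact: open_interior.
- apply: filterI; first exact: open_nbhs_nbhs.
  by apply: cf; exact: open_nbhs_nbhs.
- apply: (Ck_on_comp fF (open_interior _) oV) gV => [y /nbhs_singleton []//|].
  by apply: Ck_on_sub fU => y /nbhs_singleton [].
Qed.

Lemma smooth_at_comp E F G (f : E -> F) (g : F -> G) (x : E) : fin_dim F ->
  smooth_at f x -> smooth_at g (f x) -> smooth_at (fun y => g (f y)) x.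
Proof. by move=> fF fx gx k; apply: Ck_at_comp. Qed.

Lemma smooth_at_cst E F (w : F) (x : E) : smooth_at (fun=> w) x.
Proof.
move=> k; apply/Ck_at_ex; exists setT; split => //; first exact: openT.
exact: Ck_on_cst.
Qed.

Lemma smooth_at_add E F (f g : E -> F) (x : E) :
  smooth_at f x -> smooth_at g x -> smooth_at (fun y => f y + g y) x.
Proof.
move=> fx gx k; have [U [oU Ux fU gU]] := Ck_at_ex2 (fx k) (gx k).
by apply/Ck_at_ex; exists U; split => //; exact: Ck_on_add.
Qed.

Lemma smooth_at_lin E F G (L : {linear F -> G}) (f : E -> F) (x : E) :
  continuous L -> smooth_at f x -> smooth_at (fun y => L (f y)) x.
Proof.
move=> cL fx k; have /Ck_at_ex[U [oU Ux fU]] := fx k.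
by apply/Ck_at_ex; exists U; split => //; exact: Ck_on_lin.
Qed.

Lemma smooth_at_scale E F (a : E -> R^o) (f : E -> F) (x : E) :
  smooth_at a x -> smooth_at f x -> smooth_at (fun y => (a y : R) *: f y) x.
Proof.
move=> fx gx k; have [U [oU Ux fU gU]] := Ck_at_ex2 (fx k) (gx k).
by apply/Ck_at_ex; exists U; split => //; exact: Ck_on_scale.
Qed.

Lemma smooth_at_inv E (a : E -> R^o) (x : E) :
  smooth_at a x -> (a x : R) != 0 -> smooth_at (fun y => (a y : R)^-1 : R^o) x.
Proof.
move=> ax a0 k.
have /Ck_at_ex[U [oU Ux aU]] := ax k.
apply/Ck_at_ex; exists (interior (U `&` a @^-1` [set t | (t : R) != 0])); split.
- exact: open_interior.
- apply: filterI; first exact: open_nbhs_nbhs.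
  apply: (smooth_at_cts ax); apply: open_nbhs_nbhs; split => //; exact: open_neq.
- apply: Ck_on_inv; [exact: open_interior|by move=> y /nbhs_singleton []|].
  by apply: Ck_on_sub aU => y /nbhs_singleton [].
Qed.

Lemma smooth_at_sum E F I (r : seq I) (P : pred I) (f : I -> E -> F) (x : E) :
  (forall i, P i -> smooth_at (f i) x) -> smooth_at (fun y => \sum_(i <- r | P i) f i y) x.
Proof.
move=> H; elim: r => [|i r IH].
  apply: smooth_at_near_eq (smooth_at_cst 0 x); apply: nearW => y; by rewrite big_nil.
case Pi: (P i).
  apply: smooth_at_near_eq (smooth_at_add (H i Pi) IH); apply: nearW => y.
  by rewrite big_cons Pi.
by apply: smooth_at_near_eq IH; apply: nearW => y; rewrite big_cons Pi.
Qed.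

Lemma smooth_at_linear E F (L : {linear E -> F}) (x : E) : continuous L -> smooth_at L x.
Proof.
move=> cL; apply: (smooth_at_lin (f := id)) => // k.
apply/Ck_at_ex; exists setT; split => //; first exact: openT.
case: k => [|k] /=; first by move=> y _; exact: cvg_id.
split=> [y _|v]; first exact: (ex_diff (is_diff_def := is_diff_id y)).
by rewrite (_ : (fun y => _) = cst v); [exact: Ck_on_cst|apply/funext => y; rewrite derive_id].
Qed.

Lemma smooth_at_id E (x : E) : smooth_at (@id E) x.
Proof. by apply: (@smooth_at_linear _ _ idfun) => y; exact: cvg_id. Qed.

Definition inl_lin E F (u : E) : E * F := (u, 0).
Lemma inl_lin_linear E F : linear (@inl_lin E F).
Proof. by move=> a u v; rewrite /inl_lin; congr (_, _); rewrite /= scaler0 addr0. Qed.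
HB.instance Definition _ E F := GRing.isLinear.Build R E (E * F)%type _ (@inl_lin E F) (@inl_lin_linear E F).
Lemma inl_lin_cts E F : continuous (@inl_lin E F).
Proof. by move=> x; apply: cvg_pair; [exact: cvg_id|exact: cvg_cst]. Qed.

Definition inr_lin E F (u : F) : E * F := (0, u).
Lemma inr_lin_linear E F : linear (@inr_lin E F).
Proof. by move=> a u v; rewrite /inr_lin; congr (_, _); rewrite /= scaler0 addr0. Qed.
HB.instance Definition _ E F := GRing.isLinear.Build R F (E * F)%type _ (@inr_lin E F) (@inr_lin_linear E F).
Lemma inr_lin_cts E F : continuous (@inr_lin E F).
Proof. by move=> x; apply: cvg_pair; [exact: cvg_cst|exact: cvg_id]. Qed.

Lemma fst_cts E F : continuous (@fst E F).
Proof. by move=> x; exact: cvg_fst. Qed.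
Lemma snd_cts E F : continuous (@snd E F).
Proof. by move=> x; exact: cvg_snd. Qed.

Lemma smooth_at_pair E F G (f : E -> F) (g : E -> G) (x : E) :
  smooth_at f x -> smooth_at g x -> smooth_at (fun y => (f y, g y)) x.
Proof.
move=> fx gx.
have := smooth_at_add (smooth_at_lin (@inl_lin_cts F G) fx) (smooth_at_lin (@inr_lin_cts F G) gx).
apply: smooth_at_near_eq; apply: nearW => y.
by rewrite /= /inl_lin /inr_lin; congr (_, _); rewrite /= ?addr0 ?add0r.
Qed.

Lemma smooth_at_fst E F G (f : E -> (F * G)%type) (x : E) :
  smooth_at f x -> smooth_at (fun y => (f y).1) x.
Proof. exact: (smooth_at_lin (L := fst) (@fst_cts F G)). Qed.

Lemma fin_dim_real : fin_dim R^o.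
Proof.
exists 1%N, (fun=> 1), (fun=> idfun); split=> [i x|w]; first exact: cvg_id.
by rewrite big_ord1 /= -[LHS]mulr1.
Qed.

Lemma fin_dim_prod E F : fin_dim E -> fin_dim F -> fin_dim (E * F)%type.
Proof.
move=> [m [b [l [cl lE]]]] [m' [b' [l' [cl' lE']]]].
exists (m + m')%N, (fun i : 'I_(m + m') => match fintype.split i with inl j => inl_lin F (b j) | inr j => inr_lin E (b' j) end),
  (fun i : 'I_(m + m') => match fintype.split i with inl j => (l j \o fst : {linear (E * F)%type -> R^o}) | inr j => (l' j \o snd : {linear (E * F)%type -> R^o}) end).
split.
  move=> i; case: (fintype.split i) => j x; apply: continuous_comp; 
    [exact: cvg_fst|exact: cl|exact: cvg_snd|exact: cl'].
move=> [u v]; rewrite big_split_ord /=.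
under eq_bigr => i _ do rewrite (unsplitK (inl i)) /=.
under [X in _ + X]eq_bigr => i _ do rewrite (unsplitK (inr i)) /=.
have -> : \sum_(i < m) (l i u : R) *: inl_lin F (b i) = inl_lin F u.
  by rewrite [in RHS](lE u) linear_sum; apply: eq_bigr => i _; rewrite linearZ.
have -> : \sum_(i < m') (l' i v : R) *: inr_lin E (b' i) = inr_lin E v.
  by rewrite [in RHS](lE' v) linear_sum; apply: eq_bigr => i _; rewrite linearZ.
by rewrite /inl_lin /inr_lin; congr (_, _); rewrite /= ?addr0 ?add0r.
Qed.

Definition coord_lin m n i j (A : 'M[R]_(m, n)) : R^o := A i j.
Lemma coord_lin_linear m n i j : linear (@coord_lin m n i j).
Proof. by move=> a u v; rewrite /coord_lin !mxE. Qed.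
HB.instance Definition _ m n i j := GRing.isLinear.Build R 'M[R]_(m, n) R^o _ (@coord_lin m n i j) (@coord_lin_linear m n i j).
Lemma coord_lin_cts m n i j : continuous (@coord_lin m n i j).
Proof. exact: coord_continuous. Qed.

Lemma fin_dim_rV m : fin_dim 'rV[R]_m.
Proof.
exists m, (fun i => delta_mx 0 i), (fun i => @coord_lin _ _ 0 i : {linear _ -> _}).
split=> [i|w]; first exact: coord_lin_cts.
exact: row_sum_delta.
Qed.

End Calculus2.

(** * Symmetry of second derivatives *)

Section Schwarz.
Context {R : realType}.
Implicit Types E F G : normedModType R.

Lemma close_absurd (A B p : R^o) : `|A - p| < `|A - B| / 2 -> `|B - p| < `|A - B| / 2 -> False.
Proof.
move=> Ap Bp; have := ltrD Ap Bp; rewrite -splitr (distrC B) => h.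
by have := le_lt_trans (ler_distD p A B) h; rewrite ltxx.
Qed.

Lemma mean_value_line E (f : E -> R^o) (u y : E) (h : R) : 0 < h ->
  (forall t, 0 <= t <= h -> differentiable f (t *: u + y)) ->
  exists2 t, 0 <= t <= h & (f (h *: u + y) : R) - f y = 'D_u f (t *: u + y) * h.
Proof.
move=> h0 df.
have dg t : 0 <= t <= h -> is_derive t 1 (fun t => f (t *: u + y) : R^o) ('D_u f (t *: u + y)).
  move=> /df d; have E1 : (fun s : R => f (s *: u + (t *: u + y))) = (fun s => f ((s + t) *: u + y)).
    by apply/funext => s; rewrite scalerDl addrA.
  have dv : derivable f (t *: u + y) u by exact: diff_derivable.
  have E2 : (fun k => k^-1 *: ((f \o shift (t *: u + y)) (k *: u) - f (t *: u + y))) =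
    (fun k : R => k^-1 *: (((fun t => f (t *: u + y) : R^o) \o shift t) (k *: (1 : R^o)) - f (t *: u + y))).
    by apply/funext => k /=; rewrite [k *: 1]mulr1 scalerDl addrA.
  by apply: DeriveDef; rewrite /derivable /derive -E2.
have [| |t ht E1] := @MVT_segment R (fun t => f (t *: u + y)) (fun t => 'D_u f (t *: u + y)) 0 h (ltW h0).
- by move=> t; rewrite in_itv /= => /andP[/ltW a /ltW b]; apply: dg; rewrite a b.
- apply: derivable_within_continuous => t; rewrite in_itv /= => /dg.
  by case.
exists t; first by move: ht; rewrite in_itv.
by move: E1; rewrite scale0r add0r subr0.
Qed.

(** The mean value theorem is applied along [u] to the increment [f (h v + z) - f z], then along [v]
    to ['D_u f]. *)
Lemma second_difference E (f : E -> R^o) (u v x : E) (h : R) : 0 < h ->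
  (forall a b, 0 <= a <= h -> 0 <= b <= h ->
     differentiable f (a *: u + (b *: v + x)) /\ differentiable ('D_u f) (a *: u + (b *: v + x))) ->
  exists a b, [/\ 0 <= a <= h, 0 <= b <= h &
    ((f (h *: u + (h *: v + x)) : R) - f (h *: u + x)) - (f (h *: v + x) - f x) =
    'D_v ('D_u f) (a *: u + (b *: v + x)) * h * h].
Proof.
move=> h0 df.
have hh : 0 <= h <= h by rewrite lexx ltW.
have h00 : 0 <= (0:R) <= h by rewrite lexx ltW.
have d1 a : 0 <= a <= h -> differentiable f (a *: u + (h *: v + x)) by move=> /df/(_ hh)[].
have d2 a : 0 <= a <= h -> differentiable f (a *: u + x).
  by move=> /df/(_ h00)[]; rewrite scale0r add0r.
pose g z := f (h *: v + z) - f z.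
have ds a : 0 <= a <= h -> differentiable (f \o (fun z => h *: v + z)) (a *: u + x) /\
    'd (f \o (fun z => h *: v + z)) (a *: u + x) = 'd f (a *: u + (h *: v + x)) :> (E -> R^o).
  move=> ha; have I : is_diff (a *: u + x) (fun z => h *: v + z) (0 + id).
    by apply: is_diffD.
  have D1 := d1 a ha; rewrite addrCA in D1.
  split; first exact: (differentiable_comp (@ex_diff _ _ _ _ _ _ _ I) D1).
  rewrite (diff_comp (@ex_diff _ _ _ _ _ _ _ I) D1) (@diff_val _ _ _ _ _ _ _ I) addrCA.
  by apply/funext => z; rewrite /= fctE add0r.
have dg a : 0 <= a <= h -> differentiable g (a *: u + x).
  by move=> ha; apply: differentiableB; [have [] := ds a ha|exact: d2].
have [a ha E1] := mean_value_line h0 dg.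
have [|b hb E2] := @mean_value_line E ('D_u f) v (a *: u + x) h h0.
  by move=> b hb; rewrite addrCA; have [] := df a b ha hb.
exists a, b; split => //.
have -> : (f (h *: u + (h *: v + x)) : R) - f (h *: u + x) - (f (h *: v + x) - f x) = g (h *: u + x) - g x.
  by rewrite /g addrCA.
rewrite E1; congr (_ * _); rewrite addrCA -E2.
have [D1 D2] := ds a ha.
rewrite (deriveE _ (dg _ ha)) [g](_ : _ = (f \o (fun z => h *: v + z)) \- f) // diffB//=; last exact: d2.
rewrite D2 addrCA !deriveE //; [exact: d2|].
by rewrite addrCA; exact: d1.
Qed.

(** The second difference is symmetric in [u] and [v], so the two mixed derivatives take a common
    value at two points near [x]. If their values at [x] differed, continuity would put that common
    value within half the gap of both. *)
Lemma Schwarz E (f : E -> R^o) (u v x : E) : smooth_at f x ->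
  'D_v ('D_u f) x = 'D_u ('D_v f) x.
Proof.
move=> sf; apply/eqP; rewrite -subr_eq0; apply/negPn/negP => AB.
set A : R := 'D_v ('D_u f) x in AB; set B : R := 'D_u ('D_v f) x in AB.
have e0 : 0 < `|A - B| / 2 by rewrite divr_gt0 // normr_gt0.
have cA := smooth_at_cts (smooth_at_D v (smooth_at_D u sf)).
have cB := smooth_at_cts (smooth_at_D u (smooth_at_D v sf)).
move/cvgrPdist_lt: cA => /(_ _ e0) cA; move/cvgrPdist_lt: cB => /(_ _ e0) cB.
have dF := smooth_at_near_diff sf.
have dU := smooth_at_near_diff (smooth_at_D u sf).
have dV := smooth_at_near_diff (smooth_at_D v sf).
have [r /= r0 Hr] := (nbhs_ballP _ _).1 (filterI cA (filterI cB (filterI dF (filterI dU dV)))).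
(* The parallelogram with sides [h u] and [h v] at [x] then has all its points at distance less than
   [r] from [x]; the added 1 keeps the denominator positive. *)
pose h := r / (`|u| + `|v| + 1) / 2.
have s0 : 0 < `|u| + `|v| + 1 by rewrite ltr_wpDl // addr_ge0.
have h0 : 0 < h by rewrite /h !divr_gt0.
have inb a b : 0 <= a <= h -> 0 <= b <= h -> ball x r (a *: u + (b *: v + x)).
  move=> /andP[a0 ah] /andP[b0 bh]; rewrite -ball_normE /= addrA opprD addrCA subrr addr0 normrN.
  apply: le_lt_trans (ler_normD _ _) _; rewrite !normrZ !ger0_norm //.
  apply: (@le_lt_trans _ _ (h * (`|u| + `|v| + 1))).
    rewrite mulrDr mulr1 mulrDr -addrA; apply: lerD; first exact: ler_wpM2r.
    by apply: ler_wpDr; [exact: ltW|exact: ler_wpM2r].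
  by rewrite /h mulrAC divfK ?gt_eqF // ltr_pdivrMr // ltr_pMr // ltr1n.
have [a [b [ha hb E1]]] : exists a b, [/\ 0 <= a <= h, 0 <= b <= h &
    ((f (h *: u + (h *: v + x)) : R) - f (h *: u + x)) - (f (h *: v + x) - f x) =
    'D_v ('D_u f) (a *: u + (b *: v + x)) * h * h].
  by apply: second_difference => // a b ha hb; have [_ [_ [? [? _]]]] := Hr _ (inb a b ha hb).
have [b' [a' [hb' ha' E2]]] : exists a b, [/\ 0 <= a <= h, 0 <= b <= h &
    ((f (h *: v + (h *: u + x)) : R) - f (h *: v + x)) - (f (h *: u + x) - f x) =
    'D_u ('D_v f) (a *: v + (b *: u + x)) * h * h].
  apply: second_difference => // b' a' hb' ha'; by rewrite addrCA; have [_ [_ [? [_ ?]]]] := Hr _ (inb a' b' ha' hb').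
have [+ _] := Hr _ (inb a b ha hb); have [_ [+ _]] := Hr _ (inb a' b' ha' hb').
rewrite /= -/A -/B (addrCA (a' *: u)).
set q := 'D_u _ _; set p := 'D_v _ _ => Bq Ap.
have pq : p = q.
  have hn : h * h != 0 by rewrite mulf_neq0 // gt_eqF.
  apply: (mulIf hn); rewrite [in LHS]mulrA [in RHS]mulrA -[LHS]E1 -[RHS]E2 (addrCA (h *: v)).
  by rewrite opprB opprB addrACA [RHS]addrACA -!addrA; congr (_ + _); rewrite addrCA addrC -!addrA.
rewrite pq in Ap; exact: close_absurd Ap Bq.
Qed.

End Schwarz.

(** * Smoothness of a continuous inverse *)

Section Inverse.
Context {R : realType}.
Implicit Types E F G : normedModType R.

Lemma linear_cts_fin E F (L : {linear E -> F}) : fin_dim E -> continuous L.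
Proof.
move=> [m [b [l [cl lE]]]].
have -> : L = (fun w => \sum_i (l i w : R) *: L (b i)) :> (E -> F).
  apply/funext => w; rewrite {1}(lE w) linear_sum; apply: eq_bigr => i _; by rewrite linearZ.
move=> x; apply: smooth_at_cts; apply: smooth_at_sum => i _.
exact: smooth_at_scale (smooth_at_linear _ (cl i)) (smooth_at_cst _ _).
Qed.

Lemma derive_lin E F G (L : {linear F -> G}) (f : E -> F) (x v : E) : continuous L ->
  differentiable f x -> 'D_v (fun y => L (f y)) x = L ('D_v f x).
Proof.
move=> cL df; have dL : differentiable L (f x) by exact: linear_differentiable.
rewrite (deriveE _ (differentiable_comp df dL)) (diff_comp df dL) /= (deriveE _ df).
by rewrite (diff_lin _ cL).
Qed.

Lemma Schwarz_fin E F (f : E -> F) (u v x : E) : fin_dim F -> smooth_at f x ->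
  'D_v ('D_u f) x = 'D_u ('D_v f) x.
Proof.
move=> [m [b [l [cl lE]]]] sf.
have H i (p q : E) : l i ('D_q ('D_p f) x) = 'D_q ('D_p (fun y => l i (f y) : R^o)) x.
  rewrite -derive_lin //; last by exact: smooth_at_diff (smooth_at_D _ sf).
  apply: near_eq_derive; apply: filterS (smooth_at_near_diff sf) => y dy.
  by rewrite derive_lin.
have S i : l i ('D_v ('D_u f) x) = l i ('D_u ('D_v f) x).
  rewrite (H i u v) (H i v u); apply: Schwarz; exact: smooth_at_lin.
rewrite [LHS]lE [RHS]lE; apply: eq_bigr => i _; by rewrite S.
Qed.

Lemma Ck_on_rV k E m (U : set E) (f : E -> 'rV[R]_m) : open U ->
  (forall i, Ck_on k U (fun y => f y 0 i : R^o)) -> Ck_on k U f.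
Proof.
move=> oU H; have S := @Ck_on_sum _ k E _ U _ (index_enum 'I_m) xpredT _ oU (fun i _ =>
   Ck_on_scale oU (H i) (Ck_on_cst k U (delta_mx 0 i : 'rV_m))).
by apply: (Ck_on_eq oU _ S) => y _; rewrite -row_sum_delta.
Qed.

Lemma Ck_on_det k E m (U : set E) (M : E -> 'M[R]_m) : open U ->
  (forall i j, Ck_on k U (fun y => M y i j : R^o)) -> Ck_on k U (fun y => \det (M y) : R^o).
Proof.
move=> oU H; rewrite /determinant; apply: Ck_on_sum => // s _.
apply: (@Ck_on_scale _ k E _ U (cst _) (fun y => \prod_i M y i (s i) : R^o)) => //; first exact: Ck_on_cst.
exact: Ck_on_prod.
Qed.

Lemma Ck_on_invmx k E m (U : set E) (M : E -> 'M[R]_m) : open U ->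
  (forall i j, Ck_on k U (fun y => M y i j : R^o)) -> (forall y, U y -> M y \in unitmx) ->
  forall i j, Ck_on k U (fun y => invmx (M y) i j : R^o).
Proof.
move=> oU H Mu i j.
have D := Ck_on_det oU H.
have D0 y : U y -> \det (M y) != 0 by move=> /Mu; rewrite unitmxE unitfE.
have I := Ck_on_inv oU D0 D.
have C : Ck_on k U (fun y => cofactor (M y) j i : R^o).
  apply: (@Ck_on_scale _ k E _ U (cst _) (fun y => \det (row' j (col' i (M y))) : R^o)) => //; first exact: Ck_on_cst.
  apply: Ck_on_det => // a b.
  by apply: (Ck_on_eq oU _ (H (lift j a) (lift i b))) => y _; rewrite !mxE.
by apply: (Ck_on_eq oU _ (Ck_on_scale oU I C)) => y Uy; rewrite /invmx (Mu y Uy) !mxE.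
Qed.

Section InverseFunction.
Context (m : nat).
Local Notation V := 'rV[R]_m.

Lemma jacobian_unit (f : V -> V) x : injective ('d f x) -> 'J f x \in unitmx.
Proof.
move=> inj; rewrite -row_free_unit; apply/row_freeP.
have : kermx ('J f x) = 0.
  apply/row_matrixP => i; rewrite row0; apply: inj; rewrite linear0.
  have -> : 'd f x (row i (kermx ('J f x))) = row i (kermx ('J f x)) *m 'J f x.
    by rewrite /jacobian mul_rV_lin1.
  by rewrite -row_mul mulmx_ker row0.
by move/eqP; rewrite kermx_eq0 => /row_freeP.
Qed.

(** With [k] the increment of [g] for the increment [h], differentiability of [f] gives
    [h - k J = o(k)], hence [k - h J^-1 = o(k)]. Continuity of [g] makes [k] small, and the relation
    itself bounds [k] by a multiple of [h]. *)
Lemma inverse_diff (f g : V -> V) (y : V) : {for y, continuous g} ->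
  (\forall z \near y, f (g z) = z) -> differentiable f (g y) -> injective ('d f (g y)) ->
  differentiable g y /\ forall w, 'd g y w = w *m invmx ('J f (g y)).
Proof.
move=> cg fg df inj; have Ju := jacobian_unit inj.
set J := 'J f (g y) in Ju *.
have dfJ w : 'd f (g y) w = w *m J by rewrite /J /jacobian mul_rV_lin1.
pose L : {linear V -> V} := mulmxr (invmx J).
have cL : continuous L by apply: linear_cts_fin; exact: fin_dim_rV.
suff [H1 H2] : differentiable g y /\ 'd g y = L :> (V -> V) by split; [exact: H1|move=> w; rewrite H2].
have [K K0 LK] := linear_lipschitz cL.
apply: differentiable_diffP => // e e0.
(* With [K] a Lipschitz constant of the inverse Jacobian, the first bound absorbs half of [|k|] and
   yields [|k| <= 2 K |h|]; the second then turns [K d |k|] into at most [e |h|]. *)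
pose d := Num.min (2 * K)^-1 (e / (K * (2 * K))).
have d0 : 0 < d by rewrite lt_min invr_gt0 divr_gt0 ?mulr_gt0.
have := diff_locally df => /eqaddoP /(_ d d0) H.
have cgs : {for (0 : V), continuous (fun h : V => g (h + y))}.
  have ca : {for (0 : V), continuous (fun h : V => h + y)}.
    exact: smooth_at_cts (smooth_at_add (smooth_at_id _) (smooth_at_cst _ _)).
  by apply: (continuous_comp ca); rewrite add0r.
have cg0 : (fun h : V => g (h + y) - g y) @ (0 : V) --> g (0 + y) - g y.
  exact: (cvgB cgs (cvg_cst (g y))).
rewrite add0r subrr in cg0.
have {}H := cg0 _ H.
have fg' : \forall h \near (0 : V), f (g (h + y)) = h + y.
  by move: fg; rewrite (near_shift (0:V) y); apply: filterS => h /=; rewrite subr0.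
near=> h.
have E1 : f (g (h + y)) = h + y by near: h.
have Hk0 : `|(f \o shift (g y) - (cst (f (g y)) + 'd f (g y))) (g (h + y) - g y)| <= d * `|g (h + y) - g y|.
  by near: h.
set k := g (h + y) - g y in Hk0 *.
have Hk : `|h - k *m J| <= d * `|k|.
  move: Hk0; rewrite !fctE /= dfJ subrK E1 (nbhs_singleton fg) opprD addrA.
  by rewrite addrK.
have E2 : k - L h = - L (h - k *m J).
  by rewrite linearB /= mulmxK // opprB.
have N1 : `|k - L h| <= K * (d * `|k|).
  by rewrite E2 normrN; apply: le_trans (LK _) _; rewrite ler_pM2l.
have N2 : `|k| <= 2 * K * `|h|.
  have : `|k| <= K * `|h| + `|k| / 2.
    rewrite -[k in leLHS](subrK (L h)) addrC; apply: le_trans (ler_normD _ _) _.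
    apply: lerD; first exact: LK.
    apply: le_trans N1 _; rewrite mulrA mulrC ler_wpM2l //.
    rewrite -ler_pdivlMl // (le_trans (y := (2 * K)^-1)) //; first by rewrite ge_min lexx.
    by rewrite invfM mulrC.
  by move=> ?; lra.
apply: le_trans N1 _.
have dle : d <= e / (K * (2 * K)) by rewrite ge_min lexx orbT.
apply: (@le_trans _ _ (K * (e / (K * (2 * K)) * (2 * K * `|h|)))).
  by rewrite ler_pM2l // ler_pM // ltW.
have K1 : K != 0 by rewrite gt_eqF.
suff -> : K * (e / (K * (2 * K)) * (2 * K * `|h|)) = e * `|h| by [].
by field.
Unshelve. all: by end_near. Qed.

(** Bootstrapping: the derivative of [g] is the inverse of the Jacobian of [f] at [g y], whose
    entries are rational in those of the Jacobian, so [g] of class C^k has derivatives of class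
    C^k. *)
Lemma inverse_smooth (f g : V -> V) (U W : set V) : open U -> open W ->
  (forall y, W y -> {for y, continuous g}) ->
  (forall y, W y -> U (g y)) -> (forall y, W y -> f (g y) = y) ->
  smooth_on U f -> (forall y, W y -> injective ('d f (g y))) -> smooth_on W g.
Proof.
move=> oU oW cg WU fg sf inj.
have dd y : W y -> differentiable g y /\ forall w, 'd g y w = w *m invmx ('J f (g y)).
  move=> Wy; apply: inverse_diff; [exact: cg| |by have [+ _] := sf 1%N; apply; exact: WU|exact: inj].
  by near=> z; apply: fg; near: z; exact: open_nbhs_nbhs.
elim=> [|k IH] /=; first exact: cg.
split=> [y /dd[]//|v].
have JC i j : Ck_on k W (fun y => 'J f (g y) i j : R^o).
  have [df Df] := sf k.+1.
  have C := Ck_on_comp (fin_dim_rV m) oW oU WU IH (Df (delta_mx 0 i)).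
  apply: (Ck_on_eq oW _ (Ck_on_lin (L := @coord_lin R _ _ 0 j) oW (@coord_lin_cts R _ _ 0 j) C)) => y Wy.
  by rewrite /= /coord_lin deriveEjacobian ?rowE -?rowE ?mxE //; exact/df/WU.
have IC := Ck_on_invmx oW JC (fun y Wy => jacobian_unit (inj y Wy)).
apply: Ck_on_rV => // j.
apply: (Ck_on_eq oW _ (@Ck_on_sum _ k _ _ W _ (index_enum 'I_m) xpredT _ oW (fun i _ =>
   Ck_on_scale oW (Ck_on_cst k W (v 0 i : R^o)) (IC i j)))) => y Wy.
have [d1 d2] := dd y Wy.
by rewrite (deriveE _ d1) d2 mxE.
Unshelve. all: by end_near. Qed.

End InverseFunction.
End Inverse.

(** * Exterior powers of a symplectic form *)

Section PairingSign.
Context {R : realDomainType} {n : nat} {T : finType}.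
Variables (e : bool * 'I_n -> T) (d : T -> bool * 'I_n).
Hypotheses (eK : cancel e d) (dK : cancel d e).

(** This is the Gram matrix of a symplectic basis: [d] labels a vector by its side, [false] for e_i
    and [true] for f_i, and by its pair [i]. *)
Definition pairing_coef (x y : T) : R :=
  if (d x).2 == (d y).2 then (d y).1%:R - (d x).1%:R else 0.

Definition pairing_term (s : {perm T}) : R :=
  (-1) ^+ s * \prod_i pairing_coef (s (e (false, i))) (s (e (true, i))).

Let e_inj : injective e := can_inj eK.

Let flip (x : T) := e (~~ (d x).1, (d x).2).

Lemma pairing_coef_neq0 x y : pairing_coef x y != 0 -> y = flip x.
Proof.
rewrite /pairing_coef /flip -{3}(dK y).
case: (d x) => b k; case: (d y) => c l /=.
case: ifP => [/eqP ->|_]; last by rewrite eqxx.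
by case: b; case: c; rewrite ?subrr ?eqxx.
Qed.

Definition pair_swap (i j : 'I_n) : {perm T} :=
  (tperm (e (false, i)) (e (false, j)) * tperm (e (true, i)) (e (true, j)))%g.

Lemma pair_swapE i j c k : pair_swap i j (e (c, k)) = e (c, tperm i j k).
Proof.
have D0 a b k1 k2 : a != b -> e (a, k1) != e (b, k2).
  by move=> ab; rewrite (inj_eq e_inj) xpair_eqE (negPf ab).
have tD a b k1 k2 k3 : a != b -> tperm (e (a, k1)) (e (a, k2)) (e (b, k3)) = e (b, k3).
  by move=> ab; rewrite tpermD ?D0.
rewrite permM; have [->|ki] := eqVneq k i.
  by case: c; rewrite ?(tD false true) // !tpermL ?(tD true false).
have [->|kj] := eqVneq k j.
  by case: c; rewrite ?(tD false true) // !tpermR ?(tD true false).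
have D b k' : k' != k -> e (b, k') != e (c, k).
  by move=> h; rewrite (inj_eq e_inj) xpair_eqE (negPf h) andbF.
by rewrite !tpermD ?D // eq_sym.
Qed.

(** The exchange is a product of two transpositions, hence even, and it relabels the pairs
    injectively while keeping sides, so no coefficient changes. *)
Lemma pairing_term_swap s i j : pairing_term (s * pair_swap i j)%g = pairing_term s.
Proof.
rewrite /pairing_term; congr (_ * _).
  rewrite !odd_permM !odd_tperm !(inj_eq e_inj) !xpair_eqE /=.
  by rewrite addbb addbF.
apply: eq_bigr => k _; rewrite !(permM s).
case E1 : (d (s (e (false, k)))) => [b1 k1]; case E2 : (d (s (e (true, k)))) => [b2 k2].
have {}E1 : s (e (false, k)) = e (b1, k1) by rewrite -E1 dK.
have {}E2 : s (e (true, k)) = e (b2, k2) by rewrite -E2 dK.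
rewrite E1 E2 !pair_swapE /pairing_coef !eK /=.
by rewrite (inj_eq perm_inj).
Qed.

(** A nonzero term means that [s] sends pairs to pairs. The flip then reverses the sign of exactly
    one coefficient, and this cancels the sign of the transposition. *)
Lemma pairing_term_flip s j : pairing_term s != 0 ->
  pairing_term (s * tperm (e (false, j)) (e (true, j)))%g = pairing_term s.
Proof.
rewrite {1}/pairing_term mulf_eq0 negb_or => /andP[_ /prodf_neq0 nz].
set t := tperm _ _.
have tE c k : t (e (c, k)) = e ((k == j) (+) c, k).
  rewrite /t; have [->|kj] := eqVneq k j; first by case: c; rewrite ?tpermL ?tpermR.
  by rewrite tpermD // (inj_eq e_inj) xpair_eqE [j == _]eq_sym (negPf kj) andbF.
have Jt x y : pairing_coef (t x) (t y) = (-1) ^+ ((d x).2 == j) * pairing_coef x y.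
  rewrite -[x]dK -[y]dK; case: (d x) => b k; case: (d y) => c l.
  rewrite !tE /pairing_coef !eK /=; case: (eqVneq k l) => [->|_]; last by rewrite mulr0.
  by case: (l == j); case: b; case: c; rewrite /= ?expr0 ?expr1; lra.
have pp c i : (d (s (e (c, i)))).2 = (d (s (e (false, i)))).2.
  by case: c => //; rewrite (pairing_coef_neq0 (nz i isT)) /flip eK.
(* [i0] is the pair that [s] carries onto pair [j]; its coefficient is the one that changes sign. *)
pose i0 := (d ((s^-1)%g (e (false, j)))).2.
have si0 i : ((d (s (e (false, i)))).2 == j) = (i == i0).
  apply/eqP/eqP => [kj|->]; last first.
    by rewrite -(pp (d ((s^-1)%g (e (false, j)))).1) -surjective_pairing dK permKV eK.
  have [c sc] : exists c, s (e (c, i)) = e (false, (d (s (e (false, i)))).2).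
    case E : (d (s (e (false, i)))) => [[] k] /=; last by exists false; rewrite -E dK.
    by exists true; rewrite (pairing_coef_neq0 (nz i isT)) /flip E.
  by rewrite kj in sc; rewrite /i0 -sc permK eK.
rewrite /pairing_term odd_permM odd_tperm (inj_eq e_inj) /=.
under eq_bigr => i _ do rewrite !permM Jt si0.
rewrite big_split /= (bigD1 i0) //= eqxx expr1 big1 ?mulr1; last first.
  by move=> i /negPf ->.
by rewrite addbT signrN !mulNr !mul1r mulrN opprK.
Qed.

(* Flips inside a pair and exchanges of two pairs leave the term unchanged, and
   they reduce [s] to the identity unless the term vanishes. *)
Lemma pairing_term_ge0 s : 0 <= pairing_term s.
Proof.
pose bad (s : {perm T}) : {set 'I_n} := [set i | s (e (false, i)) != e (false, i)]%SET.
have [m] := ubnP #|bad s|; elim: m s => // m IH s.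
have [->//|nzF] := eqVneq (pairing_term s) 0.
have := nzF; rewrite {1}/pairing_term mulf_eq0 negb_or => /andP[_ /prodf_neq0 nz] lt_m.
have [bad0|[i]] := set_0Vmem (bad s).
  have sf i : s (e (false, i)) = e (false, i).
    apply/eqP/negPn/negP => h; have : i \in bad s by rewrite inE.
    by rewrite bad0 finset.inE.
  suff -> : s = 1%g.
    rewrite /pairing_term odd_perm1 mul1r prodr_ge0 // => i _.
    by rewrite !perm1 /pairing_coef !eK eqxx subr_ge0 ler_nat.
  apply/permP => x; rewrite perm1 -[x]dK; case: (d x) => [[] i]; last exact: sf.
  by rewrite (pairing_coef_neq0 (nz i isT)) sf /flip eK.
rewrite inE => bi; case E : (d (s (e (false, i)))) => [b j].
have {}E : s (e (false, i)) = e (b, j) by rewrite -E dK.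
(* After [t], the first vector of pair [i] goes to the first vector of pair [j], and exchanging
   pairs [i] and [j] brings it home, so [i] leaves [bad]. An index outside [bad] differs from [i]
   and from [j], because pair [j] is already the image of pair [i]; it therefore stays outside. *)
pose t : {perm T} := if b then tperm (e (false, j)) (e (true, j)) else 1%g.
have Ft : pairing_term (s * t)%g = pairing_term s.
  by rewrite /t; case: (b); [exact: pairing_term_flip|rewrite mulg1].
rewrite -Ft -(pairing_term_swap _ i j); apply: IH.
rewrite -ltnS; apply: leq_trans lt_m; rewrite ltnS; apply: proper_card.
apply/properP; split; last first.
  exists i; first by rewrite inE.
  rewrite inE negbK (permM (s * t)%g) (permM s) E; have -> : t (e (b, j)) = e (false, j).
    by rewrite /t; case: (b); rewrite ?tpermR ?perm1.
  by rewrite pair_swapE tpermR.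
apply/fintype.subsetP => k; rewrite !inE; apply: contra => /eqP sk.
have ki : k != i by apply: contra bi => /eqP <-; rewrite sk.
have kj : k != j.
  apply/eqP => kj; rewrite -kj in E; case: b E {t Ft} => E.
    have H := pairing_coef_neq0 (nz k isT); rewrite sk /flip eK /= in H.
    by have /perm_inj/e_inj := etrans E (esym H).
  by move: E; rewrite -sk => /perm_inj /e_inj [] ik; rewrite ik eqxx in ki.
rewrite (permM (s * t)%g) (permM s) sk; have -> : t (e (false, k)) = e (false, k).
  rewrite /t; case: (b); rewrite ?perm1 // tpermD // (inj_eq e_inj) xpair_eqE [j == _]eq_sym (negPf kj) ?andbF //.
by rewrite pair_swapE tpermD // eq_sym.
Qed.

End PairingSign.

Section PairIndex.
Context {n : nat}.

Lemma pair_index_subproof (p : bool * 'I_n) : (p.1 + p.2 * 2 < n * 2)%N.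
Proof. by have := ltn_ord p.2; case: p.1; lia. Qed.
Definition pair_index p : 'I_(n * 2) := Ordinal (pair_index_subproof p).

Lemma index_pair_subproof (x : 'I_(n * 2)) : (x./2 < n)%N.
Proof. by have := ltn_ord x; lia. Qed.
Definition index_pair (x : 'I_(n * 2)) : bool * 'I_n := (odd x, Ordinal (index_pair_subproof x)).

Lemma pair_indexK : cancel pair_index index_pair.
Proof.
move=> [b i]; rewrite /index_pair /pair_index; congr (_, _).
  by rewrite /= oddD oddM andbF addbF oddb.
by apply: val_inj => /=; case: b; lia.
Qed.

Lemma index_pairK : cancel index_pair pair_index.
Proof. by move=> x; apply: val_inj => /=; lia. Qed.

End PairIndex.

(** * Powers of a 2-form as sums over permutations *)

Section WedgePow.
Context {R : realType} {E : normedModType R}.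
Variables (B : E -> E -> R) (beta : ('I_2 -> E) -> R).
Hypothesis betaE : forall w, beta w = B (w ord0) (w ord_max).

(** Expanding the inner power in each term of the wedge product gives a double sum over [s] and [t].
    A permutation [t] of the last positions can be absorbed into [s], so each [t] contributes the
    same total. *)
Lemma wedge_pow_sum n : exists2 c : R, 0 < c & forall w : 'I_(n * 2) -> E,
  wedge_pow beta n w = c * \sum_(s : 'S_(n * 2)) (-1) ^+ s *
    \prod_(i < n) B (w (s (pair_index (false, i)))) (w (s (pair_index (true, i)))).
Proof.
have arrange (x b c y z : R) : x * (b * (c * (y * z))) = c * (y * x * (b * z)) by ring.
elim: n => [|n [c c0 IH]].
  exists 1 => // w; rewrite /= mul1r (bigD1 1%g) //= odd_perm1 big_ord0 mulr1.
  rewrite [X in _ + X]big1 ?addr0 // => s /negP[]; apply/eqP/permP => -[m lm]; by [].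
(* The extension fixes the two positions taken by the outer factor [beta] and keeps the sign. *)
pose lft (s : 'S_(n * 2)) : 'S_(n.+1 * 2) := lift_perm ord0 ord0 (lift_perm ord0 ord0 s).
have odd_lft s : odd_perm (lft s) = s by rewrite /lft !odd_lift_perm.
exists ((2`! * (n * 2)`!)%:R^-1 * c * (#|{perm 'I_(n * 2)}|)%:R).
  rewrite !mulr_gt0 // ?invr_gt0 ltr0n ?muln_gt0 ?fact_gt0 //.
  by apply/card_gt0P; exists 1%g.
move=> w; rewrite /= /wedge -!mulrA; congr (_ * _).
pose F (s : 'S_(n.+1 * 2)) := (-1) ^+ s *
    \prod_(i < n.+1) B (w (s (pair_index (false, i)))) (w (s (pair_index (true, i)))).
rewrite -/(\sum_s F s).
transitivity (\sum_(s : 'S_(n.+1 * 2)) \sum_(t : 'S_(n * 2)) c * F (lft t * s)%g).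
  apply: eq_bigr => s _; rewrite IH betaE.
  rewrite !mulr_sumr; apply: eq_bigr => t _.
  rewrite /F odd_permM odd_lft signr_addb big_ord_recl.
  have lE b : lft t (pair_index (b, ord0)) = lshift (n * 2) (inord b : 'I_2).
    have -> : pair_index (b, ord0) = if b then lift ord0 ord0 else ord0 :> 'I_(n * 2).+2.
      by apply: val_inj; case: b.
    rewrite /lft; case: b; rewrite ?lift_perm_lift ?lift_perm_id; apply: val_inj; rewrite /= inordK //.
  have rE b i : lft t (pair_index (b, lift ord0 i)) = rshift 2 (t (pair_index (b, i))).
    have -> : pair_index (b, lift ord0 i) = lift ord0 (lift ord0 (pair_index (b, i))) :> 'I_(n * 2).+2.
      by apply: val_inj; rewrite /= /bump /=; lia.
    by rewrite /lft !lift_perm_lift; apply: val_inj; rewrite /= /bump !leq0n.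
  rewrite !permM !lE.
  have -> : inord false = ord0 :> 'I_2 by apply: val_inj; rewrite /= inordK.
  have -> : inord true = ord_max :> 'I_2 by apply: val_inj; rewrite /= inordK.
  under [in RHS]eq_bigr => i _ do rewrite !permM !rE.
  exact: arrange.
rewrite exchange_big /= (eq_bigr (fun=> c * \sum_s F s)); last first.
  move=> t _; rewrite mulr_sumr.
  rewrite [RHS](reindex_inj (mulgI (lft t))) /=; by [].
by rewrite sumr_const -mulr_natr; ring.
Qed.

Lemma wedge_perm k l (a : ('I_k -> E) -> R) (b : ('I_l -> E) -> R) (t : 'S_(k + l)) v :
  wedge a b (fun i => v (t i)) = (-1) ^+ t * wedge a b v.
Proof.
have arrange (x y z : R) : y * y = 1 -> x * z = y * (x * y * z).
  by move=> yy; rewrite -[LHS]mul1r -yy; ring.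
rewrite /wedge mulrCA; congr (_ * _); rewrite mulr_sumr.
rewrite [RHS](reindex_inj (mulIg t)) /=; apply: eq_bigr => s _.
rewrite odd_permM signr_addb.
have -> : (fun i => v (t (s (lshift l i)))) = (fun i => v ((s * t)%g (lshift l i))).
  by apply/funext => i; rewrite permM.
have -> : (fun i => v (t (s (rshift k i)))) = (fun i => v ((s * t)%g (rshift k i))).
  by apply/funext => i; rewrite permM.
apply: arrange; rewrite -expr2; exact: sqrr_sign.
Qed.

(* [p (2 * i)] and [p (2 * i + 1)] are the conjugate vectors e_i and f_i. *)
Definition symplectic_family n (p : nat -> E) := forall a b, (a < n * 2)%N -> (b < n * 2)%N ->
  B (p a) (p b) = if a./2 == b./2 then (odd b)%:R - (odd a)%:R else 0.

Lemma wedge_pow_symplectic n (p : nat -> E) : symplectic_family n p ->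
  0 < wedge_pow beta n (fun i : 'I_(n * 2) => p i).
Proof.
move=> sp; have [c c0 ->] := wedge_pow_sum n; rewrite mulr_gt0 //.
rewrite (eq_bigr (fun s => pairing_term (R := R) pair_index index_pair s)); last first.
  move=> s _; rewrite /pairing_term; congr (_ * _); apply: eq_bigr => i _.
  by rewrite sp // /pairing_coef /index_pair /= -val_eqE.
rewrite (bigD1 1%g) //=; apply: ltr_wpDr.
  by apply: sumr_ge0 => s _; apply: pairing_term_ge0; [exact: pair_indexK|exact: index_pairK].
rewrite /pairing_term odd_perm1 mul1r; apply: prodr_gt0 => i _.
by rewrite !perm1 /pairing_coef !pair_indexK eqxx subr0 ltr01.
Qed.

Lemma wedge_pow_perm n (t : 'S_(n * 2)) v :
  wedge_pow beta n (fun i => v (t i)) = (-1) ^+ t * wedge_pow beta n v.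
Proof.
case: n t v => [|n] t v; last exact: wedge_perm.
have -> : t = 1%g by apply/permP => -[].
by rewrite odd_perm1 mulr1.
Qed.

(** A permutation that moves position 0 feeds some [p a] to [eta] and contributes 0. One that fixes
    it permutes the arguments of the power, and the two signs cancel. *)
Lemma wedge_one_symplectic n (p : nat -> E) (l : E -> R) (e0 : E) (eta : ('I_1 -> E) -> R) :
  (forall w, eta w = l (w ord0)) -> symplectic_family n p ->
  (forall a, (a < n * 2)%N -> l (p a) = 0) -> l e0 != 0 ->
  wedge eta (wedge_pow beta n) (fun i : 'I_(1 + n * 2) => if i == ord0 then e0 else p i.-1) != 0.
Proof.
move=> etaE sp lp l0; rewrite /wedge; apply: mulf_neq0.
  by rewrite invr_eq0 pnatr_eq0 -lt0n muln_gt0 !fact_gt0.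
pose v (i : 'I_(1 + n * 2)) := if i == ord0 then e0 else p i.-1.
pose G (s : 'S_(1 + n * 2)) := (-1) ^+ s * (eta (fun i => v (s (lshift (n * 2) i))) *
         wedge_pow beta n (fun j => v (s (rshift 1 j)))).
(* Dividing by [l e0] makes the terms nonnegative whatever its sign. *)
have G0 s : 0 <= G s / l e0 /\ 0 < G 1%g / l e0.
  have H (t : 'S_(1 + n * 2)) : t ord0 = ord0 -> 0 < G t / l e0.
    move=> t0; have lE : lshift (n * 2) (ord0 : 'I_1) = ord0 by exact: val_inj.
    rewrite /G etaE lE t0 /v eqxx mulrCA mulrAC mulfV // mul1r.
    (* The default [j] is never taken: [t] fixes [ord0], so it sends the other positions away from
       [ord0]. *)
    pose q (j : 'I_(n * 2)) : 'I_(n * 2) := odflt j (unlift (ord0 : 'I_(1 + n * 2)) (t (rshift 1 j))).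
    have rE (j : 'I_(n * 2)) : rshift 1 j = lift ord0 j by exact: val_inj.
    have qE j : t (rshift 1 j) = lift ord0 (q j).
      rewrite /q; case: unliftP => [k ->//|E0].
      by have /perm_inj := etrans E0 (esym t0); rewrite rE => /eqP; rewrite eq_sym (negPf (neq_lift _ _)).
    have q_inj : injective q.
      move=> j k E0; have : t (rshift 1 j) = t (rshift 1 k) by rewrite !qE E0.
      by move=> /perm_inj; rewrite !rE => /lift_inj.
    have tE : t = lift_perm ord0 ord0 (perm q_inj).
      apply/permP => x; case: (unliftP ord0 x) => [j ->|->]; last by rewrite lift_perm_id.
      by rewrite lift_perm_lift permE -qE rE.
    have -> : (fun j => if t (rshift 1 j) == ord0 then e0 else p (t (rshift 1 j)).-1) =
              (fun j => p ((perm q_inj) j)).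
      by apply/funext => j; rewrite qE eq_sym (negPf (neq_lift _ _)) permE.
    rewrite (wedge_pow_perm (perm q_inj) (fun i => p i)) mulrA tE odd_lift_perm /=.
    by rewrite -expr2 sqrr_sign mul1r wedge_pow_symplectic.
  split; last by apply: H; rewrite perm1.
  have [/H/ltW//|s0] := eqVneq (s ord0) ord0.
  rewrite /G etaE [X in v (s X)](_ : _ = ord0); last exact: val_inj.
  have := ltn_ord (s ord0); rewrite /v (negPf s0) => lts; rewrite lp ?mul0r ?mulr0 ?mul0r //.
  have : s ord0 != 0%N :> nat by rewrite -val_eqE in s0.
  by move: lts; lia.
rewrite -/(\sum_s G s).
suff : 0 < (\sum_s G s) / l e0 by apply: contraTneq => ->; rewrite mul0r ltxx.
rewrite mulr_suml (bigD1 1%g) //=; apply: ltr_pwDl; first by have [] := G0 1%g.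
by apply: sumr_ge0 => s _; have [] := G0 s.
Qed.

End WedgePow.

(** * Symplectic bases and a pointwise contact criterion *)

Section ContactLinear.
Context {R : realType} {m : nat}.
Local Notation E := 'rV[R]_m.

Lemma dim_cap_ker (V : {vspace E}) (L : {linear E -> R^o}) : (\dim V <= (\dim (V :&: lker (linfun L))).+1)%N.
Proof.
have H := limg_ker_dim (linfun L) V.
have K : (\dim (linfun L @: V) <= 1)%N.
  by apply: leq_trans (dimvS (subvf _)) _; rewrite dimvf.
by move: K; rewrite -(leq_add2l (\dim (V :&: lker (linfun L)))) H addn1.
Qed.

Variable B : E -> E -> R.
Hypothesis Bl : forall w a u v, B (a *: u + v) w = a * B u w + B v w.
Hypothesis Br : forall w a u v, B w (a *: u + v) = a * B w u + B w v.
Hypothesis Balt : forall u, B u u = 0.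

Lemma alt_bilinear_anti u v : B u v = - B v u.
Proof.
have := Balt (1 *: u + v); rewrite Bl !Br !Balt !mul1r add0r addr0 => /eqP.
by rewrite addr_eq0 => /eqP.
Qed.

(** Symplectic Gram-Schmidt: a hyperbolic pair [e], [f] is split off, and its orthogonal [W] in [V]
    loses at most two dimensions and stays nondegenerate. *)
Lemma symplectic_family_exists n (V : {vspace E}) : (n * 2 <= \dim V)%N ->
  (forall u, u \in V -> (forall w, w \in V -> B u w = 0) -> u = 0) ->
  exists2 p, symplectic_family B n p & forall a, (a < n * 2)%N -> p a \in V.
Proof.
pose BL w : {linear E -> R^o} := HB.pack (B w : E -> R^o) (GRing.isLinear.Build R E R^o _ (B w) (Br w)).
elim: n V => [|n IH] V dV nd; first by exists (fun=> 0).
have [e eV e0] : exists2 e, e \in V & e != 0.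
  exists (vpick V); first exact: memv_pick.
  by rewrite vpick0 -dimv_eq0 -lt0n; apply: leq_trans dV.
have [f fV ef] : exists2 f, f \in V & B e f = 1.
  have [g gV eg] : exists2 g, g \in V & B e g != 0.
    apply: contrapT => H; move/eqP: e0; apply; apply: nd => // w wV.
    by apply: contrapT => /eqP ew; apply: H; exists w.
  exists ((B e g)^-1 *: g); first exact: memvZ.
  have B0 : B e 0 = 0 := linear0 (BL e).
  by have := Br e (B e g)^-1 g 0; rewrite B0 !addr0 => ->; rewrite mulVf.
pose W := ((V :&: lker (linfun (BL e))) :&: lker (linfun (BL f)))%VS.
have WP w : w \in W <-> [/\ w \in V, B e w = 0 & B f w = 0].
  rewrite !memv_cap !memv_ker !lfunE /=; split=> [/andP[/andP[-> /eqP ->] /eqP ->]//|].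
  by move=> [-> -> ->]; rewrite !eqxx.
have dW : (n * 2 <= \dim W)%N.
  have d1 := dim_cap_ker V (BL e).
  have d2 : (\dim (V :&: lker (linfun (BL e))) <= (\dim W).+1)%N by exact: dim_cap_ker.
  by have := leq_trans dV (leq_trans d1 (d2 : (_ < _.+2)%N)); rewrite mulSn !ltnS.
have fe : B f e = -1 by rewrite alt_bilinear_anti ef.
have ndW u : u \in W -> (forall w, w \in W -> B u w = 0) -> u = 0.
  move=> /WP[uV eu fu] uW; apply: nd => // w wV.
  (* This is the projection of [w] to [W] along [e] and [f]; it has the same pairing as [w] with
     every [u] in [W]. *)
  pose w' := B f w *: e + ((- B e w) *: f + w).
  have : B u w' = 0.
    apply: uW; apply/WP; rewrite /w' !Br !Balt ef fe; split; [|by ring|by ring].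
    by rewrite !memvD ?memvZ.
  by rewrite /w' !Br (alt_bilinear_anti u e) (alt_bilinear_anti u f) eu fu => <-; ring.
have [p ps pW] := IH W dW ndW.
exists (fun a => if a is a'.+2 then p a' else if a is 1 then f else e).
  move=> [|[|a]] [|[|b]] //= ha hb; rewrite ?Balt ?ef ?fe ?subrr ?subr0 ?sub0r //.
  - by have /WP[] := pW b hb.
  - by have /WP[] := pW b hb.
  - by rewrite alt_bilinear_anti; have /WP[_ -> _] := pW a ha; rewrite oppr0.
  - by rewrite alt_bilinear_anti; have /WP[_ _ ->] := pW a ha; rewrite oppr0.
  - by rewrite ps // eqSS !negbK.
by move=> [|[|a]] //= ha; have /WP[] := pW a ha.
Qed.

End ContactLinear.

(** The kernel of [l] has dimension at least [2 * n] and [B] is nondegenerate on it, so it contains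
    a symplectic family; [e] with [l e != 0] completes the arguments. *)
Lemma wedge_contact_neq0 {R : realType} {n : nat} (l : 'rV[R]_(2 * n).+1 -> R)
  (B : 'rV[R]_(2 * n).+1 -> 'rV[R]_(2 * n).+1 -> R) eta beta :
  (forall a u v, l (a *: u + v) = a * l u + l v) ->
  (forall w a u v, B (a *: u + v) w = a * B u w + B v w) ->
  (forall w a u v, B w (a *: u + v) = a * B w u + B w v) ->
  (forall u, B u u = 0) ->
  (forall w : 'I_1 -> 'rV_(2 * n).+1, eta w = l (w ord0)) ->
  (forall w : 'I_2 -> 'rV_(2 * n).+1, beta w = B (w ord0) (w ord_max)) ->
  (exists e, l e != 0) ->
  (forall u, l u = 0 -> (forall w, l w = 0 -> B u w = 0) -> u = 0) ->
  exists v, wedge eta (wedge_pow beta n) v != 0.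
Proof.
move=> ll Bl Br Balt etaE betaE [e0 l0] nd.
pose L : 'rV[R]_(2 * n).+1 -> R^o := l.
pose LM := GRing.isLinear.Build R _ R^o _ L ll.
pose LL : {linear 'rV[R]_(2 * n).+1 -> R^o} := HB.pack L LM.
have VP u : (u \in lker (linfun LL)) = (l u == 0) by rewrite memv_ker lfunE.
have [||p ps pV] := @symplectic_family_exists R _ B Bl Br Balt n (lker (linfun LL)).
- have := dim_cap_ker fullv LL; rewrite capfv dimvf /dim /=; lia.
- move=> u; rewrite VP => /eqP lu H; apply: nd => // w lw; apply: H; rewrite VP lw; exact/eqP.
eexists; apply: (wedge_one_symplectic betaE etaE ps) l0.
by move=> a /pV; rewrite VP => /eqP.
Qed.

(** * Maps between charted spaces *)

Section Charts.
Context {R : realType}.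

(** Compatibility of charts is left out, so that the calculus below applies to models, to products,
    and to the level set before its charts are compared. *)
Definition charted_ok (E : normedModType R) (M : charted E) :=
  (forall c, atlas M c -> is_chart c) /\ (forall p : M, exists2 c, atlas M c & dom c p).

Lemma smooth_manifold_ok (E : normedModType R) (M : charted E) : smooth_manifold M -> charted_ok M.
Proof. by case. Qed.

Section OneChart.
Context {E : normedModType R} {M : topologicalType}.
Variables (c : chart E M).
Hypothesis hc : is_chart c.

(** Main localization tool: it turns statements true near a point of the manifold into statements
    true near its coordinates. *)
Lemma chart_near (p : M) (A : set M) : dom c p -> nbhs p A ->
  \forall x \near fwd c p, [/\ A (inv c x), dom c (inv c x) & fwd c (inv c x) = x].
Proof.
move=> cp Ap; have ip : (fwd c @` dom c) (fwd c p) by exists p.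
have n1 : nbhs (fwd c p) (fwd c @` dom c) by apply: open_nbhs_nbhs; split=> //; exact: chart_img_open.
have n2 : nbhs (fwd c p) (inv c @^-1` A).
  by apply: (chart_inv_cont hc ip); rewrite (chart_fwdK hc cp).
apply: filterS2 n1 n2 => x [q cq <-]; rewrite /= (chart_fwdK hc cq) => Aq.
by split.
Qed.

Lemma cdomE (U : set M) x : cdom U c x <-> exists p, [/\ dom c p, U p & fwd c p = x].
Proof.
split=> [[[p cp <-]]|[p [cp Up <-]]]; first by rewrite (chart_fwdK hc cp); exists p.
by split; [exists p|rewrite (chart_fwdK hc cp)].
Qed.

Lemma cdom_fwd (U : set M) p : dom c p -> U p -> cdom U c (fwd c p).
Proof. by move=> cp Up; apply/cdomE; exists p. Qed.

Lemma cdom_open (U : set M) : (forall p, U p -> dom c p -> nbhs p U) -> open (cdom U c).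
Proof.
move=> oU; rewrite openE => x /cdomE [p [cp Up <-]].
apply: filterS (chart_near cp (oU p Up cp)) => y [Uy cy ey].
by rewrite /= -ey; exact: cdom_fwd.
Qed.

End OneChart.

Section Maps.
Context {E F G : normedModType R} {M : charted E} {N : charted F} {K : charted G}.
Hypotheses (okM : charted_ok M) (okN : charted_ok N).

Definition smap_at (f : M -> N) (p : M) := {for p, continuous f} /\
  forall c d, atlas M c -> atlas N d -> dom c p -> dom d (f p) -> smooth_at (loc_rep f c d) (fwd c p).

Lemma smooth_map_onP (W : set M) (f : M -> N) : open W ->
  smooth_map_on W f <-> forall p, W p -> smap_at f p.
Proof.
move=> oW; split=> [[cf sf] p Wp|H].
  split=> [|c d ac ad cp dp]; first exact: cf.
  have hc := okM.1 c ac; have hd := okN.1 d ad.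
  have oc : open (cdom (W `&` f @^-1` dom d) c).
    apply: (cdom_open hc) => q [Wq dq] _; apply: filterI; first exact: open_nbhs_nbhs.
    by apply: (cf q Wq); apply: open_nbhs_nbhs; split=> //; exact: chart_dom_open.
  by apply: (smooth_onP (loc_rep f c d) oc).1; [exact: sf|exact: cdom_fwd].
split=> [p /H[]//|c d ac ad]; apply: smooth_on_at => x /(cdomE (okM.1 c ac)) [p [cp [Wp dp] <-]].
by have [_] := H p Wp; apply.
Qed.

Lemma smap_at_near_eq (f g : M -> N) p : (\forall q \near p, f q = g q) -> smap_at f p -> smap_at g p.
Proof.
move=> fg [cf sf]; split; first exact: near_eq_continuous cf.
move=> c d ac ad cp dp; rewrite -(nbhs_singleton fg) in dp.
apply: smooth_at_near_eq (sf c d ac ad cp dp).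
by apply: filterS (chart_near (okM.1 c ac) cp fg) => x [h _ _]; rewrite /loc_rep h.
Qed.

Definition tmap (f : M -> N) (c : chart E M) (d : chart F N) (p : M) : E -> F := 'd (loc_rep f c d) (fwd c p).

Lemma tmap_near_eq (f g : M -> N) (c : chart E M) (d : chart F N) (p : M) : atlas M c -> atlas N d -> dom c p -> dom d (f p) ->
  (\forall q \near p, f q = g q) -> smap_at f p -> tmap f c d p = tmap g c d p.
Proof.
move=> ac ad cp dp fg [_ sf].
have N1 : \forall x \near fwd c p, loc_rep f c d x = loc_rep g c d x.
  by apply: filterS (chart_near (okM.1 c ac) cp fg) => x [h _ _]; rewrite /loc_rep h.
by rewrite /tmap; have [_ ->] := near_eq_diff N1 (smooth_at_diff (sf c d ac ad cp dp)).
Qed.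

Lemma loc_rep_fwd (f : M -> N) (c : chart E M) (d : chart F N) (p : M) : atlas M c -> dom c p -> loc_rep f c d (fwd c p) = fwd d (f p).
Proof. by move=> ac cp; rewrite /loc_rep (chart_fwdK (okM.1 c ac) cp). Qed.

Lemma smap_at_near (f : M -> N) p (A : set N) : smap_at f p -> nbhs (f p) A -> nbhs p (f @^-1` A).
Proof. by move=> [cf _]; apply: cf. Qed.

Lemma dom_nbhs d q : atlas N d -> dom d q -> nbhs q (dom d).
Proof. by move=> ad dq; apply: open_nbhs_nbhs; split=> //; exact: (chart_dom_open (okN.1 d ad)). Qed.

Lemma loc_rep_comp (f : M -> N) (g : N -> K) (c : chart E M) (d : chart F N) (e : chart G K) (p : M) : atlas M c -> atlas N d -> dom c p -> dom d (f p) ->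
  smap_at f p ->
  \forall x \near fwd c p, loc_rep (fun q => g (f q)) c e x = loc_rep g d e (loc_rep f c d x).
Proof.
move=> ac ad cp dp sf.
apply: filterS (chart_near (okM.1 c ac) cp (smap_at_near sf (dom_nbhs ad dp))) => x [h _ _].
by rewrite /loc_rep (chart_fwdK (okN.1 d ad) h).
Qed.

End Maps.

Section Comp.
Context {E F G : normedModType R} {M : charted E} {N : charted F} {K : charted G}.
Hypotheses (okM : charted_ok M) (okN : charted_ok N) (fF : fin_dim F).

Lemma smap_at_comp (f : M -> N) (g : N -> K) p :
  smap_at f p -> smap_at g (f p) -> smap_at (fun q => g (f q)) p.
Proof.
move=> sf sg; split; first by apply: continuous_comp; [exact: sf.1|exact: sg.1].
move=> c e ac ae cp ep; have [d ad dp] := okN.2 (f p).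
apply: (@smooth_at_near_eq _ _ _ (fun x => loc_rep g d e (loc_rep f c d x))).
  by apply: filterS (loc_rep_comp okM okN g e ac ad cp dp sf) => x ->.
apply: smooth_at_comp => //; first exact: sf.2.
by rewrite (loc_rep_fwd okM) //; exact: sg.2.
Qed.

Lemma tmap_comp (f : M -> N) (g : N -> K) (c : chart E M) (d : chart F N) (e : chart G K) (p : M) v :
  atlas M c -> atlas N d -> atlas K e -> dom c p -> dom d (f p) -> dom e (g (f p)) ->
  smap_at f p -> smap_at g (f p) ->
  tmap (fun q => g (f q)) c e p v = tmap g d e (f p) (tmap f c d p v).
Proof.
move=> ac ad ae cp dp ep sf sg.
have H : \forall x \near fwd c p, (loc_rep g d e \o loc_rep f c d) x = loc_rep (fun q => g (f q)) c e x.
  by apply: filterS (loc_rep_comp okM okN g e ac ad cp dp sf) => x ->.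
have d1 := smooth_at_diff (sf.2 c d ac ad cp dp).
have := smooth_at_diff (sg.2 d e ad ae dp ep); rewrite -(loc_rep_fwd okM f d ac cp) => d2.
rewrite /tmap; have [_ ->] := near_eq_diff H (differentiable_comp d1 d2).
by rewrite (diff_comp d1 d2) /= (loc_rep_fwd okM).
Qed.

End Comp.

(** This is the compatibility of the atlas in pointwise form; changes of charts thereby become an
    instance of general maps. *)
Lemma smap_at_id (E : normedModType R) (M : charted E) p : smooth_manifold M -> smap_at (fun q : M => q) p.
Proof.
move=> hM; have okM := smooth_manifold_ok hM; split=> [|c d ac ad cp dp]; first exact: cvg_id.
have := mfd_compat hM ac ad; move/(smooth_onP _ (cdom_open (okM.1 c ac) _)); apply.
  by move=> q dq _; apply: dom_nbhs.
by apply: (cdom_fwd (okM.1 c ac)).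
Qed.

Lemma tmap_id (E : normedModType R) (M : charted E) (okM : charted_ok M) (c : chart E M) p v :
  atlas M c -> dom c p -> tmap (fun q : M => q) c c p v = v.
Proof.
move=> ac cp; rewrite /tmap.
have H : \forall x \near fwd c p, id x = loc_rep (fun q : M => q) c c x.
  by apply: filterS (chart_near (okM.1 c ac) cp filterT) => x [_ _ h]; rewrite /loc_rep h.
by have [_ ->] := near_eq_diff H (ex_diff (is_diff_def := is_diff_id _)); rewrite (diff_val (is_diff_def := is_diff_id _)).
Qed.

Lemma tmap_linear (E F : normedModType R) (M : charted E) (N : charted F) (f : M -> N) (c : chart E M) (d : chart F N) (p : M) a u v :
  tmap f c d p (a *: u + v) = a *: tmap f c d p u + tmap f c d p v.
Proof. exact: linearP. Qed.

Lemma tmap0 (E F : normedModType R) (M : charted E) (N : charted F) (f : M -> N) (c : chart E M) (d : chart F N) (p : M) :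
  tmap f c d p 0 = 0.
Proof. exact: linear0. Qed.

Lemma open_setX (T U : topologicalType) (A : set T) (B : set U) : open A -> open B -> open (A `*` B).
Proof.
move=> oA oB; rewrite openE => -[x y] [/= Ax By].
by exists (A, B) => //=; split; exact: open_nbhs_nbhs.
Qed.

Lemma model_ok (E : normedModType R) : charted_ok (model E).
Proof.
split=> [c ->|p]; last by exists (Chart setT id id).
split => //=; [exact: openT|by rewrite image_id; exact: openT|by move=> p _; exact: cvg_id|by move=> p _; exact: cvg_id].
Qed.

Lemma prod_ok (E F : normedModType R) (M : charted E) (N : charted F) :
  charted_ok M -> charted_ok N -> charted_ok (prod_charted M N).
Proof.
move=> [cM vM] [cN vN]; split.
  move=> e [c [d [ac ad ->]]]; have hc := cM c ac; have hd := cN d ad.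
  have img : (fwd (prod_chart c d) @` dom (prod_chart c d)) = (fwd c @` dom c) `*` (fwd d @` dom d).
    apply/seteqP; split=> [x [[p q] [/= cp dq] <-]|[x y] [/= [p cp <-] [q dq <-]]].
      by split; [exists p|exists q].
    by exists (p, q).
  split.
  - by apply: open_setX; [exact: chart_dom_open|exact: chart_dom_open].
  - by rewrite img; apply: open_setX; [exact: chart_img_open|exact: chart_img_open].
  - by move=> [p q] [/= cp dq]; rewrite /= (chart_fwdK hc) // (chart_fwdK hd).
  - move=> [p q] [/= cp dq]; apply: cvg_pair.
      by apply: (continuous_comp (f := fst) (g := fwd c)); [exact: cvg_fst|exact: chart_fwd_cont].
    by apply: (continuous_comp (f := snd) (g := fwd d)); [exact: cvg_snd|exact: chart_fwd_cont].
  - rewrite img => -[x y] [/= ix iy]; apply: cvg_pair.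
      by apply: (continuous_comp (f := fst) (g := inv c)); [exact: cvg_fst|exact: chart_inv_cont].
    by apply: (continuous_comp (f := snd) (g := inv d)); [exact: cvg_snd|exact: chart_inv_cont].
move=> [p q]; have [c ac cp] := vM p; have [d ad dq] := vN q.
by exists (prod_chart c d) => //; exists c, d.
Qed.

Lemma smap_at_pair (E F G : normedModType R) (M : charted E) (N : charted F) (K : charted G)
  (f : M -> N) (g : M -> K) p : smap_at f p -> smap_at g p ->
  @smap_at _ _ M (prod_charted N K) (fun q => (f q, g q)) p.
Proof.
move=> sf sg; split; first by apply: cvg_pair; [exact: sf.1|exact: sg.1].
move=> c _ ac [d [e [ad ae ->]]] cp [/= dp ep].
by apply: smooth_at_pair; [exact: sf.2|exact: sg.2].
Qed.

End Charts.

(** * Exterior derivatives in a chart *)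

Section Leibniz.
Context {R : realType}.
Implicit Types E F G : normedModType R.

(** A predicate rather than a structure, because the components of a form are linear only at points
    of its domain. *)
Definition is_lin F (L : F -> R^o) := forall a u v, L (a *: u + v) = a * (L u : R) + L v.

Lemma is_lin_sum F (L : F -> R^o) I (r : seq I) (a : I -> R) (b : I -> F) : is_lin L ->
  L (\sum_(i <- r) a i *: b i) = \sum_(i <- r) a i * (L (b i) : R).
Proof.
move=> lL; elim: r => [|i r IH]; last by rewrite !big_cons lL IH.
by rewrite !big_nil; have := lL (-1) 0 0; rewrite scaleN1r oppr0 addr0 mulN1r addNr.
Qed.

Lemma deriveZ_fun E F (a : E -> R^o) (f : E -> F) (x u : E) :
  differentiable a x -> differentiable f x ->
  'D_u (fun y => (a y : R) *: f y) x = (a x : R) *: 'D_u f x + ('D_u a x : R) *: f x.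
Proof.
move=> da df; have [d1 d2] := diffZ_fun da df.
by rewrite (deriveE _ d1) d2 (deriveE _ da) (deriveE _ df).
Qed.

Lemma derive_sum_fun E F m (f : 'I_m -> E -> F) (x u : E) :
  (forall i, differentiable (f i) x) ->
  'D_u (fun y => \sum_(i < m) f i y) x = \sum_(i < m) 'D_u (f i) x.
Proof.
move=> df; have -> : (fun y => \sum_(i < m) f i y) = \sum_(i < m) f i.
  by apply/funext => y; rewrite fct_sumE.
by rewrite derive_sum // => i; exact: diff_derivable.
Qed.

(** Expanding the moving argument in a finite family reduces the rule to products of scalar
    functions, so differentiability of [L] at each fixed argument suffices. *)
Lemma leibniz_lin E F (L : E -> F -> R^o) (g : E -> F) (x u : E) : fin_dim F ->
  (\forall y \near x, is_lin (L y)) -> (forall w, differentiable (L^~ w) x) ->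
  differentiable g x ->
  'D_u (fun y => L y (g y)) x = 'D_u (fun y => L y (g x)) x + L x ('D_u g x).
Proof.
move=> [m [b [l [cl lE]]]] lL dL dg.
have dlg i : differentiable (fun y => l i (g y)) x.
  by apply: (differentiable_comp dg); exact: linear_differentiable.
have S (f : E -> F) : (forall i, differentiable (fun y => l i (f y)) x) ->
   'D_u (fun y => L y (f y)) x = \sum_i ((l i (f x) : R) * ('D_u (L^~ (b i)) x : R) + ('D_u (fun y => l i (f y)) x : R) * (L x (b i) : R)).
  move=> df; rewrite (@near_eq_derive _ _ _ _ (fun y => \sum_i (l i (f y) : R) *: (L y (b i)))).
    rewrite derive_sum_fun; first by apply: eq_bigr => i _; rewrite deriveZ_fun.
    by move=> i; have [] := diffZ_fun (df i) (dL (b i)).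
  by apply: filterS lL => y lLy; rewrite {1}(lE (f y)) is_lin_sum.
rewrite (S g dlg) (S (fun=> g x)); last by move=> i; exact: differentiable_cst.
rewrite [in L x _](lE ('D_u g x)) (is_lin_sum _ _ _ (nbhs_singleton lL)) -big_split /=.
apply: eq_bigr => i _; rewrite derive_lin // derive_cst mul0r addr0.
by [].
Qed.

Lemma derive_comp E F G (f : E -> F) (g : F -> G) (x u : E) :
  differentiable f x -> differentiable g (f x) ->
  'D_u (fun y => g (f y)) x = 'D_('D_u f x) g (f x).
Proof.
move=> df dg; rewrite (deriveE _ (differentiable_comp df dg)) (diff_comp df dg) /=.
by rewrite (deriveE _ dg) (deriveE _ df).
Qed.

Lemma partial2 E F (G : R^o * E -> F) t x u : 'D_(0, u) G (t, x) = 'D_u (fun y => G (t, y)) x.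
Proof.
rewrite /derive; have E1 (h : R) : h *: (0 : R^o, u) + (t, x) = (t, h *: u + x).
  by rewrite [LHS]surjective_pairing; congr (_, _); rewrite /= scaler0 add0r.
by under eq_fun => h do rewrite /= E1.
Qed.

Lemma partial1 E F (G : R^o * E -> F) t x : 'D_(1, 0) G (t, x) = derive1 (fun s => G (s, x)) t.
Proof.
rewrite /derive /derive1; have E1 (h : R) : h *: (1 : R^o, 0 : E) + (t, x) = (h + t : R^o, x).
  by rewrite [LHS]surjective_pairing; congr (_, _); rewrite /= ?scaler0 ?add0r // [h *: _]mulr1.
by under eq_fun => h do rewrite /= E1.
Qed.

Lemma smooth_at_lin_app E F (L : E -> F -> R^o) (g : E -> F) (x : E) : fin_dim F ->
  (\forall y \near x, is_lin (L y)) -> (forall w, smooth_at (L^~ w) x) -> smooth_at g x ->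
  smooth_at (fun y => L y (g y)) x.
Proof.
move=> [m [b [l [cl lE]]]] lL sL sg.
have S := @smooth_at_sum _ E R^o _ (index_enum 'I_m) xpredT _ x (fun i _ =>
  smooth_at_scale (smooth_at_lin (cl i) sg) (sL (b i))).
by apply: smooth_at_near_eq S; apply: filterS lL => y lLy; rewrite [in RHS](lE (g y)) is_lin_sum.
Qed.

(* Cartan's formula in a chart, without flows: [H] stands for the orbit map of
   the action and [X] for its generator. *)
Section Homogeneous.
Context {E : normedModType R} (Om : E -> E -> E -> R^o) (H : R^o * E -> E) (x : E).
Hypothesis fE : fin_dim E.
Hypothesis Om_linl : \forall y \near x, forall b, is_lin (fun a => Om y a b).
Hypothesis Om_linr : \forall y \near x, forall a, is_lin (Om y a).
Hypothesis Om_anti : forall a b, Om x a b = - (Om x b a : R).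
Hypothesis Om_smooth : forall a b, smooth_at (fun y => Om y a b) x.
Hypothesis H_smooth : smooth_at H (1, x).
Hypothesis H1 : \forall y \near x, H (1, y) = y.
Hypothesis Om_hom : \forall z \near ((1, x) : R^o * E), forall u w,
  Om (H z) ('D_(0, u) H z) ('D_(0, w) H z) = (z.1 : R) * (Om z.2 u w : R).
Hypothesis Om_closed : forall a b c,
  ('D_a (fun y => Om y b c) x : R) - 'D_b (fun y => Om y a c) x + 'D_c (fun y => Om y a b) x = 0.

Let X (y : E) : E := 'D_(1, 0) H (1, y).

(** The base point moves along [F]: the case of the orbit map serves the homogeneity equation, and
    the case of the identity serves the contraction with [X]. *)
Lemma leibniz_form E' (F f g : E' -> E) (x' u : E') : F x' = x -> smooth_at F x' ->
  smooth_at f x' -> smooth_at g x' ->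
  'D_u (fun y => Om (F y) (f y) (g y)) x' =
  ('D_('D_u F x') (fun y => Om y (f x') (g x')) x : R) + Om x ('D_u f x') (g x') + Om x (f x') ('D_u g x').
Proof.
move=> Fx sF sf sg; have cF := smooth_at_cts sF; rewrite /prop_for /continuous_at Fx in cF.
have lr : \forall y \near x', forall a, is_lin (Om (F y) a) by exact: (cF _ Om_linr).
have ll : \forall y \near x', forall b, is_lin (fun a => Om (F y) a b) by exact: (cF _ Om_linl).
have sO a b : smooth_at (fun y => Om (F y) a b) x'.
  by apply: (smooth_at_comp (g := fun y => Om y a b)) => //; rewrite Fx.
have sOf b : smooth_at (fun y => Om (F y) (f y) b) x'.
  by apply: (smooth_at_lin_app (L := fun y a => Om (F y) a b)) => //; apply: filterS ll => y.
have l1 : \forall y \near x', is_lin (Om (F y) (f y)) by apply: filterS lr => y.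
rewrite (@leibniz_lin E' E (fun y => Om (F y) (f y)) g x' u fE l1
  (fun w => smooth_at_diff (sOf w)) (smooth_at_diff sg)).
have l2 : \forall y \near x', is_lin (fun a => Om (F y) a (g x')) by apply: filterS ll => y.
rewrite (@leibniz_lin E' E (fun y a => Om (F y) a (g x')) f x' u fE l2
  (fun w => smooth_at_diff (sO w (g x'))) (smooth_at_diff sf)).
have dO : differentiable (fun y => Om y (f x') (g x')) (F x') by rewrite Fx; exact: smooth_at_diff.
by rewrite (derive_comp (g := fun y => Om y (f x') (g x')) u (smooth_at_diff sF) dO) Fx.
Qed.

Lemma X_smooth : smooth_at X x.
Proof.
apply: (smooth_at_comp (f := fun y : E => (1 : R^o, y)) (g := 'D_(1, 0) H)).
- by apply: fin_dim_prod => //; exact: fin_dim_real.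
- by apply: smooth_at_pair; [exact: smooth_at_cst|exact: smooth_at_id].
- exact: smooth_at_D.
Qed.

(** This is [L_X Om = Om], the derivative of [Om_hom] in the group variable at 1. Since [H (1, .)]
    is the identity, ['D_(0, v) H] is [v] there, and by symmetry of second derivatives its group
    derivative is ['D_v X]. *)
Lemma homogeneous_derivative u w :
  ('D_(X x) (fun y => Om y u w) x : R) + Om x ('D_u X x) w + Om x u ('D_w X x) = Om x u w.
Proof.
have Hx : H (1, x) = x := nbhs_singleton H1.
have Du v : 'D_(0, v) H (1, x) = v.
  by rewrite partial2 (near_eq_derive _ (g := id)) // derive_id.
have DD v : 'D_(1, 0) ('D_(0, v) H) (1, x) = 'D_v X x.
  by rewrite (@Schwarz_fin R (R^o * E)%type E H (0 : R^o, v) (1 : R^o, 0 : E) (1 : R^o, x) fE H_smooth) partial2.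
have := @leibniz_form (R^o * E)%type H ('D_(0 : R^o, u) H) ('D_(0 : R^o, w) H) (1 : R^o, x) (1 : R^o, 0 : E) Hx H_smooth (smooth_at_D _ H_smooth) (smooth_at_D _ H_smooth).
rewrite !Du !DD => <-.
rewrite (near_eq_derive _ (g := fun z : R^o * E => (z.1 : R) *: (Om z.2 u w))); last first.
  by apply: filterS Om_hom => z.
rewrite deriveZ_fun; last 2 first.
- by apply: linear_differentiable; exact: fst_cts.
- apply: smooth_at_diff; apply: (smooth_at_comp (f := snd) (g := fun y => Om y u w)) => //.
  by apply: smooth_at_linear; exact: snd_cts.
have -> : 'D_(1, 0) (fun z : R^o * E => z.1) (1, x) = 1.
  rewrite partial1 /=; exact: derive1_id.
have -> : 'D_(1, 0) (fun z : R^o * E => Om z.2 u w) (1, x) = 0.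
  by rewrite partial1 /= derive1_cst.
by rewrite scaler0 add0r scale1r.
Qed.

(** Differentiating the slot [X y] adds the terms in ['D_u X] and ['D_w X]; closedness, with [X x]
    frozen, replaces the remaining terms by the derivative along [X x], which completes [L_X Om]. *)
Lemma d_contraction u w :
  ('D_u (fun y => Om y (X y) w) x : R) - 'D_w (fun y => Om y (X y) u) x = Om x u w.
Proof.
have E1 v w' : 'D_v (fun y => Om y (X y) w') x = ('D_v (fun y => Om y (X x) w') x : R) + Om x ('D_v X x) w'.
  have := leibniz_form v (erefl x) (smooth_at_id x) X_smooth (smooth_at_cst w' x).
  rewrite derive_id derive_cst => ->.
  have -> : Om x (X x) 0 = 0.
    have := nbhs_singleton Om_linr (X x) 0 0 0; rewrite scale0r addr0 mul0r add0r => _.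
    have := is_lin_sum [::] (fun=> 0) (fun i : 'I_0 => 0) (nbhs_singleton Om_linr (X x)).
    by rewrite !big_nil.
  by rewrite addr0.
rewrite !E1; have := homogeneous_derivative u w; have := Om_closed (X x) u w.
rewrite (Om_anti u ('D_w X x)).
move: ('D_(X x) _ x) ('D_u (fun _ => _) x) ('D_w (fun _ => _) x) (Om x ('D_u X x) w) (Om x ('D_w X x) u) (Om x u w).
move=> a b c d e f h1 h2; lra.
Qed.

End Homogeneous.

(** Exterior derivative commutes with pullback: the terms with second derivatives of [F] are
    symmetric in [u] and [w] and cancel. *)
Lemma d_pullback E E' (th : E -> E -> R^o) (F : E' -> E) (x' u w : E') : fin_dim E ->
  (\forall y \near F x', is_lin (th y)) -> (forall a, smooth_at (th^~ a) (F x')) -> smooth_at F x' ->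
  ('D_u (fun y => th (F y) ('D_w F y)) x' : R) - 'D_w (fun y => th (F y) ('D_u F y)) x' =
  ('D_('D_u F x') (th^~ ('D_w F x')) (F x') : R) - 'D_('D_w F x') (th^~ ('D_u F x')) (F x').
Proof.
move=> fE lt st sF; have cF := smooth_at_cts sF; rewrite /prop_for /continuous_at in cF.
have l1 : \forall y \near x', is_lin (th (F y)) by exact: (cF _ lt).
have E1 p q : 'D_p (fun y => th (F y) ('D_q F y)) x' =
   ('D_('D_p F x') (th^~ ('D_q F x')) (F x') : R) + th (F x') ('D_p ('D_q F) x').
  have dl a : differentiable (fun y => th (F y) a) x'.
    by apply: smooth_at_diff; exact: (smooth_at_comp (g := th^~ a)).
  have dD := smooth_at_diff (smooth_at_D q sF).
  rewrite (@leibniz_lin E' E (fun y => th (F y)) ('D_q F) x' p fE l1 dl dD).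
  by rewrite (derive_comp (g := th^~ _)) //; exact: smooth_at_diff.
rewrite !E1 (Schwarz_fin w u) // opprD addrACA subrr addr0.
by [].
Qed.

End Leibniz.

(** * Differential forms and pullbacks *)

Section Forms.
Context {R : realType}.

Lemma vcons2 (E : normedModType R) (v : 'I_2 -> E) : v = vcons (v ord0) (fun=> v ord_max).
Proof.
apply/funext => i; rewrite /vcons; case: unliftP => [j ->|->//].
by congr v; apply: val_inj; rewrite /= /bump; case: j => -[].
Qed.

Lemma form1E (E : normedModType R) (a : ('I_1 -> E) -> R) v : a v = a (fun=> v ord0).
Proof. by congr a; apply/funext => i; rewrite (ord1 i). Qed.

Lemma multilinear1 (E : normedModType R) (a : ('I_1 -> E) -> R) :
  multilinear a <-> is_lin (fun w => a (fun=> w) : R^o).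
Proof.
have D (v : 'I_1 -> E) i z : dfwith v i z = fun=> z.
  by apply/funext => j; rewrite (ord1 i) (ord1 j) dfwithin.
by split=> [H r u w|H i v r u w]; [have := H ord0 (fun=> 0) r u w|]; rewrite !D.
Qed.

Lemma vcons_ord0 (E : normedModType R) k (u : E) (v : 'I_k -> E) : vcons u v ord0 = u.
Proof. by rewrite /vcons unlift_none. Qed.

Lemma vcons_lift (E : normedModType R) k (u : E) (v : 'I_k -> E) j : vcons u v (lift ord0 j) = v j.
Proof. by rewrite /vcons liftK. Qed.

Lemma multilinear2 (E : normedModType R) (a : ('I_2 -> E) -> R) : multilinear a ->
  (forall w, is_lin (fun u => a (vcons u (fun=> w)) : R^o)) /\
  (forall u, is_lin (fun w => a (vcons u (fun=> w)) : R^o)).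
Proof.
move=> H; split=> w r u v.
  have D z : dfwith (vcons 0 (fun _ : 'I_1 => w)) ord0 z = vcons z (fun=> w).
    apply/funext => i; case: (@unliftP 2 ord0 i) => [j ->|->].
      by rewrite dfwithout // !vcons_lift.
    by rewrite dfwithin vcons_ord0.
  by have := H ord0 (vcons 0 (fun=> w)) r u v; rewrite !D.
have D z : dfwith (vcons w (fun _ : 'I_1 => 0)) ord_max z = vcons w (fun=> z).
  apply/funext => i; case: (@unliftP 2 ord0 i) => [j ->|->].
    have -> : lift ord0 j = ord_max by rewrite (ord1 j); exact: val_inj.
    by rewrite dfwithin -[ord_max](_ : lift ord0 ord0 = _) ?vcons_lift //; exact: val_inj.
  by rewrite dfwithout // !vcons_ord0.
by have := H ord_max (vcons w (fun=> 0)) r u v; rewrite !D.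
Qed.

Lemma alternating2 (E : normedModType R) (a : ('I_2 -> E) -> R) : alternating a ->
  forall u, a (vcons u (fun=> u)) = 0.
Proof.
move=> H u; apply: (H _ ord0 (lift ord0 ord0)) => //.
by rewrite vcons_ord0 vcons_lift.
Qed.

Lemma ext_d1 (E : normedModType R) (a : E -> ('I_1 -> E) -> R) x v :
  ext_d a x v = 'D_(v ord0) (fun y => a y (fun=> v ord_max) : R^o) x
              - 'D_(v ord_max) (fun y => a y (fun=> v ord0) : R^o) x.
Proof.
have Ef (i : 'I_2) : (fun y => a y (fun j => v (lift i j)) : R^o) = (fun y => a y (fun=> v (lift i ord0)) : R^o).
  by apply/funext => y; rewrite form1E.
rewrite /ext_d big_ord_recl big_ord1 !Ef.
have e1 : lift ord0 ord0 = ord_max :> 'I_2 by exact: val_inj.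
have e2 : lift ord_max ord0 = ord0 :> 'I_2 by exact: val_inj.
by rewrite e1 e2 expr0 mul1r expr1 mulN1r.
Qed.

Lemma ext_d2 (E : normedModType R) (a : E -> ('I_2 -> E) -> R) x u v w :
  ext_d a x (vcons u (vcons v (fun=> w))) =
    'D_u (fun y => a y (vcons v (fun=> w)) : R^o) x
    - 'D_v (fun y => a y (vcons u (fun=> w)) : R^o) x
    + 'D_w (fun y => a y (vcons u (fun=> v)) : R^o) x.
Proof.
set V := vcons u (vcons v (fun=> w)).
have Ef (i : 'I_3) : (fun y => a y (fun j => V (lift i j)) : R^o) =
    (fun y => a y (vcons (V (lift i ord0)) (fun=> V (lift i ord_max))) : R^o).
  by apply/funext => y; congr (a y _); exact: (vcons2 (fun j => V (lift i j))).
rewrite /ext_d 2!big_ord_recl big_ord1 !Ef.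
have V0 : V ord0 = u by rewrite /V vcons_ord0.
have V1 : V (lift ord0 ord0) = v by rewrite /V vcons_lift vcons_ord0.
have V2 : V (lift ord0 (lift ord0 ord0)) = w by rewrite /V !vcons_lift.
have m0 : lift ord0 (ord_max : 'I_2) = lift ord0 (lift ord0 ord0) :> 'I_3 by exact: val_inj.
have m1 : lift (lift ord0 ord0) (ord0 : 'I_2) = ord0 :> 'I_3 by exact: val_inj.
have m2 : lift (lift ord0 ord0) (ord_max : 'I_2) = lift ord0 (lift ord0 ord0) :> 'I_3 by exact: val_inj.
have m3 : lift (lift ord0 (lift ord0 ord0)) (ord0 : 'I_2) = ord0 :> 'I_3 by exact: val_inj.
have m4 : lift (lift ord0 (lift ord0 ord0)) (ord_max : 'I_2) = lift ord0 ord0 :> 'I_3 by exact: val_inj.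
rewrite m0 m1 m2 m3 m4 V0 V1 V2 expr0 mul1r expr1 mulN1r [X in _ ^+ X]/= expr2 mulN1r opprK mul1r.
exact: addrA.
Qed.

Section Pullback.
Context {E F : normedModType R} {M : charted E} {N : charted F}.
Hypotheses (okM : charted_ok M) (hN : smooth_manifold N) (fF : fin_dim F).
Let okN := smooth_manifold_ok hN.

(** The chosen value in [pullback] ranges over all charts at the image point; [form_compat] and the
    chain rule make these candidates equal. *)
Lemma pullbackE k (U : set N) (a : form k N) (f : M -> N) (c : chart E M) (d : chart F N) (p : M) v :
  diff_form U a -> U (f p) -> smap_at f p -> atlas M c -> atlas N d -> dom c p -> dom d (f p) ->
  pullback f a c (fwd c p) v = a d (fwd d (f p)) (fun i => tmap f c d p (v i)).
Proof.
move=> da Uf sf ac ad cp dp; rewrite /pullback; apply: xget_subset1.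
  by exists d; rewrite (chart_fwdK (okM.1 c ac) cp) (loc_rep_fwd okM).
have H d' : atlas N d' -> dom d' (f p) ->
    a d' (loc_rep f c d' (fwd c p)) (fun i => 'd (loc_rep f c d') (fwd c p) (v i)) =
    a d (fwd d (f p)) (fun i => tmap f c d p (v i)).
  move=> ad' dp'; have dc : cdom (U `&` dom d') d (fwd d (f p)).
    by apply: (cdom_fwd (okN.1 d ad)).
  rewrite [RHS](form_compat da _ ad ad' dc) (loc_rep_fwd okM) // (loc_rep_fwd okN) //.
  congr (a _ _ _); apply/funext => i.
  exact: (tmap_comp okM okN (v i) ac ad ad' cp dp dp' sf (smap_at_id _ hN)).
move=> r r' [d1 [a1 p1 ->]] [d2 [a2 p2 ->]]; rewrite (chart_fwdK (okM.1 c ac) cp) in p1 p2.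
by rewrite !H.
Qed.

Lemma form1_lin (U : set N) (a : form 1 N) d q : diff_form U a -> atlas N d -> dom d q -> U q ->
  is_lin (fun w => a d (fwd d q) (fun=> w) : R^o).
Proof.
move=> da ad dq Uq; apply/multilinear1; apply: (form_linear da ad).
exact: (cdom_fwd (okN.1 d ad)).
Qed.

Lemma form1_near_lin (U : set N) (a : form 1 N) d q : open U -> diff_form U a -> atlas N d -> dom d q -> U q ->
  \forall y \near fwd d q, is_lin (fun w => a d y (fun=> w) : R^o).
Proof.
move=> oU da ad dq Uq.
have Uq' : nbhs q U by exact: open_nbhs_nbhs.
apply: filterS (chart_near (okN.1 d ad) dq Uq') => y [Uy dy <-].
exact: form1_lin da _ _ _.
Qed.

Lemma form_smooth_at k (U : set N) (a : form k N) d q w : open U -> diff_form U a -> atlas N d -> dom d q -> U q ->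
  smooth_at (fun y => a d y w : R^o) (fwd d q).
Proof.
move=> oU da ad dq Uq; have := form_smooth da w ad.
move/(smooth_onP _ (cdom_open (okN.1 d ad) _)); apply; last exact: (cdom_fwd (okN.1 d ad)).
by move=> q' Uq' _; exact: open_nbhs_nbhs.
Qed.

Lemma pullback_near (U : set N) (a : form 1 N) (f : M -> N) (c : chart E M) (d : chart F N) (p : M) :
  diff_form U a -> (\forall q \near p, smap_at f q /\ U (f q)) -> atlas M c -> atlas N d -> dom c p -> dom d (f p) ->
  \forall y \near fwd c p, forall w, pullback f a c y (fun=> w) = a d (loc_rep f c d y) (fun=> 'D_w (loc_rep f c d) y).
Proof.
move=> da nf ac ad cp dp; have [sf Uf] := nbhs_singleton nf.
have n2 := smap_at_near sf (dom_nbhs okN ad dp).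
apply: filterS (chart_near (okM.1 c ac) cp (filterI nf n2)) => y [[[sy Uy] dy] cy ey] w.
rewrite -ey (pullbackE _ da Uy sy ac ad cy dy) (loc_rep_fwd okM) //.
rewrite /tmap deriveE //; exact: smooth_at_diff (sy.2 c d ac ad cy dy).
Qed.

Lemma pullback_form (U : set N) (a : form 1 N) (W : set M) (f : M -> N) :
  open U -> diff_form U a -> open W -> (forall p, W p -> smap_at f p /\ U (f p)) ->
  (forall p, W p -> smap_at (fun q : M => q) p) -> fin_dim E ->
  diff_form W (pullback f a).
Proof.
move=> oU da oW Wf idM fE; split.
- move=> c x ac /(cdomE (okM.1 c ac)) [p [cp Wp <-]]; have [sf Uf] := Wf p Wp.
  have [d ad dp] := okN.2 (f p).
  apply/multilinear1 => r u v; rewrite !(pullbackE _ da Uf sf ac ad cp dp) tmap_linear.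
  exact: (form1_lin da ad dp Uf r).
- by move=> c x ac _ v i j; rewrite (ord1 i) (ord1 j) eqxx.
- move=> c v ac; apply: smooth_on_at => x /(cdomE (okM.1 c ac)) [p [cp Wp <-]].
  have [sf Uf] := Wf p Wp; have [d ad dp] := okN.2 (f p).
  have nf : \forall q \near p, smap_at f q /\ U (f q).
    by near=> q; apply: Wf; near: q; exact: open_nbhs_nbhs.
  have sF := sf.2 c d ac ad cp dp.
  apply: (@smooth_at_near_eq _ _ _ (fun y => a d (loc_rep f c d y) (fun=> 'D_(v ord0) (loc_rep f c d) y) : R^o)).
    apply: filterS (pullback_near da nf ac ad cp dp) => y H.
    by rewrite [in RHS]form1E H.
  apply: (smooth_at_lin_app (L := fun y w => a d (loc_rep f c d y) (fun=> w) : R^o)) => //.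
  + have := smooth_at_cts sF; rewrite /prop_for /continuous_at (loc_rep_fwd okM) // => cF.
    exact: (cF _ (form1_near_lin oU da ad dp Uf)).
  + move=> w; apply: (smooth_at_comp (g := fun y => a d y (fun=> w) : R^o)) => //.
    by rewrite (loc_rep_fwd okM) //; exact: form_smooth_at da _ _ _.
  + exact: smooth_at_D.
- move=> c c' x v ac ac' /(cdomE (okM.1 c ac)) [p [cp [Wp c'p] <-]].
  have [sf Uf] := Wf p Wp; have [d ad dp] := okN.2 (f p).
  rewrite (loc_rep_fwd okM) // !(pullbackE _ da Uf sf _ ad _ dp) //.
  congr (a _ _ _); apply/funext => i.
  exact: (tmap_comp okM okM (v i) ac ac' ad cp c'p dp (idM p Wp) sf).
Unshelve. all: by end_near. Qed.

End Pullback.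
End Forms.

(** * Geometry of the symplectic bundle *)

Section Line.
Context {R : realType} {E : normedModType R} {M : charted E}.
Hypothesis okM : charted_ok M.

Definition line_chart : chart R^o (line : charted (R^o : normedModType R)) := Chart setT id id.

Lemma line_ok : charted_ok (line : charted (R^o : normedModType R)).
Proof. exact: model_ok. Qed.

Lemma smap_at_lineP (f : M -> (line : charted (R^o : normedModType R))) (p : M) : smap_at f p <->
  forall c, atlas M c -> dom c p -> smooth_at (fun x => f (inv c x) : R^o) (fwd c p).
Proof.
split=> [[_ sf] c ac cp|H]; first exact: (sf c line_chart ac erefl cp I).
split; last by move=> c _ ac -> cp _; exact: H.
have [c ac cp] := okM.2 p; have hc := okM.1 c ac.
have cf := continuous_comp (chart_fwd_cont hc cp) (smooth_at_cts (H c ac cp)).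
apply: near_eq_continuous cf; have N := dom_nbhs okM ac cp.
by apply: filterS N => q cq /=; rewrite (chart_fwdK hc cq).
Qed.

Lemma smap_at_cst (F : normedModType R) (N : charted F) (q : N) (p : M) : smap_at (fun _ : M => q) p.
Proof. by split=> [|c d ac ad cp dp]; [exact: cvg_cst|exact: smooth_at_cst]. Qed.

Lemma smap_at_mul (f g : M -> (line : charted (R^o : normedModType R))) (p : M) :
  smap_at f p -> smap_at g p -> smap_at (fun q => (f q : R) * g q : (line : charted (R^o : normedModType R))) p.
Proof.
move=> /smap_at_lineP sf /smap_at_lineP sg; apply/smap_at_lineP => c ac cp.
exact: (smooth_at_scale (sf c ac cp) (sg c ac cp)).
Qed.

Lemma smap_at_inv (f : M -> (line : charted (R^o : normedModType R))) (p : M) :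
  smap_at f p -> (f p : R) != 0 -> smap_at (fun q => (f q : R)^-1 : (line : charted (R^o : normedModType R))) p.
Proof.
move=> /smap_at_lineP sf f0; apply/smap_at_lineP => c ac cp.
by apply: (smooth_at_inv (sf c ac cp)); rewrite (chart_fwdK (okM.1 c ac) cp).
Qed.

End Line.

Section Bundle.
Context {R : realType} {m k : nat}.
Local Notation EM := 'rV[R]_m.
Local Notation EP := 'rV[R]_k.
Context {M : charted EM} {P : charted EP}.
Variables (tau : P -> M) (h : R -> P -> P) (omega : form 2 P) (s : P -> R).
Hypotheses (hM : smooth_manifold M) (hP : smooth_manifold P).
Hypotheses (sb : symplectic_bundle tau h omega) (hs : calibration h s).

Let okM := smooth_manifold_ok hM.
Let okP := smooth_manifold_ok hP.
Let pb := sb_principal sb.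
Let fP : fin_dim EP := fin_dim_rV k.
Let fM : fin_dim EM := fin_dim_rV m.
Local Notation L := (line : charted (R^o : normedModType R)).
Let okL : charted_ok L := line_ok.
Let okLP : charted_ok (prod_charted L P) := prod_ok okL okP.
Let okLM : charted_ok (prod_charted L M) := prod_ok okL okM.

Let fLP : fin_dim (R^o * EP)%type := fin_dim_prod fin_dim_real fP.
Let fLM : fin_dim (R^o * EM)%type := fin_dim_prod fin_dim_real fM.

Definition act (tp : prod_charted L P) : P := h tp.1 tp.2.

Lemma act_smap_at (t : R) (p : P) : t != 0 -> smap_at act (t : L, p).
Proof.
move=> t0; have := act_smooth pb; have oR : open (Rx `*` setT : set (prod_charted L P)).
  by apply: open_setX; [exact: open_neq|exact: openT].
by move/(smooth_map_onP okLP okP _ oR); apply.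
Qed.

Lemma h_smap_at (t : R) (p : P) : t != 0 -> smap_at (h t) p.
Proof.
move=> t0; apply: (smap_at_comp okP okLP fLP (f := fun q => (t : L, q) : prod_charted L P) (g := act)).
  by apply: smap_at_pair; [exact: smap_at_cst|exact: smap_at_id].
exact: act_smap_at.
Qed.

Lemma tau_smap_at (p : P) : smap_at tau p.
Proof. by have := proj_smooth pb; move/(smooth_map_onP okP okM _ openT); apply. Qed.

Lemma s_smap_at (p : P) : smap_at (s : P -> L) p.
Proof. by have := calib_smooth hs; move/(smooth_map_onP okP okL _ openT); apply. Qed.

Section OrbitMap.
Context (c : chart EP P) (ac : atlas P c).
Let hc := okP.1 c ac.

(** The action read in a single chart at both ends, which is legitimate near [t = 1]; it plays the
    part of [H] in Cartan's formula. *)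
Definition orbit_rep (z : R^o * EP) : EP := fwd c (h z.1 (inv c z.2)).

Lemma orbit_rep_smooth t p : t != 0 -> dom c p -> dom c (h t p) ->
  smooth_at orbit_rep (t : R^o, fwd c p).
Proof.
move=> t0 cp cq; have [_ H] := act_smap_at p t0.
have aL : atlas (prod_charted L P) (prod_chart line_chart c) by exists line_chart, c.
exact: (H _ c aL ac (conj I cp) cq).
Qed.

Lemma generatorE x : generator h c x = 'D_(1 : R^o, 0 : EP) orbit_rep (1 : R^o, x).
Proof. by rewrite partial1. Qed.

Lemma orbit_rep1 p : dom c p -> \forall x \near fwd c p, orbit_rep (1 : R^o, x) = x.
Proof.
move=> cp; apply: filterS (chart_near hc cp filterT) => x [_ _ e].
by rewrite /orbit_rep (act_one pb).
Qed.

Lemma generator_push (F : normedModType R) (N : charted F) (f : P -> N) (d : chart F N) p :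
  atlas N d -> dom c p -> dom d (f p) -> smap_at f p ->
  tmap f c d p (generator h c (fwd c p)) = derive1 (fun t : R => fwd d (f (h t p))) 1.
Proof.
move=> ad cp dp sf.
have ip := chart_fwdK hc cp.
have h1 : h 1 p = p := act_one pb p.
have so : smooth_at orbit_rep (1 : R^o, fwd c p) by apply: orbit_rep_smooth; rewrite ?h1 ?oner_neq0.
have sg : smooth_at (fun t : R^o => orbit_rep (t, fwd c p)) (1 : R^o).
  apply: (smooth_at_comp (f := fun t : R^o => (t, fwd c p))) => //.
  by apply: smooth_at_pair; [exact: smooth_at_id|exact: smooth_at_cst].
have o1 : orbit_rep (1 : R^o, fwd c p) = fwd c p by rewrite /orbit_rep /= ip h1.
have dl : differentiable (loc_rep f c d) (orbit_rep (1 : R^o, fwd c p)).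
  by rewrite o1; exact: smooth_at_diff (sf.2 c d ac ad cp dp).
have := derive_comp (1 : R^o) (smooth_at_diff sg) dl.
rewrite o1 (deriveE (V := EP) (W := F)); last by rewrite -o1.
have -> : 'D_(1 : R^o) (fun t : R^o => orbit_rep (t, fwd c p)) 1 = generator h c (fwd c p).
  by rewrite -derive1E /orbit_rep.
rewrite /tmap => <-; rewrite [RHS]derive1E; apply: near_eq_derive.
have : nbhs (1 : R^o) [set t : R^o | dom c (h t p)].
  have cA : {for (1 : R^o), continuous (fun t : L => h t p)}.
    apply: (@continuous_comp _ _ _ (fun t : L => (t, p) : prod_charted L P) act).
      have sp : @smap_at _ _ _ L (prod_charted L P) (fun t => (t, p)) (1 : L).
        apply: smap_at_pair; last exact: smap_at_cst.
        by apply/(smap_at_lineP okL) => c' -> _; exact: smooth_at_id.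
      exact: sp.1.
    exact: (act_smap_at p (oner_neq0 R)).1.
  by apply: cA; rewrite h1; exact: (dom_nbhs okP ac cp).
by apply: filterS => t ct; rewrite /loc_rep /orbit_rep /= ip (chart_fwdK hc ct).
Qed.

End OrbitMap.

Let om_form : diff_form setT omega := sympl_form (sb_symplectic sb).

Definition Om (c : chart EP P) (y a b : EP) : R^o := omega c y (vcons a (fun=> b)).

Lemma cdom_setT c p : atlas P c -> dom c p -> cdom setT c (fwd c p).
Proof. by move=> ac cp; apply: (cdom_fwd (okP.1 c ac)). Qed.

Lemma Om_linl c p b : atlas P c -> dom c p -> is_lin (fun a => Om c (fwd c p) a b).
Proof. by move=> ac cp; exact: (multilinear2 (form_linear om_form ac (cdom_setT ac cp))).1. Qed.

Lemma Om_linr c p a : atlas P c -> dom c p -> is_lin (Om c (fwd c p) a).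
Proof. by move=> ac cp; exact: (multilinear2 (form_linear om_form ac (cdom_setT ac cp))).2. Qed.

Lemma Om_alt c p a : atlas P c -> dom c p -> Om c (fwd c p) a a = 0.
Proof. by move=> ac cp; exact: (alternating2 (form_alt om_form ac (cdom_setT ac cp))). Qed.

Lemma Om_anti c p a b : atlas P c -> dom c p -> Om c (fwd c p) a b = - (Om c (fwd c p) b a : R).
Proof.
move=> ac cp; have := Om_alt (1 *: a + b) ac cp.
rewrite (Om_linl _ ac cp) !(Om_linr _ ac cp) !Om_alt // !mul1r add0r addr0 => /eqP.
by rewrite addr_eq0 => /eqP.
Qed.

Lemma near_fwd c p (A : EP -> Prop) : atlas P c -> dom c p -> (forall q, dom c q -> A (fwd c q)) ->
  \forall y \near fwd c p, A y.
Proof.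
move=> ac cp H; apply: filterS (chart_near (okP.1 c ac) cp filterT) => y [_ cy <-].
exact: H.
Qed.

Lemma Om_smooth c p a b : atlas P c -> dom c p -> smooth_at (fun y => Om c y a b) (fwd c p).
Proof. move=> ac cp; exact: (form_smooth_at hP _ openT om_form ac cp I). Qed.

Lemma Om_push (t : R) c d p u w : t != 0 -> atlas P c -> atlas P d -> dom c p -> dom d (h t p) ->
  Om d (fwd d (h t p)) (tmap (h t) c d p u) (tmap (h t) c d p w) = t * (Om c (fwd c p) u w : R).
Proof.
move=> t0 ac ad cp dp.
have := sb_homogeneous sb t0 (vcons u (fun=> w)) ac (cdom_setT ac cp).
rewrite (pullbackE okP hP _ om_form I (h_smap_at p t0) ac ad cp dp) => E.
apply: etrans E; rewrite /Om; congr (omega _ _ _); apply/funext => i.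
by case: (@unliftP 2 ord0 i) => [j ->|->]; rewrite ?vcons_lift ?vcons_ord0.
Qed.

Lemma Om_hom c p : atlas P c -> dom c p ->
  \forall z \near ((1 : R^o, fwd c p) : R^o * EP), forall u w,
    Om c (orbit_rep c z) ('D_(0 : R^o, u) (orbit_rep c) z) ('D_(0 : R^o, w) (orbit_rep c) z) =
    (z.1 : R) * (Om c z.2 u w : R).
Proof.
move=> ac cp; have hc := okP.1 c ac.
have aL : atlas (prod_charted L P) (prod_chart line_chart c) by exists line_chart, c.
have h1 : h 1 p = p := act_one pb p.
have N : nbhs ((1 : L, p) : prod_charted L P) [set tq | tq.1 != 0 /\ dom c (h tq.1 tq.2)].
  apply: filterI.
    have := @cvg_fst L P (nbhs (1 : L)) (nbhs p) _ [set t : L | (t : R) != 0]; apply.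
    by apply: open_nbhs_nbhs; split; [exact: open_neq|exact: oner_neq0].
  apply: (smap_at_near (act_smap_at p (oner_neq0 R)) (A := dom c)).
  by rewrite /act /= h1; exact: (dom_nbhs okP ac cp).
apply: filterS (chart_near (okLP.1 _ aL) (conj I cp : dom (prod_chart line_chart c) (1, p)) N).
move=> [t y] /= [[t0 cq] [_ cy] [ey]] u w.
have D v : 'D_(0 : R^o, v) (orbit_rep c) (t, y) = tmap (h t) c c (inv c y) v.
  have s0 := (h_smap_at (inv c y) t0).2 c c ac ac cy cq; rewrite ey in s0.
  by rewrite partial2 /tmap ey -(deriveE _ (smooth_at_diff s0)).
have := Om_push u w t0 ac ac cy cq; rewrite ey => <-.
by rewrite !D.
Qed.

Lemma liouvilleE c y w : liouville h omega c y w = Om c y (generator h c y) (w ord0).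
Proof. by rewrite /liouville /Om; congr (omega _ _ (vcons _ _)); apply/funext => i; rewrite (ord1 i). Qed.

Lemma liouville_ext_d c p u w : atlas P c -> dom c p ->
  ('D_u (fun y => liouville h omega c y (fun=> w) : R^o) (fwd c p) : R)
   - 'D_w (fun y => liouville h omega c y (fun=> u) : R^o) (fwd c p) = Om c (fwd c p) u w.
Proof.
move=> ac cp; have hc := okP.1 c ac; have h1 : h 1 p = p := act_one pb p.
have E1 v : (fun y => liouville h omega c y (fun=> v) : R^o) =
    (fun y => Om c y ('D_(1 : R^o, 0 : EP) (orbit_rep c) (1 : R^o, y)) v).
  by apply/funext => y; rewrite liouvilleE generatorE.
have G (A B A' B' : EP -> R^o) x r : A = A' -> B = B' ->
  ('D_u A' x : R) - 'D_w B' x = r -> ('D_u A x : R) - 'D_w B x = r by move=> -> ->.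
apply: (G _ _ _ _ _ _ (E1 w) (E1 u)).
have D := @d_contraction R EP (Om c) (orbit_rep c) (fwd c p) fP.
apply: D.
- by apply: near_fwd => // q cq b; exact: Om_linl.
- by apply: near_fwd => // q cq b; exact: Om_linr.
- by move=> a b; exact: Om_anti.
- by move=> a b; exact: Om_smooth.
- by apply: orbit_rep_smooth; rewrite ?h1 ?oner_neq0.
- exact: orbit_rep1.
- exact: Om_hom.
- move=> a b e.
  have := sympl_closed (sb_symplectic sb) (vcons a (vcons b (fun=> e))) ac (cdom_setT ac cp).
  by rewrite ext_d2.
Qed.


Local Notation th := (liouville h omega).

Lemma near1_neq0 : \forall t \near (1 : R), t != 0.
Proof. by apply: open_nbhs_nbhs; split; [exact: open_neq|exact: oner_neq0]. Qed.

(** Used with the identity, for changes of charts, and with [h t], which is equivariant because the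
    group is commutative. *)
Lemma generator_natural f c d p : atlas P c -> atlas P d -> dom c p -> dom d (f p) -> smap_at f p ->
  (forall t, t != 0 -> f (h t p) = h t (f p)) ->
  tmap f c d p (generator h c (fwd c p)) = generator h d (fwd d (f p)).
Proof.
move=> ac ad cp dp sf fh; rewrite (generator_push ac ad cp dp sf) /generator !derive1E.
apply: near_eq_derive; apply: filterS near1_neq0 => t t0.
by rewrite (chart_fwdK (okP.1 d ad) dp) fh.
Qed.

Lemma generator_smooth c p : atlas P c -> dom c p -> smooth_at (generator h c) (fwd c p).
Proof.
move=> ac cp; have h1 : h 1 p = p := act_one pb p.
have so : smooth_at (orbit_rep c) (1 : R^o, fwd c p) by apply: orbit_rep_smooth; rewrite ?h1 ?oner_neq0.
have -> : generator h c = (fun y => 'D_(1 : R^o, 0 : EP) (orbit_rep c) (1 : R^o, y)).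
  by apply/funext => y; rewrite generatorE.
exact: (X_smooth fP so).
Qed.

Lemma liouville_form : diff_form setT th.
Proof.
split.
- move=> c x ac /(cdomE (okP.1 c ac)) [p [cp _ <-]]; apply/multilinear1 => r u v.
  by rewrite !liouvilleE; exact: Om_linr.
- by move=> c x ac _ v i j; rewrite (ord1 i) (ord1 j) eqxx.
- move=> c v ac; apply: smooth_on_at => x /(cdomE (okP.1 c ac)) [p [cp _ <-]].
  have -> : (fun y => th c y v : R^o) = (fun y => Om c y (generator h c y) (v ord0)).
    by apply/funext => y; rewrite liouvilleE.
  apply: (smooth_at_lin_app (L := fun y a => Om c y a (v ord0)) fP).
  + by apply: near_fwd => // q cq; exact: Om_linl.
  + by move=> w; exact: Om_smooth.
  + exact: generator_smooth.
- move=> c d x v ac ad /(cdomE (okP.1 c ac)) [p [cp [_ dp] <-]].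
  have sid := smap_at_id p hP.
  rewrite !liouvilleE (loc_rep_fwd okP) //.
  have := generator_natural ac ad cp dp sid (fun t _ => erefl) => <-.
  rewrite /Om (form_compat om_form _ ac ad (cdom_fwd (okP.1 c ac) cp (conj I dp : (setT `&` dom d) p))).
  rewrite (loc_rep_fwd okP) //; congr (omega _ _ _); apply/funext => i.
  by case: (@unliftP 2 ord0 i) => [j ->|->]; rewrite ?vcons_lift ?vcons_ord0.
Qed.

Lemma liouville_push (t : R) c d p v : t != 0 -> atlas P c -> atlas P d -> dom c p -> dom d (h t p) ->
  th d (fwd d (h t p)) (fun=> tmap (h t) c d p v) = t * th c (fwd c p) (fun=> v).
Proof.
move=> t0 ac ad cp dp; rewrite !liouvilleE -(Om_push _ _ t0 ac ad cp dp).
rewrite (generator_natural ac ad cp dp (h_smap_at p t0)) // => r r0.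
by rewrite !(act_mul pb) // mulrC.
Qed.

Lemma liouville_generator c p : atlas P c -> dom c p -> th c (fwd c p) (fun=> generator h c (fwd c p)) = 0.
Proof. by move=> ac cp; rewrite liouvilleE Om_alt. Qed.

Lemma liouville_lin c p : atlas P c -> dom c p -> is_lin (fun v => th c (fwd c p) (fun=> v) : R^o).
Proof. by move=> ac cp; exact: (form1_lin hP liouville_form ac cp I). Qed.

Lemma generator_s c p : atlas P c -> dom c p ->
  tmap (s : P -> L) c line_chart p (generator h c (fwd c p)) = s p.
Proof.
move=> ac cp; rewrite (generator_push ac (erefl : atlas L line_chart) cp I (s_smap_at p)) derive1E.
rewrite (near_eq_derive _ (g := fun t : R => (t : R) *: (s p : R^o))).
  by rewrite -derive1E derive1Mr // derive1_id mul1r.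
(* The absolute value in the homogeneity of [s] disappears near [t = 1]. *)
have gt0 : \forall t \near (1 : R), 0 < t by apply: open_nbhs_nbhs; split => //; exact: open_gt.
by apply: filterS gt0 => t t0; rewrite /= (calib_homogeneous hs) ?gt_eqF // gtr0_norm.
Qed.

Lemma generator_tau c d p : atlas P c -> atlas M d -> dom c p -> dom d (tau p) ->
  tmap tau c d p (generator h c (fwd c p)) = 0.
Proof.
move=> ac ad cp dp; rewrite (generator_push ac ad cp dp (tau_smap_at p)) derive1E.
rewrite (near_eq_derive _ (g := cst (fwd d (tau p)))); first by rewrite derive_cst.
by apply: filterS near1_neq0 => t t0; rewrite (act_fiber pb).
Qed.

(* [psi] is the calibration with a sign, read in a local trivialization, and
   [sigma] is the section on which [psi] is [1]. *)
Record trivialization (U : set M) (sigma : M -> P) (psi : P -> L) : Prop := Trivialization {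
  triv_open : open U;
  triv_sec_smooth : forall q, U q -> smap_at sigma q;
  triv_sec : forall q, U q -> tau (sigma q) = q;
  triv_sec1 : forall q, U q -> psi (sigma q) = 1;
  triv_smooth : forall p, U (tau p) -> smap_at psi p;
  triv_neq0 : forall p, U (tau p) -> (psi p : R) != 0;
  triv_hom : forall t p, U (tau p) -> t != 0 -> psi (h t p) = t * (psi p : R);
  triv_act : forall p, U (tau p) -> h (psi p) (sigma (tau p)) = p;
  triv_calib : forall p, U (tau p) -> s p = `|psi p : R| }.

Lemma smap_at_fst_line (f : P -> L) (g : P -> M) p :
  @smap_at _ _ _ P (prod_charted L M) (fun q => (f q, g q)) p -> smap_at f p.
Proof.
move=> sf; apply/(smap_at_lineP okP) => c ac cp.
have [d ad dp] := okM.2 (g p).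
have aL : atlas (prod_charted L M) (prod_chart line_chart d) by exists line_chart, d.
exact: smooth_at_fst (sf.2 c _ ac aL cp (conj I dp)).
Qed.

Lemma local_trivialization (q0 : M) : exists U sigma psi, trivialization U sigma psi /\ U q0.
Proof.
have [U [phi [oU Uq0 phi_h [g [[sf sg] fB gA gK fK]]]]] := loc_trivial pb q0.
have phi_neq0 p : U (tau p) -> phi p != 0 by move=> Up; have [] := fB p Up.
have tau_g t q : t != 0 -> U q -> tau (g (t, q)) = q.
  by move=> t0 Uq; have [] := fK (t, q) (conj t0 Uq).
have phi_g t q : t != 0 -> U q -> phi (g (t, q)) = t.
  by move=> t0 Uq; have [] := fK (t, q) (conj t0 Uq).
have inj p p' : U (tau p) -> tau p = tau p' -> phi p = phi p' -> p = p'.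
  by move=> Up tp fp; rewrite -(gK p Up) -(gK p') ?tp ?fp // /= -tp.
have oA : open (tau @^-1` U).
  rewrite openE => p Up; apply: (smap_at_near (tau_smap_at p)); exact: open_nbhs_nbhs.
have oB : open (Rx `*` U : set (prod_charted L M)) by apply: open_setX => //; exact: open_neq.
have phi_s p : U (tau p) -> smap_at (phi : P -> L) p.
  by move=> Up; apply: (@smap_at_fst_line phi tau p); apply: (smooth_map_onP okP okLM _ oA).1.
have g_s t q : t != 0 -> U q -> @smap_at _ _ _ (prod_charted L M) P g (t, q).
  by move=> t0 Uq; apply: (smooth_map_onP okLM okP _ oB).1.
(* [sig] is the calibration on the section [phi = 1]. Rescaling that section by [1 / sig] gives
   [sigma] with [s = 1], and [psi], equal to [phi] times [sig o tau], has absolute value [s]. *)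
pose sig (q : M) : L := s (g (1, q)).
have id_s q : smap_at (fun q : M => q) q by exact: smap_at_id.
have sig_s q : U q -> smap_at sig q.
  move=> Uq; apply: (smap_at_comp okM okP fP (f := fun q => g (1, q)) (g := s : P -> L)); last exact: s_smap_at.
  apply: (smap_at_comp okM okLM fLM (f := fun q => (1 : L, q) : prod_charted L M) (g := g)).
    by apply: smap_at_pair; [exact: smap_at_cst|].
  exact: (g_s 1 q (oner_neq0 R)).
have sig_gt0 q : 0 < (sig q : R) := calib_pos hs _.
have sig_neq0 q : (sig q : R) != 0 by rewrite gt_eqF.
pose sigma q := g ((sig q : R)^-1, q).
pose psi p : L := phi p * (sig (tau p) : R).
have sV q : (sig q : R)^-1 != 0 by rewrite invr_eq0.
have act_sigma p : U (tau p) -> h (psi p) (sigma (tau p)) = p.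
  move=> Up; have p0 : (psi p : R) != 0 by rewrite mulf_neq0 ?phi_neq0.
  have E1 : tau (h (psi p) (sigma (tau p))) = tau p by rewrite (act_fiber pb) // tau_g.
  apply: inj => //; first by rewrite E1.
  by rewrite phi_h ?tau_g // phi_g // /psi mulfK.
exists U, sigma, psi; split => //; split => //.
- move=> q Uq; apply: (smap_at_comp okM okLM fLM (f := fun q => ((sig q : R)^-1 : L, q) : prod_charted L M) (g := g)).
    by apply: smap_at_pair => //; apply: (smap_at_inv okM) => //; exact: sig_s.
  exact: g_s.
- by move=> q Uq; rewrite tau_g.
- by move=> q Uq; rewrite /psi tau_g // phi_g // mulVf.
- move=> p Up; apply: (smap_at_mul okP); first exact: phi_s.
  by apply: (smap_at_comp okP okM fM (g := sig)); [exact: tau_smap_at|exact: sig_s].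
- by move=> p Up; rewrite mulf_neq0 ?phi_neq0.
- by move=> t p Up t0; rewrite /psi phi_h // (act_fiber pb) // mulrA.
- move=> p Up; have p0 : phi p != 0 by exact: phi_neq0.
  have E1 : h (phi p) (g (1, tau p)) = p.
    apply: inj; rewrite ?phi_h ?phi_g ?mulr1 ?(act_fiber pb) ?tau_g ?oner_neq0 //.
  by rewrite -{1}E1 (calib_homogeneous hs) // /psi normrM (gtr0_norm (sig_gt0 _)).
Qed.

Section Kernel.
Variables (U : set M) (sigma : M -> P) (psi : P -> L).
Hypothesis tr : trivialization U sigma psi.

Lemma generator_psi c p : atlas P c -> dom c p -> U (tau p) ->
  tmap psi c line_chart p (generator h c (fwd c p)) = psi p.
Proof.
move=> ac cp Up; rewrite (generator_push ac (erefl : atlas L line_chart) cp I (triv_smooth tr Up)) derive1E.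
rewrite (near_eq_derive _ (g := fun t : R => (t : R) *: (psi p : R^o))).
  by rewrite -derive1E derive1Mr // derive1_id mul1r.
by apply: filterS near1_neq0 => t t0; rewrite /= (triv_hom tr).
Qed.

(** Subtracting the multiple of the generator leaves a vector killed by the derivatives of [tau] and
    [psi]. The identity of [P] factors locally through [psi] and [sigma o tau], so that vector is
    zero. *)
Lemma tau_kernel c d p v : atlas P c -> atlas M d -> dom c p -> dom d (tau p) -> U (tau p) ->
  tmap tau c d p v = 0 ->
  v = ((tmap psi c line_chart p v : R) / (psi p : R)) *: generator h c (fwd c p).
Proof.
move=> ac ad cp dp Up tv; set X := generator h c _; set a := _ / _.
have psi0 := triv_neq0 tr Up.
pose v' := - a *: X + v.
suff : v' = 0 by rewrite /v' scaleNr addrC => /subr0_eq.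
have t1 : tmap tau c d p v' = 0 by rewrite tmap_linear (generator_tau ac ad cp dp) scaler0 tv addr0.
have t2 : tmap psi c line_chart p v' = 0.
  rewrite tmap_linear (generator_psi ac cp Up) /a.
  by rewrite scaleNr -[_ *: _]/(_ * _) divfK // addNr.
have [e ae ep] := okP.2 (sigma (tau p)).
have aL : atlas (prod_charted L P) (prod_chart line_chart e) by exists line_chart, e.
pose B (q : P) : prod_charted L P := (psi q, sigma (tau q)).
have ss : smap_at (fun q => sigma (tau q)) p.
  by apply: (smap_at_comp okP okM fM); [exact: tau_smap_at|exact: (triv_sec_smooth tr Up)].
have sB : smap_at B p by apply: smap_at_pair; [exact: (triv_smooth tr Up)|].
have BE : tmap B c (prod_chart line_chart e) p v' = 0.
  have d1 := smooth_at_diff ((triv_smooth tr Up).2 c line_chart ac erefl cp I).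
  have d2 := smooth_at_diff (ss.2 c e ac ae cp ep).
  have E1 : tmap B c (prod_chart line_chart e) p = (fun v => (tmap psi c line_chart p v, tmap (fun q => sigma (tau q)) c e p v)) :> (EP -> R^o * EP).
    exact: (diff_pair d1 d2).
  rewrite E1 t2 (tmap_comp okP okM v' ac ad ae cp dp ep (tau_smap_at p) (triv_sec_smooth tr Up)) t1 tmap0.
  by [].
have Ap : act (B p) = p := triv_act tr Up.
have sA : smap_at act (B p) by exact: (act_smap_at _ psi0).
have cAp : dom c (act (B p)) by rewrite Ap.
have idE : \forall q \near p, act (B q) = q.
  have : nbhs p (tau @^-1` U) by apply: (smap_at_near (tau_smap_at p)); apply: open_nbhs_nbhs; split => //; exact: triv_open tr.
  by apply: filterS => q Uq; exact: (triv_act tr Uq).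
have sAB : smap_at (fun q => act (B q)) p by exact: (smap_at_comp okP okLP fLP sB sA).
rewrite -[v'](tmap_id okP v' ac cp).
have <- := tmap_near_eq okP ac ac cp cAp idE sAB.
by rewrite (tmap_comp okP okLP v' ac aL ac cp (conj I ep : dom (prod_chart line_chart e) (B p)) cAp sB sA) BE tmap0.
Qed.

End Kernel.

(** A vector of [C] may come from another point of the fibre and another lift. The action moves that
    lift to [p] and rescales [theta], so it stays in the kernel; it then differs from [v] by a
    vertical vector, on which [theta] vanishes. *)
Lemma distr_tau (C : distribution M) c d p v : distr_eq_on setT C (image_distr tau (kernel_of th)) ->
  atlas P c -> atlas M d -> dom c p -> dom d (tau p) ->
  C d (fwd d (tau p)) (tmap tau c d p v) <-> th c (fwd c p) (fun=> v) = 0.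
Proof.
move=> hC ac ad cp dp; rewrite (hC d _ _ ad (cdom_fwd (okM.1 d ad) dp I)).
have hd := okM.1 d ad.
split=> [|tv]; last first.
  exists c, (fwd c p), v; split; [exact: ac|exact: (cdom_setT ac cp)| |exact: tv|by []].
  by rewrite (chart_fwdK (okP.1 c ac) cp) (chart_fwdK hd dp).
case=> [c' [_ [v' [ac' /(cdomE (okP.1 c' ac')) [p' [cp' _ <-]] + tv' vv']]]].
rewrite (chart_fwdK (okP.1 c' ac') cp') (chart_fwdK hd dp) => tp.
have [U [sigma [psi [tr Up]]]] := local_trivialization (tau p).
have Up' : U (tau p') by rewrite tp.
(* The group element carrying [p'] to [p], read from the fibre coordinate. *)
pose t : R := (psi p : R) / (psi p' : R).
have t0 : t != 0 by rewrite mulf_neq0 ?invr_eq0 ?(triv_neq0 tr).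
have hp : h t p' = p.
  rewrite -[RHS](triv_act tr Up) -{1}(triv_act tr Up') tp (act_mul pb) // ?(triv_neq0 tr) //.
  by rewrite /t divfK // (triv_neq0 tr).
have cp2 : dom c (h t p') by rewrite hp.
pose v2 := tmap (h t) c' c p' v'.
have th2 : th c (fwd c p) (fun=> v2) = 0.
  by rewrite -{1}hp (liouville_push v' t0 ac' ac cp' cp2) [X in _ * X]tv' mulr0.
have sh := h_smap_at p' t0.
have dp2 : dom d (tau (h t p')) by rewrite hp.
have T2 : tmap tau c d p v2 = tmap tau c d p v.
  rewrite -[RHS]vv' -{1}hp -(tmap_comp okP okP v' ac' ac ad cp' cp2 dp2 sh (tau_smap_at _)).
  have fE : \forall q \near p', tau (h t q) = tau q.
    by apply: (filterS _ (filterT : nbhs p' setT)) => q _; exact: (act_fiber pb).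
  have st : smap_at (fun q => tau (h t q)) p' by exact: (smap_at_comp okP okP fP sh (tau_smap_at _)).
  by rewrite (tmap_near_eq okP ac' ad cp' dp2 fE st).
have K0 : tmap tau c d p (-1 *: v2 + v) = 0.
  by rewrite tmap_linear T2 scaleN1r addNr.
have KE := tau_kernel tr ac ad cp dp Up K0.
have lin := liouville_lin ac cp.
have Lz a w : th c (fwd c p) (fun=> w) = 0 -> th c (fwd c p) (fun=> a *: w) = 0.
  have L0 : th c (fwd c p) (fun=> 0) = 0.
    by have := lin (-1) 0 0; rewrite scaleN1r oppr0 addr0 mulN1r addNr.
  by move=> w0; have := lin a w 0; rewrite addr0 L0 w0 mulr0 addr0.
have : th c (fwd c p) (fun=> -1 *: v2 + v) = 0.
  by rewrite KE; apply: Lz; exact: liouville_generator.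
by rewrite (lin (-1) v2 v) th2 mulr0 add0r.
Qed.

(** The image of [T] has dimension [e] and lies in the kernel of [ell], which avoids [X]; adding the
    line of [X] fills the space. *)
Lemma transverse_span e (T : {linear 'rV[R]_e -> 'rV[R]_k}) (ell : {linear 'rV[R]_k -> R^o}) (X : 'rV[R]_k) :
  k = e.+1 -> injective T -> (forall w, ell (T w) = 0) -> (ell X : R) != 0 ->
  forall z, exists w a, z = a *: X + T w.
Proof.
move=> ke Tinj ellT ellX.
pose A := (limg (linfun T) + <[X]>)%VS.
have X0 : X != 0 by apply: contraNneq ellX => ->; rewrite linear0.
have TX : (limg (linfun T) :&: <[X]> = 0)%VS.
  apply/eqP; rewrite -subv0; apply/subvP => z; rewrite memv_cap => /andP[/memv_imgP[w _ ->]].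
  rewrite lfunE /= => /vlineP[a E1]; rewrite memv0 E1.
  have := ellT w; rewrite E1 linearZ /= => /eqP; rewrite mulf_eq0 (negPf ellX) orbF => /eqP ->.
  by rewrite scale0r.
have dT : \dim (limg (linfun T)) = e.
  have := limg_ker_dim (linfun T) fullv.
  have -> : lker (linfun T) = 0%VS.
    apply/eqP; rewrite -subv0; apply/subvP => w; rewrite memv_ker lfunE memv0 /= => /eqP E1.
    by apply/eqP/Tinj; rewrite E1 linear0.
  by rewrite capv0 dimv0 add0n => ->; rewrite dimvf /dim /= mul1n.
have dA : (A == fullv)%VS.
  rewrite eqEdim subvf /= dimv_disjoint_sum // dT dim_vline X0 dimvf /dim /= mul1n ke.
  by rewrite addn1.
move=> z; have : z \in A by rewrite (eqP dA) memvf.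
case/memv_addP => _ /memv_imgP[w _ ->] [_ /vlineP[a ->] ->].
by exists w, a; rewrite lfunE addrC.
Qed.

(** Stated for a general immersion into the level set, so that it covers both the inclusion of the
    double cover and the local sections. *)
Lemma pullback_contact n (N : charted 'rV[R]_(2 * n).+1) (f : N -> P) (W : set N) : k = (2 * n).+2 ->
  charted_ok N -> (forall q, W q -> smap_at (fun q : N => q) q) -> open W ->
  (forall q, W q -> smap_at f q /\ s (f q) = 1) ->
  (forall q c d, W q -> atlas N c -> atlas P d -> dom c q -> dom d (f q) -> injective (tmap f c d q)) ->
  contact_form W (pullback f th).
Proof.
move=> kE okN idN oW sf Tinj; split.
  apply: (pullback_form okN hP fP openT liouville_form oW _ idN (fin_dim_rV _)).
  by move=> q /sf[].
move=> c x ac /(cdomE (okN.1 c ac)) [q [cq Wq <-]].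
have [sfq s1] := sf q Wq; have [d ad dq] := okP.2 (f q).
set y0 := fwd d (f q); pose X := generator h d y0.
pose T : {linear 'rV[R]_(2 * n).+1 -> EP} := 'd (loc_rep f c d) (fwd c q).
have TE w : T w = tmap f c d q w by [].
pose ell : {linear EP -> R^o} := 'd (loc_rep (s : P -> L) d line_chart) y0.
have sFq := sfq.2 c d ac ad cq dq.
have nW : nbhs q W by exact: open_nbhs_nbhs.
have nf : \forall q \near q, smap_at f q /\ setT (f q).
  by apply: filterS nW => q' /sf[].
have ellX : ell X = 1.
  by rewrite -[LHS]/(tmap (s : P -> L) d line_chart (f q) (generator h d y0)) generator_s.
have ellT w : ell (T w) = 0.
  rewrite -[LHS]/(tmap (s : P -> L) d line_chart (f q) (tmap f c d q w)).
  rewrite -(tmap_comp okN okP w ac ad (erefl : atlas L line_chart) cq dq I sfq (s_smap_at _)).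
  have E1 : \forall q' \near q, s (f q') = 1 by apply: filterS nW => q' /sf[].
  have ss : smap_at (fun q => s (f q) : L) q by exact: (smap_at_comp okN okP fP sfq (s_smap_at _)).
  rewrite (tmap_near_eq (g := fun=> 1 : L) okN ac (erefl : atlas L line_chart) cq I E1 ss).
  exact: (congr1 (fun g => g w) (diff_cst (1 : R^o) (fwd c q))).
have ellX0 : (ell X : R) != 0 by rewrite ellX oner_neq0.
have span := @transverse_span _ T ell X kE (Tinj q c d Wq ac ad cq dq) ellT ellX0.
have X0 : X != 0 by apply: contraNneq ellX0 => ->; rewrite linear0.
have ll a := Om_linl a ad dq; have lr a := Om_linr a ad dq.
(* [z0] shows that the pulled back form is nonzero and later normalizes the proportionality factor
   [la]. *)
have [z0 Xz0] : exists z0, (Om d y0 X z0 : R) != 0.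
  apply: contrapT => H; move/eqP: X0; apply.
  apply: (sympl_nondeg (sb_symplectic sb) ad (cdom_setT ad dq)) => w.
  by apply: contrapT => /eqP Xw; apply: H; exists w.
have XX : Om d y0 X X = 0 by exact: Om_alt.
apply: (@wedge_contact_neq0 R n (fun u => Om d y0 X (T u)) (fun u w => Om d y0 (T u) (T w))).
- by move=> a u v; rewrite linearP; exact: lr.
- by move=> w a u v; rewrite linearP; exact: ll.
- by move=> w a u v; rewrite linearP; exact: lr.
- by move=> u; exact: Om_alt.
- move=> w; rewrite (pullbackE okN hP w liouville_form I sfq ac ad cq dq) liouvilleE.
  by [].
- move=> v; rewrite ext_d1.
  have near u : \forall y \near fwd c q, (pullback f th c y (fun=> u) : R^o) =
      th d (loc_rep f c d y) (fun=> 'D_u (loc_rep f c d) y).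
    by apply: filterS (pullback_near okN hP liouville_form nf ac ad cq dq) => y; exact.
  rewrite (near_eq_derive _ (near (v ord_max))) (near_eq_derive _ (near (v ord0))).
  have FE : loc_rep f c d (fwd c q) = y0 by rewrite (loc_rep_fwd okN).
  have l1 : \forall y \near loc_rep f c d (fwd c q), is_lin (fun a => th d y (fun=> a) : R^o).
    by rewrite FE; exact: (form1_near_lin hP openT liouville_form ad dq I).
  have l2 a : smooth_at (fun y => th d y (fun=> a) : R^o) (loc_rep f c d (fwd c q)).
    by rewrite FE; exact: (form_smooth_at hP _ openT liouville_form ad dq I).
  have H := @d_pullback R EP _ (fun y a => th d y (fun=> a) : R^o) (loc_rep f c d) (fwd c q) (v ord0) (v ord_max) fP l1 l2 sFq.
  apply: (etrans H); rewrite FE; apply: (etrans (liouville_ext_d _ _ ad dq)).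
  by rewrite !(deriveE _ (smooth_at_diff sFq)).
- have [w [a z0E]] := span z0; exists w.
  by move: Xz0; rewrite z0E (lr X a X (T w)) XX mulr0 add0r.
move=> u Xu H.
have TuX : Om d y0 (T u) X = 0 by rewrite (Om_anti _ _ ad dq) Xu oppr0.
(* Vectors [omega]-orthogonal to [X] are multiples of [X] plus images of kernel vectors, and [T u]
   is orthogonal to both. So [omega(T u, .)] is [la] times [omega(X, .)]. *)
have K z : Om d y0 X z = 0 -> Om d y0 (T u) z = 0.
  have [w [a ->]] := span z; rewrite (lr X a X (T w)) XX mulr0 add0r => Xw.
  by rewrite (lr (T u) a X (T w)) TuX mulr0 add0r; exact: H.
pose la : R := (Om d y0 (T u) z0 : R) / (Om d y0 X z0 : R).
have E1 : - la *: X + T u = 0.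
  apply: (sympl_nondeg (sb_symplectic sb) ad (cdom_setT ad dq)) => z.
  have E2 : Om d y0 (- la *: X + T u) z = - la * (Om d y0 X z : R) + Om d y0 (T u) z by exact: ll.
  rewrite -[LHS]/(Om d y0 (- la *: X + T u) z) E2.
  have arrange (a b e : R) : a / e * b = b / e * a by rewrite mulrAC [RHS]mulrAC (mulrC a).
  pose b : R := (Om d y0 X z : R) / (Om d y0 X z0 : R).
  have : Om d y0 (T u) (- b *: z0 + z) = 0.
    apply: K; rewrite (lr X (- b) z0 z) /b mulNr divfK // addNr //.
  rewrite (lr (T u) (- b) z0 z) /b /la => E3; rewrite -[RHS]E3; congr (_ + _).
  rewrite !mulNr; congr (- _); exact: arrange.
(* [ell] is the differential of [s]: it is 1 on [X] and 0 on the image of [T]. *)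
have la0 : la = 0.
  have := congr1 ell E1; rewrite linearP linear0 ellT addr0 ellX => E2.
  have /eqP : - la * 1 = 0 := E2.
  by rewrite mulr1 oppr_eq0 => /eqP.
move: E1; rewrite la0 oppr0 scale0r add0r => Tu.
by apply: (Tinj q c d Wq ac ad cq dq); rewrite -TE Tu tmap0.
Qed.

End Bundle.

(** * The level set of the calibration *)

Section Subspace.
Context {P : topologicalType} (S : set P).

Lemma set_val_continuous : continuous (set_val : set_type S -> P).
Proof. exact: initial_continuous. Qed.

Lemma set_val_nbhs (x : set_type S) (A : set (set_type S)) : nbhs x A ->
  exists2 B, open_nbhs (set_val x) B & set_val @^-1` B `<=` A.
Proof. by rewrite nbhsE => -[_ [[B oB <-] Bx] BA]; exists B. Qed.

Lemma into_subspace_continuous (T : topologicalType) (f : T -> set_type S) x :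
  {for x, continuous (fun y => set_val (f y))} -> {for x, continuous f}.
Proof.
move=> cf A /set_val_nbhs [B oB BA].
have n : nbhs x (fun y => B (set_val (f y))) by apply: cf; exact: open_nbhs_nbhs oB.
by apply: filterS n => y; exact: BA.
Qed.

Lemma subspace_hausdorff_type : hausdorff_space P -> hausdorff_space (set_type S).
Proof.
move=> hP p q pq; apply: val_inj; apply: hP => A B Ap Bq.
have [r [Ar Br]] := pq _ _ (set_val_continuous Ap) (set_val_continuous Bq).
by exists (set_val r).
Qed.

Lemma subspace_second_countable : @second_countable P -> @second_countable (set_type S).
Proof.
case=> B cB [oB bB]; exists ((fun A => (set_val : set_type S -> P) @^-1` A) @` B).
  exact: sub_countable (card_image_le _ _) cB.
split=> [_ [A BA <-]|x A /set_val_nbhs [D [oD Dx] DA]].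
  by exists A => //; exact: oB.
have [C [BC Cx] CD] := bB (set_val x) D (open_nbhs_nbhs (conj oD Dx)).
exists (set_val @^-1` C); first by split=> //; exists C.
by move=> y Cy; apply: DA; exact: CD.
Qed.

End Subspace.

Section LevelSet.
Context {R : realType} {m k : nat}.
Local Notation EM := 'rV[R]_m.
Local Notation EP := 'rV[R]_k.
Context {M : charted EM} {P : charted EP}.
Variables (tau : P -> M) (h : R -> P -> P) (omega : form 2 P) (s : P -> R).
Hypotheses (hM : smooth_manifold M) (hP : smooth_manifold P).
Hypotheses (sb : symplectic_bundle tau h omega) (hs : calibration h s).

Let okM := smooth_manifold_ok hM.
Let okP := smooth_manifold_ok hP.
Let pb := sb_principal sb.
Let fP : fin_dim EP := fin_dim_rV k.
Let fM : fin_dim EM := fin_dim_rV m.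
Local Notation L := (line : charted (R^o : normedModType R)).
Local Notation Mt := (subcharted EM [set q : P | s q = 1]).
Let okE := @model_ok R EM.
Let tauS := tau_smap_at hM hP sb.

Definition incl (q : Mt) : P := set_val q.

Lemma incl_level q : s (incl q) = 1.
Proof. by case: q => q /= hq; exact: (set_mem hq). Qed.

Lemma incl_inj : injective incl.
Proof. by move=> p q /val_inj. Qed.

(** [q0] is a default off the level set, needed because inverse charts are total maps. *)
Definition lift_level (q0 : Mt) (q : P) : Mt :=
  if pselect ([set q : P | s q = 1] q) is left e then exist _ q (mem_set e) else q0.

Lemma lift_levelK q0 q : s q = 1 -> incl (lift_level q0 q) = q.
Proof. by move=> sq; rewrite /lift_level; case: pselect. Qed.

(** Because -1 has absolute value 1, the opposite section is again normalized; through it the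
    results for [psi > 0] cover the other sheet. *)
Lemma trivialization_opp U sigma psi : trivialization tau h s U sigma psi ->
  trivialization tau h s U (fun q => h (-1) (sigma q)) (fun p => - (psi p : R) : L).
Proof.
move=> tr; have n0 : (-1 : R) != 0 by rewrite oppr_eq0 oner_neq0.
split.
- exact: triv_open tr.
- move=> q Uq; apply: (smap_at_comp okM okP fP (g := h (-1)) (triv_sec_smooth tr Uq)).
  exact: (h_smap_at hP sb _ n0).
- by move=> q Uq; rewrite (act_fiber pb) // (triv_sec tr).
- by move=> q Uq; rewrite (triv_hom tr) ?(triv_sec tr) // (triv_sec1 tr) // mulr1 opprK.
- move=> p Up.
  have -> : (fun p => - (psi p : R) : L) = (fun p => (-1 : R) * (psi p : R) : L).
    by apply/funext => q; rewrite mulN1r.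
  by apply: (smap_at_mul okP); [exact: smap_at_cst|exact: triv_smooth tr _ Up].
- by move=> p Up; rewrite oppr_eq0 (triv_neq0 tr).
- by move=> t p Up t0; rewrite (triv_hom tr) // mulrN.
- move=> p Up; have p0 := triv_neq0 tr Up.
  by rewrite (act_mul pb) ?oppr_eq0 // mulrNN mulr1 (triv_act tr).
- by move=> p Up; rewrite normrN (triv_calib tr).
Qed.

Lemma smap_at_inv_chart (c : chart EM M) p : atlas M c -> dom c p ->
  @smap_at _ _ _ (model EM) M (inv c) (fwd c p).
Proof.
move=> ac cp; have hc := okM.1 c ac; split.
  by apply: (chart_inv_cont hc); exists p.
move=> _ d -> ad _; rewrite /= (chart_fwdK hc cp) => dp.
exact: ((smap_at_id p hM).2 c d ac ad cp dp).
Qed.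

Section NiceChart.
Variables (U : set M) (sigma : M -> P) (psi : P -> L) (y : chart EM M) (q0 : Mt).
Hypothesis tr : trivialization tau h s U sigma psi.
Hypothesis ay : atlas M y.
Let hy := okM.1 y ay.

(** Where [psi > 0] the level set is the image of [sigma], so coordinates of [M] serve as
    coordinates on it. *)
Definition level_chart : chart EM Mt := Chart
  [set q : Mt | [/\ U (tau (incl q)), dom y (tau (incl q)) & 0 < (psi (incl q) : R)]]
  (fun q => fwd y (tau (incl q)))
  (fun x => lift_level q0 (sigma (inv y x))).

Lemma level_psi1 q : U (tau (incl q)) -> 0 < (psi (incl q) : R) -> (psi (incl q) : R) = 1.
Proof. by move=> Uq p0; rewrite -(incl_level q) (triv_calib tr Uq) gtr0_norm. Qed.

Lemma level_sec q : U (tau (incl q)) -> 0 < (psi (incl q) : R) -> sigma (tau (incl q)) = incl q.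
Proof.
move=> Uq p0; have := triv_act tr Uq; rewrite level_psi1 // => <-.
by rewrite (act_one pb) (triv_sec tr Uq).
Qed.

Lemma sec_level q : U q -> s (sigma q) = 1.
Proof. by move=> Uq; rewrite (triv_calib tr) ?(triv_sec tr) // (triv_sec1 tr) // normr1. Qed.

Lemma level_dom_open : open (dom level_chart).
Proof.
rewrite openE => q [Uq yq pq] /=.
have n1 : nbhs (incl q) [set p | [/\ U (tau p), dom y (tau p) & 0 < (psi p : R)]].
  have a1 : nbhs (incl q) (tau @^-1` (U `&` dom y)).
    apply: (smap_at_near (tauS _)); apply: filterI; last exact: (dom_nbhs okM ay yq).
    by apply: open_nbhs_nbhs; split => //; exact: triv_open tr.
  have a2 : nbhs (incl q) (psi @^-1` [set t : R | 0 < t]).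
    apply: (smap_at_near (triv_smooth tr Uq)); apply: open_nbhs_nbhs; split => //; exact: open_gt.
  by apply: filterS2 a1 a2 => p [? ?] ?.
exact: (set_val_continuous n1).
Qed.

Lemma level_img : fwd level_chart @` dom level_chart = cdom U y.
Proof.
apply/seteqP; split=> [x [q [Uq yq pq] <-]|x /(cdomE hy) [p [yp Up <-]]].
  by apply: (cdom_fwd hy).
have E1 := lift_levelK q0 (sec_level Up).
exists (lift_level q0 (sigma p)); rewrite /= E1 (triv_sec tr Up) //.
by split => //; rewrite (triv_sec1 tr Up) ltr01.
Qed.

Lemma level_invE x : cdom U y x -> incl (inv level_chart x) = sigma (inv y x).
Proof. by move=> /(cdomE hy) [p [yp Up <-]]; rewrite /= lift_levelK // (chart_fwdK hy yp) sec_level. Qed.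

Lemma cdomU_open : open (cdom U y).
Proof. by apply: (cdom_open hy) => p Up _; apply: open_nbhs_nbhs; split => //; exact: triv_open tr. Qed.

Lemma level_inv_smap x : cdom U y x ->
  @smap_at _ _ _ (model EM) P (fun x => incl (inv level_chart x)) x.
Proof.
move=> Ux; have nU : nbhs x (cdom U y) by apply: open_nbhs_nbhs; split => //; exact: cdomU_open.
apply: (smap_at_near_eq okE (f := fun x => sigma (inv y x))).
  by apply: filterS nU => z Uz; rewrite level_invE.
move: Ux => /(cdomE hy) [p [yp Up <-]].
apply: (smap_at_comp okE okM fM (f := inv y : model EM -> M)); first exact: smap_at_inv_chart.
by rewrite (chart_fwdK hy yp); exact: (triv_sec_smooth tr Up).
Qed.

Lemma level_is_chart : is_chart level_chart.
Proof.
split.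
- exact: level_dom_open.
- by rewrite level_img; exact: cdomU_open.
- move=> q [Uq yq pq]; apply: incl_inj.
  rewrite level_invE; last exact: (cdom_fwd hy).
  by rewrite /= (chart_fwdK hy yq) level_sec.
- move=> q [Uq yq pq].
  apply: (@continuous_comp _ _ _ (fun q : Mt => tau (incl q)) (fwd y)); last exact: (chart_fwd_cont hy yq).
  apply: (@continuous_comp _ _ _ incl tau); first exact: set_val_continuous.
  exact: (tauS _).1.
- rewrite level_img => x Ux; apply: into_subspace_continuous.
  exact: (level_inv_smap Ux).1.
Qed.

Lemma level_chart_atlas : atlas Mt level_chart.
Proof.
have oU := cdomU_open; have cE : cimg level_chart = cdom U y.
  rewrite -level_img; apply/seteqP; split=> x; [by case|by []].
split; first exact: level_is_chart.
  rewrite cE; apply/(smooth_map_onP okE okP _ oU) => x; exact: level_inv_smap.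
move=> d x ad; rewrite /cdom level_img => -[Ux dx].
have sj := level_inv_smap Ux.
pose j : model EM -> P := fun x => incl (inv level_chart x).
have jE : tau (j x) = inv y x by rewrite /j level_invE // (triv_sec tr) //; case: Ux.
have yx : dom y (tau (j x)) by rewrite jE; move: Ux => /(cdomE hy) [p [yp Up <-]]; rewrite (chart_fwdK hy yp).
(* Immersion because [tau] undoes the section: in coordinates [tau o j] is the identity. *)
apply: (@can_inj _ _ _ (tmap tau d y (j x))) => v.
have a0 : atlas (model EM) (Chart setT id id) by [].
have := tmap_comp okE okP v a0 ad ay I dx yx sj (tauS _).
rewrite -[tmap tau d y (j x) ('d _ _ v)]/(tmap tau d y (j x) (tmap j (Chart setT id id) d x v)) => <-.
have sc : @smap_at _ _ _ (model EM) M (fun x => tau (j x)) x by exact: (smap_at_comp okE okP fP sj (tauS _)).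
rewrite /tmap /=.
have H : \forall z \near x, id z = loc_rep (fun x => tau (j x) : M) (Chart setT id id) y z.
  have nU : nbhs x (cdom U y) by apply: open_nbhs_nbhs.
  apply: filterS nU => z Uz; rewrite /loc_rep /= /j level_invE //.
  move: Uz => /(cdomE hy) [p [yp Up <-]]; rewrite (chart_fwdK hy yp) (triv_sec tr) //.
have [_ ->] := near_eq_diff H (ex_diff (is_diff_def := is_diff_id _)).
by rewrite (diff_val (is_diff_def := is_diff_id _)).
Qed.

End NiceChart.
Lemma level_is_chart_atlas c : atlas Mt c -> is_chart c.
Proof. by case. Qed.

Lemma trivialization_pos (q : Mt) : exists U sigma psi,
  [/\ trivialization tau h s U sigma psi, U (tau (incl q)) & 0 < (psi (incl q) : R)].
Proof.
have [U [sigma [psi [tr Uq]]]] := local_trivialization hM hP sb hs (tau (incl q)).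
have := triv_neq0 tr Uq; case: (ltgtP (psi (incl q) : R) 0) => // p0 _.
  by exists U, (fun q => h (-1) (sigma q)), (fun p => - (psi p : R) : L); rewrite oppr_gt0; split => //; exact: trivialization_opp.
by exists U, sigma, psi.
Qed.

Lemma level_ok : charted_ok Mt.
Proof.
split=> [c|q]; first exact: level_is_chart_atlas.
have [U [sigma [psi [tr Uq pq]]]] := trivialization_pos q.
have [y ay yq] := okM.2 (tau (incl q)).
by exists (level_chart U sigma psi y q); [exact: level_chart_atlas|].
Qed.

Lemma level_inv_smap_at c x : atlas Mt c -> cimg c x ->
  @smap_at _ _ _ (model EM) P (fun x => incl (inv c x)) x.
Proof.
move=> ac cx; have hc := level_is_chart_atlas ac; case: ac => _ sc _.
have oc : open (cimg c) by apply: (cdom_open hc) => q _ _; exact: filterT.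
exact: (smooth_map_onP okE okP _ oc).1 sc x cx.
Qed.

Lemma incl_smap_at q : smap_at incl q.
Proof.
split; first exact: set_val_continuous.
move=> c d ac ad cq dq; have hc := level_is_chart_atlas ac.
have cx : cimg c (fwd c q) by exact: (cdom_fwd hc cq I).
apply: ((level_inv_smap_at ac cx).2 (Chart setT id id) d erefl ad I).
by rewrite (chart_fwdK hc cq).
Qed.

Lemma incl_tmap_inj q c d : atlas Mt c -> atlas P d -> dom c q -> dom d (incl q) -> injective (tmap incl c d q).
Proof.
move=> ac ad cq dq; have hc := level_is_chart_atlas ac; case: ac => _ _; apply => //.
exact: (cdom_fwd hc cq dq).
Qed.

(* The inverse of [c] is an immersion, hence so is the change of charts from [c]
   to a level chart; the latter is a homeomorphism, so its inverse is smooth. *)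
Lemma level_transition_smooth c U sigma psi y q0 q : trivialization tau h s U sigma psi ->
  atlas M y -> atlas Mt c -> dom c q -> dom (level_chart U sigma psi y q0) q ->
  smooth_at (fun z => fwd c (inv (level_chart U sigma psi y q0) z)) (fwd y (tau (incl q))).
Proof.
move=> tr ay ac cq; set e := level_chart U sigma psi y q0 => eq.
have hc := level_is_chart_atlas ac; have hy := okM.1 y ay.
have he : is_chart e := level_is_chart q0 tr ay.
pose f x := fwd e (inv c x); pose g z := fwd c (inv e z).
have oW : open (cdom (dom c) e).
  by apply: (cdom_open he) => p cp _; exact: (open_nbhs_nbhs (conj (chart_dom_open hc) cp)).
have oV : open (cdom (dom e) c).
  by apply: (cdom_open hc) => p ep _; exact: (open_nbhs_nbhs (conj (chart_dom_open he) ep)).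
have sf p : dom c p -> dom e p -> smooth_at f (fwd c p).
  move=> cp [_ yp _].
  have sj := level_inv_smap_at ac (cdom_fwd hc cp I : cimg c (fwd c p)).
  have st : @smap_at _ _ _ (model EM) M (fun x => tau (incl (inv c x))) (fwd c p).
    exact: (smap_at_comp okE okP fP sj (tauS _)).
  apply: (st.2 (Chart setT id id) y erefl ay I).
  by rewrite (chart_fwdK hc cp).
suff : smooth_on (cdom (dom c) e) g.
  move/(smooth_onP _ oW); apply; exact: (cdom_fwd he eq cq).
apply: (@inverse_smooth _ _ f g (cdom (dom e) c) (cdom (dom c) e) oV oW).
- move=> _ /(cdomE he) [p [ep cp <-]].
  apply: continuous_comp; first by apply: (chart_inv_cont he); exists p.
  by rewrite (chart_fwdK he ep); exact: chart_fwd_cont.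
- move=> _ /(cdomE he) [p [ep cp <-]]; rewrite /g (chart_fwdK he ep).
  exact: (cdom_fwd hc cp ep).
- move=> _ /(cdomE he) [p [ep cp <-]]; rewrite /g /f (chart_fwdK he ep) (chart_fwdK hc cp).
  by [].
- by apply: smooth_on_at => _ /(cdomE hc) [p [cp ep <-]]; exact: sf.
move=> _ /(cdomE he) [p [ep cp <-]]; rewrite /g (chart_fwdK he ep).
have [Up yp pp] := ep.
have [d ad dp] := okP.2 (incl p).
have inj := incl_tmap_inj ac ad cp dp.
have st := triv_sec_smooth tr Up.
have sE : sigma (tau (incl p)) = incl p := level_sec tr Up pp.
(* The inclusion factors as [sigma] after the change of charts [f], so injectivity of its derivative
   passes to that of [f]. *)
have F : \forall x \near fwd c p, (loc_rep sigma y d \o f) x = loc_rep incl c d x.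
  have nE : nbhs p (dom e) by exact: (open_nbhs_nbhs (conj (chart_dom_open he) ep)).
  apply: filterS (chart_near hc cp nE) => x [[Ux yx px] cx ex].
  by rewrite /= /loc_rep /f /= (chart_fwdK hy yx) (level_sec tr Ux px).
have d1 := smooth_at_diff (sf p cp ep).
have fE : f (fwd c p) = fwd y (tau (incl p)) by rewrite /f (chart_fwdK hc cp).
have dsig : dom d (sigma (tau (incl p))) by rewrite sE.
have s2 := st.2 y d ay ad yp dsig; rewrite -fE in s2.
have [_ D] := near_eq_diff F (differentiable_comp d1 (smooth_at_diff s2)).
have DD w : tmap incl c d p w = 'd (loc_rep sigma y d) (f (fwd c p)) ('d f (fwd c p) w).
  exact: (etrans (congr1 (fun g => g w) D) (congr1 (fun g => g w) (diff_comp d1 (smooth_at_diff s2)))).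
move=> u v uv; apply: inj; rewrite (DD u) (DD v).
exact: (congr1 ('d (loc_rep sigma y d) (f (fwd c p))) uv).
Qed.

(** In any chart [c], the map [f] is the change from a level chart to [c] after
    [y o tau o incl o f], which is smooth by hypothesis. Applied to the identity, it yields
    compatibility of all charts of the level set. *)
Lemma into_level_smap_at (F : normedModType R) (N : charted F) (f : N -> Mt) p : charted_ok N ->
  smap_at (fun q => incl (f q)) p -> smap_at f p.
Proof.
move=> okN si; split; first by apply: into_subspace_continuous; exact: si.1.
move=> a c aa ac ap cp.
have hc := level_is_chart_atlas ac.
have [U [sigma [psi [tr Uq pq]]]] := trivialization_pos (f p).
have [y ay yq] := okM.2 (tau (incl (f p))).
pose e := level_chart U sigma psi y (f p).
have he : is_chart e := level_is_chart (f p) tr ay.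
have ef : dom e (f p) by [].
have st : smap_at (fun q => tau (incl (f q))) p by exact: (smap_at_comp okN okP fP si (tauS _)).
have cf : {for p, continuous f} by apply: into_subspace_continuous; exact: si.1.
have nb : nbhs p (f @^-1` dom e).
  by apply: cf; exact: (open_nbhs_nbhs (conj (chart_dom_open he) ef)).
apply: (@smooth_at_near_eq _ _ _ (fun x => fwd c (inv e (loc_rep (fun q => tau (incl (f q))) a y x)))).
  apply: filterS (chart_near (okN.1 a aa) ap nb) => x [ex ax xx].
  by rewrite /loc_rep -[fwd y _]/(fwd e (f (inv a x))) (chart_fwdK he ex).
apply: (smooth_at_comp (g := fun z => fwd c (inv e z)) fM); first exact: st.2 aa ay ap yq.
rewrite (loc_rep_fwd okN) //.
exact: (level_transition_smooth tr ay ac cp ef).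
Qed.

Lemma level_id_smap_at (q : Mt) : smap_at (fun q : Mt => q) q.
Proof. by apply: (into_level_smap_at level_ok); exact: incl_smap_at. Qed.

Lemma level_manifold : smooth_manifold Mt.
Proof.
split.
- exact: subspace_hausdorff_type (mfd_hausdorff hP).
- exact: subspace_second_countable (mfd_second_countable hP).
- by move=> c; exact: level_is_chart_atlas.
- by move=> q; exact: level_ok.2.
- move=> c d ac ad; apply: smooth_on_at => x /(cdomE (level_is_chart_atlas ac)) [q [cq dq <-]].
  exact: (level_id_smap_at q).2 ac ad cq dq.
Qed.

End LevelSet.

(** * Sheets of the double cover *)

Section Sheets.
Context {R : realType} {m k : nat}.
Local Notation EM := 'rV[R]_m.
Local Notation EP := 'rV[R]_k.
Context {M : charted EM} {P : charted EP}.
Variables (tau : P -> M) (h : R -> P -> P) (omega : form 2 P) (s : P -> R).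
Hypotheses (hM : smooth_manifold M) (hP : smooth_manifold P).
Hypotheses (sb : symplectic_bundle tau h omega) (hs : calibration h s).

Let okM := smooth_manifold_ok hM.
Let okP := smooth_manifold_ok hP.
Let pb := sb_principal sb.
Let fP : fin_dim EP := fin_dim_rV k.
Let fM : fin_dim EM := fin_dim_rV m.
Local Notation L := (line : charted (R^o : normedModType R)).
Local Notation Mt := (subcharted EM [set q : P | s q = 1]).
Local Notation th := (liouville h omega).
Local Notation incl := (@incl R m k P s).
Local Notation proj := (fun q : Mt => tau (incl q)).
Let tauS := tau_smap_at hM hP sb.
Let thF : diff_form setT th := liouville_form hP sb.

Section Pullbacks.
Context {F : normedModType R} {N : charted F}.
Hypothesis okN : charted_ok N.

Lemma pullback_liouvilleE (f : N -> P) c d q v : smap_at f q -> atlas N c -> atlas P d ->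
  dom c q -> dom d (f q) -> pullback f th c (fwd c q) v = th d (fwd d (f q)) (fun=> tmap f c d q (v ord0)).
Proof.
move=> sf ac ad cq dq; rewrite (pullbackE okN hP v thF I sf ac ad cq dq).
by rewrite form1E.
Qed.

Lemma pullback_near_eq (f g : N -> P) c q v : (\forall q' \near q, f q' = g q') -> smap_at f q ->
  atlas N c -> dom c q -> pullback f th c (fwd c q) v = pullback g th c (fwd c q) v.
Proof.
move=> fg sf ac cq; have [d ad dq] := okP.2 (f q).
have sg := smap_at_near_eq okN fg sf.
have fgq := nbhs_singleton fg.
have dgq : dom d (g q) by rewrite -fgq.
rewrite (pullback_liouvilleE v sf ac ad cq dq) (pullback_liouvilleE v sg ac ad cq dgq).
by rewrite (tmap_near_eq okN ac ad cq dq fg sf) fgq.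
Qed.

Lemma pullback_push (t : R) (f : N -> P) c q v : t != 0 -> smap_at f q -> atlas N c -> dom c q ->
  pullback (fun q => h t (f q)) th c (fwd c q) v = t * pullback f th c (fwd c q) v.
Proof.
move=> t0 sf ac cq; have [d ad dq] := okP.2 (f q); have [e ae eq] := okP.2 (h t (f q)).
have sh := h_smap_at hP sb (f q) t0.
have shf : smap_at (fun q => h t (f q)) q by exact: (smap_at_comp okN okP fP sf sh).
rewrite (pullback_liouvilleE v shf ac ae cq eq) (pullback_liouvilleE v sf ac ad cq dq).
rewrite (tmap_comp okN okP _ ac ad ae cq dq eq sf sh).
exact: (liouville_push hP sb _ t0 ad ae dq eq).
Qed.

Lemma pullback_liouville_comp (U : set M) (f : N -> M) (g : M -> P) c q v :
  diff_form U (pullback g th) -> U (f q) -> smap_at f q -> smap_at g (f q) -> atlas N c -> dom c q ->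
  pullback (fun q => g (f q)) th c (fwd c q) v = pullback f (pullback g th) c (fwd c q) v.
Proof.
move=> da Uf sf sg ac cq; have [d ad dq] := okM.2 (f q); have [e ae eq] := okP.2 (g (f q)).
have sgf : smap_at (fun q => g (f q)) q by exact: (smap_at_comp okN okM fM sf sg).
rewrite (pullback_liouvilleE v sgf ac ae cq eq) (pullbackE okN hM v da Uf sf ac ad cq dq).
rewrite (pullbackE okM hP _ thF I sg ad ae dq eq).
by rewrite [RHS]form1E (tmap_comp okN okM _ ac ad ae cq dq eq sf sg).
Qed.

Lemma pullback_distr_liouville (C : distribution M) (f : N -> P) c q v :
  distr_eq_on setT C (image_distr tau (kernel_of th)) -> smap_at f q -> atlas N c -> dom c q ->
  pullback_distr (fun q => tau (f q)) C c (fwd c q) v <-> kernel_of (pullback f th) c (fwd c q) v.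
Proof.
move=> hC sf ac cq; have [e ae eq] := okP.2 (f q).
rewrite /kernel_of (pullback_liouvilleE _ sf ac ae cq eq) /pullback_distr (chart_fwdK (okN.1 c ac) cq).
have H d : atlas M d -> dom d (tau (f q)) -> C d (loc_rep (fun q => tau (f q)) c d (fwd c q))
    ('d (loc_rep (fun q => tau (f q)) c d) (fwd c q) v) <-> th e (fwd e (f q)) (fun=> tmap f c e q v) = 0.
  move=> ad dq; rewrite (loc_rep_fwd okN) // -[X in C _ _ X]/(tmap (fun q => tau (f q)) c d q v).
  rewrite (tmap_comp okN okP v ac ae ad cq eq dq sf (tauS _)).
  exact: (distr_tau hM hP sb hs _ hC ae ad eq dq).
split=> [[d [ad dq /H]]|]; first exact.
have [d ad dq] := okM.2 (tau (f q)).
by move=> /(H d ad dq) Cd; exists d.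
Qed.

End Pullbacks.

Section LocalSection.
Variables (U : set M) (sigma : M -> P) (psi : P -> L).
Hypothesis tr : trivialization tau h s U sigma psi.

Lemma section_tmapK c d q v : atlas M c -> atlas P d -> U q -> dom c q -> dom d (sigma q) ->
  tmap tau d c (sigma q) (tmap sigma c d q v) = v.
Proof.
move=> ac ad Uq cq dq; have ss := triv_sec_smooth tr Uq.
have ct : dom c (tau (sigma q)) by rewrite (triv_sec tr Uq).
rewrite -(tmap_comp okM okP v ac ad ac cq dq ct ss (tauS _)).
have E1 : \forall q' \near q, tau (sigma q') = q'.
  have nU : nbhs q U by apply: open_nbhs_nbhs; split => //; exact: triv_open tr.
  by apply: filterS nU => q' Uq'; exact: (triv_sec tr).
have st : smap_at (fun q => tau (sigma q)) q by exact: (smap_at_comp okM okP fP ss (tauS _)).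
by rewrite (tmap_near_eq okM ac ac cq ct E1 st) (tmap_id okM).
Qed.

(** Each tangent vector of [U] is the projection of its image under the derivative of [sigma], so
    [distr_tau] can be read at the point [sigma q]. *)
Lemma section_induces (C : distribution M) : distr_eq_on setT C (image_distr tau (kernel_of th)) ->
  distr_eq_on U C (kernel_of (pullback sigma th)).
Proof.
move=> hC c x v ac /(cdomE (okM.1 c ac)) [q [cq Uq <-]].
have [d ad dq] := okP.2 (sigma q); have ss := triv_sec_smooth tr Uq.
rewrite /kernel_of (pullback_liouvilleE okM _ ss ac ad cq dq).
have ct : dom c (tau (sigma q)) by rewrite (triv_sec tr Uq).
have := distr_tau hM hP sb hs (tmap sigma c d q v) hC ad ac dq ct.
by rewrite section_tmapK // (triv_sec tr Uq).
Qed.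

Lemma section_form : diff_form U (pullback sigma th).
Proof.
apply: (pullback_form okM hP fP openT thF (triv_open tr) _ _ fM).
  by move=> q Uq; split => //; exact: (triv_sec_smooth tr Uq).
by move=> q _; exact: smap_at_id.
Qed.

Definition sheet : set Mt := [set q | U (tau (incl q)) /\ 0 < (psi (incl q) : R)].

Lemma proj_smap_at (q : Mt) : smap_at proj q.
Proof. exact: (smap_at_comp (level_ok hM hP sb hs) okP fP (incl_smap_at hP q) (tauS _)). Qed.

Lemma sheet_open : open sheet.
Proof.
rewrite openE => q [Uq pq]; apply: filterI.
  by apply: (smap_at_near (proj_smap_at q)); apply: open_nbhs_nbhs; split => //; exact: triv_open tr.
have n : nbhs (incl q) (psi @^-1` [set t : R | 0 < t]).
  apply: (smap_at_near (triv_smooth tr Uq)); apply: open_nbhs_nbhs; split => //; exact: open_gt.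
exact: (set_val_continuous n).
Qed.

Lemma sheet_diffeo (q0 : Mt) : diffeo_on sheet U proj.
Proof.
have lE q : U q -> incl (lift_level q0 (sigma q)) = sigma q.
  by move=> Uq; rewrite lift_levelK // (sec_level tr Uq).
exists (fun q => lift_level q0 (sigma q)); split.
- split.
    by apply/(smooth_map_onP (level_ok hM hP sb hs) okM _ sheet_open) => q _; exact: proj_smap_at.
  apply/(smooth_map_onP okM (level_ok hM hP sb hs) _ (triv_open tr)) => q Uq.
  apply: (into_level_smap_at hM hP sb hs okM).
  apply: (smap_at_near_eq okM _ (triv_sec_smooth tr Uq)).
  have nU : nbhs q U by apply: open_nbhs_nbhs; split => //; exact: triv_open tr.
  by apply: filterS nU => q' Uq'; rewrite lE.
- by move=> q [].
- by move=> q Uq; rewrite /sheet /= lE // (triv_sec tr Uq) (triv_sec1 tr Uq); split => //; exact: ltr01.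
- by move=> q [Uq pq]; apply: incl_inj; rewrite lE // (level_sec sb tr Uq pq).
- by move=> q Uq; rewrite lE // (triv_sec tr Uq).
Qed.

(** On this open sheet the inclusion coincides with [sigma o proj], and pullback is functorial. *)
Lemma sheet_form : form_eq_on sheet (pullback incl th) (pullback proj (pullback sigma th)).
Proof.
have okT := level_ok hM hP sb hs.
move=> c x v ac /(cdomE (okT.1 c ac)) [q [cq [Uq pq] <-]].
rewrite -(pullback_liouville_comp okT v section_form Uq (proj_smap_at q) (triv_sec_smooth tr Uq) ac cq).
apply: (pullback_near_eq okT _ _ (incl_smap_at hP q) ac cq).
have ns : nbhs q sheet by apply: open_nbhs_nbhs; split => //; exact: sheet_open.
by apply: filterS ns => q' [Uq' pq']; rewrite (level_sec sb tr Uq' pq').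
Qed.

Lemma section_opp_form : form_eq_on U (pullback (fun q => h (-1) (sigma q)) th) (form_scale (-1) (pullback sigma th)).
Proof.
move=> c x v ac /(cdomE (okM.1 c ac)) [q [cq Uq <-]].
have n0 : (-1 : R) != 0 by rewrite oppr_eq0 oner_neq0.
exact: (pullback_push okM v n0 (triv_sec_smooth tr Uq) ac cq).
Qed.

End LocalSection.

(** On the level set [psi] has absolute value 1, so where it is positive on [sigma'] it equals 1 and
    the two sections coincide. *)
Lemma section_transition U sigma psi U' sigma' psi' (x : M) :
  trivialization tau h s U sigma psi -> trivialization tau h s U' sigma' psi' ->
  U x -> U' x -> 0 < (psi (sigma' x) : R) ->
  exists V, [/\ open V, V x, V `<=` U `&` U' & form_eq_on V (pullback sigma th) (pullback sigma' th)].
Proof.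
move=> tr tr' Ux U'x px.
pose V := [set y | [/\ U y, U' y & 0 < (psi (sigma' y) : R)]].
have oV : open V.
  rewrite openE => y [Uy U'y py].
  have n1 : nbhs y U by apply: open_nbhs_nbhs; split => //; exact: triv_open tr.
  have n2 : nbhs y U' by apply: open_nbhs_nbhs; split => //; exact: triv_open tr'.
  have n3 : nbhs y ((fun y => psi (sigma' y)) @^-1` [set t : R | 0 < t]).
    apply: (smap_at_near (triv_sec_smooth tr' U'y) (A := psi @^-1` [set t : R | 0 < t])).
    have Uty : U (tau (sigma' y)) by rewrite (triv_sec tr' U'y).
    apply: (smap_at_near (triv_smooth tr Uty)); apply: open_nbhs_nbhs; split => //; exact: open_gt.
  apply: filterS3 n1 n2 n3 => z Uz U'z pz; split; [exact: Uz|exact: U'z|exact: pz].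
exists V; split; [exact: oV|split; [exact: Ux|exact: U'x|exact: px]|by move=> y []|].
move=> c z v ac /(cdomE (okM.1 c ac)) [y [cy Vy <-]].
have [Uy _ _] := Vy.
apply: (pullback_near_eq okM _ _ (triv_sec_smooth tr Uy) ac cy).
have nV : nbhs y V by exact: (open_nbhs_nbhs (conj oV Vy)).
apply: filterS nV => y' [Uy' U'y py].
have Uty : U (tau (sigma' y')) by rewrite (triv_sec tr' U'y).
have s1 : s (sigma' y') = 1 := sec_level tr' U'y.
have p1 : (psi (sigma' y') : R) = 1 by rewrite -s1 (triv_calib tr Uty) gtr0_norm.
have := triv_act tr Uty; rewrite (triv_sec tr' U'y) p1 (act_one pb).
by [].
Qed.

End Sheets.

Theorem corollary5p5 (R : realType) (n : nat)
    (M : charted 'rV[R]_(2 * n).+1) (C : distribution M)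
    (P : charted 'rV[R]_(2 * n).+2) (tau : P -> M) (h : R -> P -> P)
    (omega : form 2 P) (s : P -> R)
    (hM : smooth_manifold M) (hC : contact_structure C)
    (hP : smooth_manifold P) (hcover : symplectic_cover tau h omega C)
    (hs : calibration h s) :
  let Mt := subcharted 'rV[R]_(2 * n).+1 [set q : P | s q = 1] in
  let incl : Mt -> P := fun q => set_val q in
  let p : Mt -> M := fun q => tau (incl q) in
  let eta_t : form 1 Mt := pullback incl (liouville h omega) in
  [/\ smooth_manifold Mt,
      contact_structure (pullback_distr p C),
      contact_form setT eta_t,
      induces setT eta_t (pullback_distr p C) &
      exists (I : Type) (U : I -> set M) (eta : I -> form 1 M),
        [/\ (forall i, open (U i)) /\ (forall x : M, exists i, U i x),
            (forall i, contact_form (U i) (eta i) /\ induces (U i) (eta i) C),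
            (forall i, exists Wp Wm : set Mt,
               [/\ open Wp /\ open Wm,
                   Wp `|` Wm = p @^-1` U i,
                   Wp `&` Wm = set0,
                   diffeo_on Wp (U i) p /\ diffeo_on Wm (U i) p &
                   form_eq_on Wp eta_t (pullback p (eta i)) /\
                   form_eq_on Wm eta_t (form_scale (-1) (pullback p (eta i)))]) &
            (forall i j (x : M), U i x -> U j x ->
               exists V : set M,
                 [/\ open V, V x, V `<=` U i `&` U j &
                     form_eq_on V (eta i) (eta j) \/
                     form_eq_on V (eta i) (form_scale (-1) (eta j))])]].
Proof.
move=> Mt incl p eta_t; have [sb hCC] := hcover.
have okT : charted_ok Mt := level_ok hM hP sb hs.
have okM := smooth_manifold_ok hM; have okP := smooth_manifold_ok hP.
have cT : contact_form setT eta_t.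
  apply: (pullback_contact hP sb hs (f := incl) erefl okT _ openT).
  - by move=> q _; exact: (level_id_smap_at hM hP sb hs).
  - by move=> q _; split; [exact: (incl_smap_at hP)|exact: incl_level].
  - by move=> q c d _; exact: incl_tmap_inj.
have iT : induces setT eta_t (pullback_distr p C).
  move=> c x v ac /(cdomE (okT.1 c ac)) [q [cq _ <-]].
  exact: (pullback_distr_liouville hM hP sb hs okT v hCC (incl_smap_at hP q) ac cq).
split => //; first exact: (level_manifold hM hP sb hs).
  by move=> q; exists setT, eta_t; split => //; exact: openT.
(* One trivialization is chosen around each point, so the covering is indexed by [M] itself. *)
have /choice[T HT] : forall x : M, exists T : set M * (M -> P) * (P -> (line : charted (R^o : normedModType R))),
    trivialization tau h s T.1.1 T.1.2 T.2 /\ T.1.1 x.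
  move=> x; have [U [sigma [psi H]]] := local_trivialization hM hP sb hs x.
  by exists (U, sigma, psi).
pose U x := (T x).1.1; pose sigma x := (T x).1.2; pose psi x := (T x).2.
have tr x : trivialization tau h s (U x) (sigma x) (psi x) := (HT x).1.
have Ux x : U x x := (HT x).2.
have n0 : (-1 : R) != 0 by rewrite oppr_eq0 oner_neq0.
have trN x := trivialization_opp hM hP sb (tr x).
exists M, U, (fun x => pullback (sigma x) (liouville h omega)); split.
- by split=> [x|x]; [exact: triv_open (tr x)|exists x].
- move=> x; split; last exact: (section_induces hM hP sb hs (tr x) hCC).
  apply: (pullback_contact hP sb hs (f := sigma x) erefl okM _ (triv_open (tr x))).
  + by move=> q _; exact: smap_at_id.
  + by move=> q Uq; split; [exact: (triv_sec_smooth (tr x) Uq)|exact: (sec_level (tr x) Uq)].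
  + move=> q c d Uq ac ad cq dq.
    by apply: (can_inj (g := tmap tau d c (sigma x q))) => v; exact: (section_tmapK hM hP sb (tr x)).
- move=> x; exists (sheet (m := (2 * n).+1) tau (s := s) (U x) (psi x)), (sheet (m := (2 * n).+1) tau (s := s) (U x) (fun p => - (psi x p : R) : line)).
  (* [sheet_diffeo] needs a default point of the level set; the value of the section at [x] provides
     it. *)
  have [q0 _] : exists q0 : Mt, True.
    by exists (exist _ (sigma x x) (mem_set (sec_level (tr x) (Ux x)))).
  split.
  + by split; [exact: (sheet_open hM hP sb hs (tr x))|exact: (sheet_open hM hP sb hs (trN x))].
  + apply/seteqP; split=> [q [[]|[]]//|q Uq].
    have := triv_neq0 (tr x) Uq; case: (ltgtP (psi x (incl q) : R) 0) => // p0 _; [right|left]; split => //.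
    by rewrite oppr_gt0.
  + by apply/seteqP; split=> // q [[_ p0] [_]]; rewrite oppr_gt0 => /(lt_trans p0); rewrite ltxx.
  + by split; [exact: (sheet_diffeo hM hP sb hs (tr x) q0)|exact: (sheet_diffeo hM hP sb hs (trN x) q0)].
  + split; first exact: (sheet_form hM hP sb hs (tr x)).
    (* On the sheet [psi < 0] the inclusion is [h (-1) o sigma o p], and pulling [theta] back by
       [h (-1)] produces the sign. *)
    move=> c z v ac /(cdomE (okT.1 c ac)) [q [cq Wq <-]].
    have Uq : U x (p q) by case: Wq.
    have sp := proj_smap_at hM hP sb hs q.
    have ss := triv_sec_smooth (tr x) Uq.
    have sps : smap_at (fun q => sigma x (p q)) q.
      exact: (smap_at_comp okT okM (fin_dim_rV _) sp ss).
    apply: (etrans (sheet_form hM hP sb hs (trN x) v ac (cdom_fwd (okT.1 c ac) cq Wq))).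
    apply: (etrans (esym (pullback_liouville_comp hM hP sb okT v (section_form hM hP sb (trN x)) Uq sp (triv_sec_smooth (trN x) Uq) ac cq))).
    apply: (etrans (pullback_push hP sb okT v n0 sps ac cq)).
    exact: (congr1 (fun r => -1 * r) (pullback_liouville_comp hM hP sb okT v (section_form hM hP sb (tr x)) Uq sp ss ac cq)).
move=> i j x Uix Ujx.
(* The sign of [psi i] on [sigma j] at [x] decides between the two cases; if it is negative, the
   opposite section of index [i] is compared with [sigma j]. *)
have Uit : U i (tau (sigma j x)) by rewrite (triv_sec (tr j) Ujx).
have := triv_neq0 (tr i) Uit; case: (ltgtP (psi i (sigma j x) : R) 0) => // p0 _; last first.
  have [V [oV Vx VU VE]] := section_transition hM hP sb (tr i) (tr j) Uix Ujx p0.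
  by exists V; split => //; left.
rewrite -oppr_gt0 in p0.
have [V [oV Vx VU VE]] := section_transition hM hP sb (trN i) (tr j) Uix Ujx p0.
exists V; split => //; right => c z v ac Vz.
rewrite /form_scale -(VE c z v ac Vz).
have Uz : cdom (U i) c z by case: Vz => ? /VU[]; split.
have := section_opp_form hM hP sb (tr i) v ac Uz; rewrite /form_scale => ->.
by rewrite !mulN1r opprK.
Qed.
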